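(* Let $A$ be a locally unital graded algebra that is locally finite-dimensional and bounded below, equipped with a graded triangular basis. For $b\in\mathbf B$, the indecomposable projective module $P(b)$ has a $\Delta$-flag, with $$(P(b):\Delta(a))_q=\overline{[\bar\nabla(a):L(b)]_q}$$ for all $a\in\mathbf B$. If the graded triangular basis admits a duality, then $(P(b):\Delta(a))_q=[\bar\Delta(a):L(b)]_q$.
   Context: Conventions. $\Bbbk$ is an algebraically closed field; all algebras, categories and functors are $\Bbbk$-linear; graded means $\mathbb Z$-graded. For a graded vector space $V$, $qV$ is the shift $(qV)_d=V_{d-1}$; $\dim_qV=\sum_d(\dim V_d)q^d$; for a formal series $f=\sum_dr_dq^d$ put $\overline f=\sum_dr_dq^{-d}$. A locally unital graded algebra is a graded associative algebra $A=\bigoplus_{i,j\in\mathbf I}1_iA1_j$ with a given family of mutually orthogonal homogeneous idempotents $1_i$ $(i\in\mathbf I)$. Graded left modules are locally unital: $V=\bigoplus_{i}1_iV$. $A$-gmod is the abelian category of graded left $A$-modules with degree-preserving homomorphisms. $\operatorname{Hom}_A(V,W)=\bigoplus_{d\in\mathbb Z}\operatorname{Hom}_A(V,W)_d$, where $\operatorname{Hom}_A(V,W)_d$ is the space of $A$-module homomorphisms $f$ with $f(V_n)\subseteq W_{n+d}$ for all $n$. $V$ is locally finite-dimensional if $\dim 1_iV_d<\infty$ for all $i,d$; bounded below if for each $i$ there is $N_i$ with $1_iV_d=0$ for $d<N_i$. $A$ is locally finite-dimensional and bounded below if all $(1_iA1_j)_d$ are finite-dimensional and, for all $i,j$, $(1_iA1_j)_d=0$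 for $d\ll 0$. For $V$ locally finite-dimensional and $L$ irreducible, $[V:L]_q=\sum_dm_dq^d$ where $m_d$ is the maximum, over all finite filtrations of $V$ by graded submodules, of the number of sections isomorphic to $q^dL$. Graded triangular basis. For such $A$ this is the following data: a subset $\mathbf S\subseteq\mathbf I$; a poset $(\Lambda,\leq)$ that is lower finite (each $\{\mu\in\Lambda:\mu\leq\lambda\}$ is finite); a function $\mathbf S\to\Lambda$, $s\mapsto\dot s$, with finite (possibly empty) fibers $\mathbf S_\lambda$; homogeneous sets $\mathrm X(i,s)\subset1_iA1_s$, $\mathrm H(s,t)\subset1_sA1_t$, $\mathrm Y(t,j)\subset1_tA1_j$ for $i,j\in\mathbf I$, $s,t\in\mathbf S$. With $\mathrm X(s)=\bigcup_i\mathrm X(i,s)$, $\mathrm Y(t)=\bigcup_j\mathrm Y(t,j)$, the axioms are: (A1) the products $xhy$ for $(x,h,y)\in\bigcup_{s,t\in\mathbf S}\mathrm X(s)\times\mathrm H(s,t)\times\mathrm Y(t)$ form a basis of $A$; (A2) $\mathrm X(s,s)=\mathrm Y(s,s)=\{1_s\}$ for $s\in\mathbf S$; (A3) for $s\neq t$ in $\mathbf S$: $\mathrm X(s,t)\neq\varnothing\Rightarrow\dot s>\dot t$, $\mathrm H(s,t)\neq\varnothing\Rightarrow\dot s=\dot t$, $\mathrm Y(s,t)\neq\varnothing\Rightarrow\dot s<\dot t$; (A4) for each $i\in\mathbf I-\mathbf S$, the sets $\{s\in\mathbf S:\mathrm X(i,s)\neq\varnothing\}$ and $\{s\in\mathbf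 S:\mathrm Y(s,i)\neq\varnothing\}$ are finite. Functors. For $\lambda\in\Lambda$ let $e_\lambda=\sum_{s\in\mathbf S_\lambda}1_s$; let $A_{\geq\lambda}$ be the quotient of $A$ by the two-sided ideal generated by all $e_\mu$ with $\mu\not\geq\lambda$ (with idempotents the images $\bar1_i$), let $\bar e_\lambda$ be the image of $e_\lambda$ in it, and let $A_\lambda=\bar e_\lambda A_{\geq\lambda}\bar e_\lambda$, a unital graded algebra. Let $j^\lambda:A_{\geq\lambda}\text{-gmod}\to A_\lambda\text{-gmod}$, $V\mapsto\bar e_\lambda V$, with left adjoint $j^\lambda_!=A_{\geq\lambda}\bar e_\lambda\otimes_{A_\lambda}-$ and right adjoint $j^\lambda_*=\bigoplus_{i\in\mathbf I}\operatorname{Hom}_{A_\lambda}(\bar e_\lambda A_{\geq\lambda}\bar1_i,-)$. $A_{\geq\lambda}$-modules are viewed as $A$-modules by inflation. Modules. Fix a set $\mathbf B=\coprod_{\lambda\in\Lambda}\mathbf B_\lambda$ such that $L_\lambda(b)$ $(b\in\mathbf B_\lambda)$ is a full set of irreducible graded left $A_\lambda$-modules up to isomorphism and degree shift. Let $P_\lambda(b)$ be a projective cover of $L_\lambda(b)$ in $A_\lambda$-gmod. For $b\in\mathbf B_\lambda$, $\Delta(b)=j^\lambda_!P_\lambda(b)$, $\bar\Delta(b)=j^\lambda_!L_\lambda(b)$, $\bar\nabla(b)=j^\lambda_*L_\lambda(b)$, viewed as graded $A$-modules. $L(b)$ is the unique irreducible graded quotient of $\Delta(b)$; the $L(b)$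 $(b\in\mathbf B)$ form a full set of irreducible graded left $A$-modules up to isomorphism and degree shift. $P(b)$ is a projective cover of $L(b)$ in $A$-gmod. Flags. A $\Delta$-layer of type $\lambda$ is a graded $A$-module isomorphic to $j^\lambda_!\bar V$ for a projective graded left $A_\lambda$-module $\bar V$ that is locally finite-dimensional and bounded below. $V$ has a $\Delta$-flag if for some $n\geq0$ there is a graded filtration $0=V_0\subset V_1\subset\dots\subset V_n=V$ and distinct $\lambda_1,\dots,\lambda_n\in\Lambda$ such that $V_r/V_{r-1}$ is a $\Delta$-layer of type $\lambda_r$ for each $r$. For such $V$, $(V:\Delta(a))_q:=\overline{\dim_q\operatorname{Hom}_A(V,\bar\nabla(a))}$, which is the total graded multiplicity of $\Delta(a)$ as a summand of the layers. Duality. The graded triangular basis is said to admit a duality $\tau$ if $A$ admits a graded algebra anti-automorphism $\tau:A\to A$ fixing each $1_i$ $(i\in\mathbf I)$.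
   Formalization: The duality formula is proved only when L(a) and L(b) are each isomorphic, up to one common degree shift, to their graded duals twisted by τ; with representatives L_λ(b) chosen only up to shift, the formula as stated can fail (q versus q^{-1}). *)

(* Defs.v *)
From HB Require Import structures.
From mathcomp Require Import all_boot all_order all_algebra.
From mathcomp Require Import finmap boolp classical_sets functions.
From mathcomp Require Import freeg.

Set Implicit Arguments.
Unset Strict Implicit.
Unset Printing Implicit Defensive.

Import GRing.Theory.
Local Open Scope ring_scope.

Section LinearAlgebra.
Variables (k : fieldType) (V : lmodType k).
Implicit Type P : V -> Prop.

Inductive in_span P : V -> Prop :=
| in_span0 : in_span P 0
| in_spanD a v w : P v -> in_span P w -> in_span P (a *: v + w).

Lemma in_span1 P v : P v -> in_span P v.
Proof. by move=> Pv; rewrite -[v]addr0 -[v]scale1r; apply: in_spanD => //; left. Qed.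

Lemma in_span_closed P a u v :
  in_span P u -> in_span P v -> in_span P (a *: u + v).
Proof.
move=> + hv; elim=> [|b x y Px _ IH]; first by rewrite scaler0 add0r.
by rewrite scalerDr scalerA -addrA; apply: in_spanD.
Qed.

Lemma in_span_D P u v : in_span P u -> in_span P v -> in_span P (u + v).
Proof. by move=> hu hv; rewrite -[u]scale1r; apply: in_span_closed. Qed.

Lemma in_span_Z P a u : in_span P u -> in_span P (a *: u).
Proof. by move=> hu; rewrite -[_ *: u]addr0; apply: in_span_closed => //; left. Qed.

Definition subspace_axiom P : Prop :=
  P 0 /\ forall (a : k) u v, P u -> P v -> P (a *: u + v).

Lemma in_span_ind_sub P Q : subspace_axiom Q -> (forall v, P v -> Q v) ->
  forall v, in_span P v -> Q v.
Proof. by case=> Q0 QD PQ v; elim=> // a x y Px _; apply: QD => //; apply: PQ. Qed.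

Lemma in_span_axiom P : subspace_axiom (in_span P).
Proof. by split; [left|move=> *; apply: in_span_closed]. Qed.

Section Bundle.
Variables (P : V -> Prop) (hP : subspace_axiom P).
Definition subspace_pred : {pred V} := fun v => `[< P v >].
Lemma subspace_closed : submod_closed subspace_pred.
Proof.
case: hP => P0 PD; split; first exact/asboolP.
by move=> a u v /asboolP hu /asboolP hv; apply/asboolP/PD.
Qed.
Definition subspace : submodClosed V :=
  HB.pack subspace_pred (GRing.isSubmodClosed.Build k V subspace_pred subspace_closed).
Lemma subspaceP v : reflect (P v) (v \in subspace).
Proof. exact: asboolP. Qed.
End Bundle.

Definition span P : submodClosed V := subspace (in_span_axiom P).

Lemma submod_axiom (U : submodClosed V) : subspace_axiom (fun v => v \in U).
Proof. by split; [exact: rpred0|move=> a u v hu hv; rewrite rpredD// rpredZ]. Qed.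

(* A basis of the subspace P with n elements; the zero space has n = 0. *)
Definition has_dim P (n : nat) : Prop :=
  exists b : 'I_n -> V,
    [/\ forall i, P (b i),
        forall c : 'I_n -> k, \sum_i c i *: b i = 0 -> forall i, c i = 0 &
        forall v, P v -> exists c : 'I_n -> k, v = \sum_i c i *: b i].

Definition fin_dim P : Prop := exists n, has_dim P n.

(* The family (f t), t in D, is a basis of V (f is in particular injective
   on D). *)
Definition is_basis (T : eqType) (D : T -> Prop) (f : T -> V) : Prop :=
  (forall v, in_span (fun u => exists2 t, D t & u = f t) v) /\
  (forall (s : seq T) (c : T -> k), uniq s -> (forall t, t \in s -> D t) ->
     \sum_(t <- s) c t *: f t = 0 -> forall t, t \in s -> c t = 0).

Lemma submodB (U : submodClosed V) u v : u \in U -> v \in U -> u - v \in U.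
Proof. by move=> hu hv; rewrite -scaleN1r rpredD// rpredZ. Qed.

Definition mem_fun (U : submodClosed V) : V -> bool := fun v => v \in U.
Lemma submod_zmod_closed (U : submodClosed V) : zmod_closed (mem_fun U).
Proof. by split=> [|u v]; [exact: rpred0|exact: submodB]. Qed.
Definition submod_zmod (U : submodClosed V) : zmodClosed V :=
  HB.pack (mem_fun U)
    (GRing.isZmodClosed.Build V (mem_fun U) (submod_zmod_closed U)).

End LinearAlgebra.

Record subm (k : fieldType) (V : lmodType k) (U : submodClosed V) :=
  Subm { subm_val :> V; submP : subm_val \in U }.
HB.instance Definition _ (k : fieldType) (V : lmodType k) (U : submodClosed V) :=
  [isSub for @subm_val k V U].
HB.instance Definition _ (k : fieldType) (V : lmodType k) (U : submodClosed V) :=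
  [Choice of subm U by <:].
HB.instance Definition _ (k : fieldType) (V : lmodType k) (U : submodClosed V) :=
  [SubChoice_isSubLmodule of subm U by <:].

Section QuotientSpace.
Variables (k : fieldType) (V : lmodType k) (U : submodClosed V).
Local Open Scope quotient_scope.

Definition quotm := Quotient.quot (submod_zmod U).
HB.instance Definition _ := GRing.Zmodule.on quotm.

Definition qpi (v : V) : quotm := \pi_(Quotient.quot (submod_zmod U)) v.
Definition qrepr (x : quotm) : V := repr (x : Quotient.quot (submod_zmod U)).

Lemma qreprK x : qpi (qrepr x) = x.
Proof. exact: reprK. Qed.

Lemma qpi_eq u v : (qpi u = qpi v) <-> (u - v \in U).
Proof.
have -> : (u - v \in U) = (u - v \in submod_zmod U) by [].
by rewrite Quotient.idealrBE; split=> /eqP.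
Qed.

Lemma qpiD u v : qpi (u + v) = qpi u + qpi v.
Proof. exact: raddfD. Qed.

Definition qscale (a : k) (x : quotm) : quotm := qpi (a *: qrepr x).
Lemma qpiZ_ a v : qpi (a *: v) = qscale a (qpi v).
Proof. by apply/qpi_eq; rewrite -scalerBr rpredZ//; apply/qpi_eq; rewrite qreprK. Qed.

Fact qscaleA a b x : qscale a (qscale b x) = qscale (a * b) x.
Proof. by rewrite -[x]qreprK -!qpiZ_ scalerA. Qed.
Fact qscale1 : left_id 1 qscale.
Proof. by move=> x; rewrite -[x]qreprK -!qpiZ_ scale1r. Qed.
Fact qscaleDr : right_distributive qscale +%R.
Proof. by move=> a x y; rewrite -[x]qreprK -[y]qreprK -qpiD -!qpiZ_ -qpiD scalerDr. Qed.
Fact qscaleDl x : {morph qscale^~ x : a b / a + b}.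
Proof. by move=> a b; rewrite -[x]qreprK -!qpiZ_ -qpiD scalerDl. Qed.
HB.instance Definition _ :=
  GRing.Zmodule_isLmodule.Build k quotm qscaleA qscale1 qscaleDr qscaleDl.

Lemma qpiZ a v : qpi (a *: v) = a *: qpi v.
Proof. exact: qpiZ_. Qed.
Lemma qpi_linear : linear qpi.
Proof. by move=> a u v; rewrite qpiD qpiZ. Qed.
HB.instance Definition _ := GRing.isLinear.Build k V quotm *:%R qpi qpi_linear.

Lemma qpi0 v : (qpi v = 0) <-> (v \in U).
Proof. by rewrite -[0](linear0 qpi) qpi_eq subr0. Qed.
End QuotientSpace.

(* A grading of V: an internal direct sum decomposition indexed by Z. *)
Record grading (k : fieldType) (V : lmodType k) := Grading {
  hcomp :> int -> submodClosed V;
  hcomp_span : forall v, in_span (fun u => exists d, u \in hcomp d) v;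
  hcomp_free : forall (f : int -> V) (s : seq int), uniq s ->
    (forall d, f d \in hcomp d) -> \sum_(d <- s) f d = 0 ->
    forall d, d \in s -> f d = 0 }.

Section Projections.
Variables (k : fieldType) (V : lmodType k) (G : grading V).

Let decomp (v : V) (f : int -> V) (s : seq int) : Prop :=
  [/\ uniq s, forall d, f d \in G d, forall d, d \notin s -> f d = 0 &
      v = \sum_(d <- s) f d].

Let sum_widen (f : int -> V) (s t : seq int) : uniq s -> uniq t ->
  {subset s <= t} -> (forall d, d \notin s -> f d = 0) ->
  \sum_(d <- s) f d = \sum_(d <- t) f d.
Proof.
move=> us ut st f0; rewrite [RHS](bigID (fun d => d \in s)) /=.
rewrite [X in _ = _ + X]big1; last by move=> d /f0.
rewrite addr0 -[RHS]big_filter; apply: perm_big; apply: uniq_perm => //.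
  exact: filter_uniq.
by move=> d; rewrite mem_filter; case: (boolP (d \in s)) => //= /st ->.
Qed.

Let decomp_widen v f s t : decomp v f s -> uniq t -> {subset s <= t} ->
  decomp v f t.
Proof.
move=> [us fG f0 ->] ut st; split=> // [d dt|]; last exact: sum_widen.
by apply: f0; apply: contra dt => /st.
Qed.

Let decomp_ex v : exists fs, decomp v fs.1 fs.2.
Proof.
elim: {v}(hcomp_span G v) => [|a v w [d vd] _ [[f s] /= D]].
  by exists (fun=> 0, [::]); split=> //= [d|]; [exact: rpred0|rewrite big_nil].
pose t := undup (d :: s).
have ut : uniq t by exact: undup_uniq.
have dt : d \in t by rewrite mem_undup mem_head.
have [|_ fG f0 ->] := decomp_widen D ut.
  by move=> e es; rewrite mem_undup inE es orbT.
exists (fun e => (if e == d then a *: v else 0) + f e, t); split=> //= [e|e et|].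
- by rewrite rpredD//; case: eqP => [->|_]; rewrite ?rpred0// rpredZ.
- by rewrite f0// addr0; case: eqP et => // ->; rewrite dt.
rewrite big_split /=; congr (_ + _); rewrite -big_mkcond /= -big_filter.
by rewrite filter_pred1_uniq// big_seq1.
Qed.

Let decomp_uniq v f g s t : decomp v f s -> decomp v g t -> f =1 g.
Proof.
move=> D E e; pose r := undup (e :: s ++ t).
have ur : uniq r by exact: undup_uniq.
have [|_ fG _ vf] := decomp_widen D ur.
  by move=> x xs; rewrite mem_undup inE mem_cat xs orbT.
have [|_ gG _ vg] := decomp_widen E ur.
  by move=> x xs; rewrite mem_undup inE mem_cat xs !orbT.
apply/eqP; rewrite -subr_eq0; apply/eqP.
apply: (hcomp_free (g := G) (f := fun d => f d - g d) ur) => [d||].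
- exact: submodB.
- by rewrite sumrB -vf -vg subrr.
- by rewrite mem_undup mem_head.
Qed.

Definition hproj (d : int) (v : V) : V := (projT1 (cid (decomp_ex v))).1 d.
Definition hsupp (v : V) : seq int := (projT1 (cid (decomp_ex v))).2.

Let hprojP v : decomp v (hproj ^~ v) (hsupp v).
Proof. by rewrite /hproj /hsupp; case: cid => -[]. Qed.

Lemma hproj_unique v f s : uniq s -> (forall d, f d \in G d) ->
  (forall d, d \notin s -> f d = 0) -> v = \sum_(d <- s) f d ->
  forall d, hproj d v = f d.
Proof. by move=> us fG f0 ve; apply: (@decomp_uniq v _ f _ s (hprojP v)). Qed.

Lemma hsupp_uniq v : uniq (hsupp v). Proof. by case: (hprojP v). Qed.
Lemma hproj_mem d v : hproj d v \in G d. Proof. by case: (hprojP v). Qed.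
Lemma hproj_out d v : d \notin hsupp v -> hproj d v = 0.
Proof. by case: (hprojP v) => _ _ h _ /h. Qed.
Lemma hproj_sum v : v = \sum_(d <- hsupp v) hproj d v.
Proof. by case: (hprojP v). Qed.

Lemma hproj_widen v (t : seq int) : uniq t -> {subset hsupp v <= t} ->
  v = \sum_(d <- t) hproj d v.
Proof.
move=> ut st; rewrite {1}[v]hproj_sum; apply: sum_widen => //.
- exact: hsupp_uniq.
- by move=> d; apply: hproj_out.
Qed.

Lemma hproj_linear d : linear (hproj d).
Proof.
move=> a u v; pose t := undup (hsupp u ++ hsupp v).
have ut : uniq t by exact: undup_uniq.
have su : {subset hsupp u <= t} by move=> x h; rewrite mem_undup mem_cat h.
have sv : {subset hsupp v <= t} by move=> x h; rewrite mem_undup mem_cat h orbT.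
apply: (hproj_unique (f := fun d => a *: hproj d u + hproj d v) ut) => [e|e et|].
- by rewrite rpredD ?rpredZ ?hproj_mem.
- rewrite !hproj_out ?scaler0 ?addr0//.
    by apply: contra et => /sv.
  by apply: contra et => /su.
- by rewrite big_split /= -scaler_sumr -!hproj_widen.
Qed.
HB.instance Definition _ d :=
  GRing.isLinear.Build k V V *:%R (hproj d) (hproj_linear d).

Lemma hproj_hom d e v : v \in G e -> hproj d v = if d == e then v else 0.
Proof.
move=> ve.
apply: (@hproj_unique v (fun d => if d == e then v else 0) [:: e]) => //.
- by move=> x; case: eqP => [->//|_]; exact: rpred0.
- by move=> x; rewrite inE; case: eqP.
- by rewrite big_seq1 eqxx.
Qed.

Lemma hproj_id d v : v \in G d -> hproj d v = v.
Proof. by move=> /(hproj_hom d) ->; rewrite eqxx. Qed.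

End Projections.

Section Gradings.
Variables (k : fieldType) (V : lmodType k).

(* A family of linear maps that looks like the projections of a direct sum
   decomposition: an auxiliary way of proving independence. *)
Lemma hcomp_free_of_proj (H : int -> submodClosed V)
    (p : int -> {linear V -> V}) :
  (forall d e v, v \in H e -> p d v = if d == e then v else 0) ->
  forall (f : int -> V) (s : seq int), uniq s ->
    (forall d, f d \in H d) -> \sum_(d <- s) f d = 0 ->
    forall d, d \in s -> f d = 0.
Proof.
move=> pH f s us fH sf d ds.
have := congr1 (p d) sf; rewrite linear0 linear_sum /=.
rewrite (eq_bigr (fun e => if e == d then f e else 0)); last first.
  by move=> e _; rewrite (pH d e)// eq_sym.
by rewrite -big_mkcond /= -big_filter filter_pred1_uniq// big_seq1.
Qed.

(* A graded subspace is one spanned by homogeneous elements of itself. *)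
Definition graded_sub (G : grading V) (U : submodClosed V) : Prop :=
  forall v, v \in U -> in_span (fun u => u \in U /\ exists d, u \in G d) v.

Lemma graded_sub_proj (G : grading V) U : graded_sub G U ->
  forall d v, v \in U -> hproj G d v \in U.
Proof.
move=> gU d v /gU; move: v; apply: in_span_ind_sub.
  split; first by rewrite linear0 rpred0.
  by move=> a x y hx hy; rewrite linearP rpredD// rpredZ.
by move=> u [uU [e ue]]; rewrite (hproj_hom _ ue); case: eqP; rewrite ?rpred0.
Qed.

Section SubGrading.
Variables (G : grading V) (U : submodClosed V) (gU : graded_sub G U).

Lemma subm_hcomp_axiom d :
  subspace_axiom (fun x : subm U => subm_val x \in G d).
Proof.
split; first exact: rpred0.
by move=> a u v hu hv; rewrite [subm_val _]/= rpredD// rpredZ.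
Qed.
Definition subm_hcomp d : submodClosed (subm U) := subspace (subm_hcomp_axiom d).

Lemma subm_hcompP d (x : subm U) : (x \in subm_hcomp d) = (subm_val x \in G d).
Proof. by apply/subspaceP/idP. Qed.

Lemma subm_hcomp_span v : in_span (fun u : subm U => exists d, u \in subm_hcomp d) v.
Proof.
case: v => v vU; pose Q := fun v => forall vU : v \in U,
  in_span (fun u : subm U => exists d, u \in subm_hcomp d) (Subm vU).
suff: Q v by apply.
have {1}-> := hproj_sum G v.
have hU d : hproj G d v \in U by exact: graded_sub_proj.
elim: (hsupp G v) => [|d s IH] sU.
  have -> : Subm sU = 0 by apply: val_inj; rewrite /= big_nil.
  by left.
have tU : \sum_(d <- s) hproj G d v \in U by rewrite rpred_sum.
have -> : Subm sU = 1 *: Subm (hU d) + Subm tU.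
  by apply: val_inj; rewrite /= big_cons scale1r.
apply: in_spanD; last exact: IH.
by exists d; rewrite subm_hcompP /= hproj_mem.
Qed.

Lemma subm_hcomp_free (f : int -> subm U) (s : seq int) : uniq s ->
    (forall d, f d \in subm_hcomp d) -> \sum_(d <- s) f d = 0 ->
    forall d, d \in s -> f d = 0.
Proof.
move=> us fH sf d ds; apply: val_inj => /=.
apply: (hcomp_free (g := G) (f := fun d => subm_val (f d)) us) => //.
  by move=> e; rewrite -subm_hcompP.
by have := congr1 val sf; rewrite (raddf_sum (val : subm U -> V)).
Qed.

Definition subm_grading : grading (subm U) :=
  Grading subm_hcomp_span subm_hcomp_free.
End SubGrading.

Section QuotGrading.
Variables (G : grading V) (U : submodClosed V) (gU : graded_sub G U).

Lemma quot_hcomp_axiom d :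
  subspace_axiom (fun x : quotm U => exists2 v, v \in G d & x = qpi U v).
Proof.
split; first by exists 0; rewrite ?rpred0// linear0.
move=> a _ _ [u hu ->] [v hv ->]; exists (a *: u + v); last by rewrite linearP.
by rewrite rpredD// rpredZ.
Qed.
Definition quot_hcomp d : submodClosed (quotm U) := subspace (quot_hcomp_axiom d).

Lemma quot_hcomp_span x : in_span (fun u => exists d, u \in quot_hcomp d) x.
Proof.
rewrite -[x]qreprK; elim: {x}(hcomp_span G (qrepr x)) => [|a v w [d vd] _ IH].
  by rewrite linear0; left.
by rewrite linearP; apply: in_spanD => //; exists d; apply/subspaceP; exists v.
Qed.

Lemma quot_hcomp_free (f : int -> quotm U) (s : seq int) : uniq s ->
    (forall d, f d \in quot_hcomp d) -> \sum_(d <- s) f d = 0 ->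
    forall d, d \in s -> f d = 0.
Proof.
move=> us fH sf d ds.
have /choice[g gP] : forall e, exists v, v \in G e /\ f e = qpi U v.
  by move=> e; have /subspaceP[v] := fH e; exists v.
have : \sum_(e <- s) g e \in U.
  by apply/qpi0; rewrite linear_sum /= -[RHS]sf; apply: eq_bigr => e _; case: (gP e).
move=> /(graded_sub_proj gU d); rewrite linear_sum /=.
rewrite (eq_bigr (fun e => if e == d then g e else 0)); last first.
  by move=> e _; case: (gP e) => ge _; rewrite (hproj_hom _ ge) eq_sym.
rewrite -big_mkcond /= -big_filter filter_pred1_uniq// big_seq1 => gU'.
by case: (gP d) => _ ->; apply/qpi0.
Qed.

Definition quot_grading : grading (quotm U) :=
  Grading quot_hcomp_span quot_hcomp_free.

Lemma quot_hcomp_pi d v : v \in G d -> qpi U v \in quot_grading d.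
Proof. by move=> vd; apply/subspaceP; exists v. Qed.
End QuotGrading.

End Gradings.

Lemma subm_val_sum (k : fieldType) (V : lmodType k) (U : submodClosed V)
    (T : Type) (s : seq T) (F : T -> subm U) :
  subm_val (\sum_(t <- s) F t) = \sum_(t <- s) subm_val (F t).
Proof. exact: (raddf_sum (val : subm U -> V)). Qed.

Section Structures.
Variable k : fieldType.

(* A locally unital graded algebra.  A homogeneous idempotent has degree 0. *)
Record galg (I : choiceType) := GAlg {
  ga_sort :> lmodType k;
  ga_gr : grading ga_sort;
  ga_mul : ga_sort -> ga_sort -> ga_sort;
  ga_idem : I -> ga_sort;
  ga_mulA : associative ga_mul;
  ga_mulPl : forall y, linear (ga_mul^~ y);
  ga_mulPr : forall x, linear (ga_mul x);
  ga_mul_hom : forall d e x y, x \in ga_gr d -> y \in ga_gr e ->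
    ga_mul x y \in ga_gr (d + e);
  ga_idem_hom : forall i, ga_idem i \in ga_gr 0;
  ga_idem_mul : forall i j,
    ga_mul (ga_idem i) (ga_idem j) = if i == j then ga_idem i else 0;
  ga_unital : forall x, in_span
    (fun y => exists i j z, y = ga_mul (ga_mul (ga_idem i) z) (ga_idem j)) x }.

Record gmod (I : choiceType) (A : galg I) := GMod {
  gm_sort :> lmodType k;
  gm_gr : grading gm_sort;
  gm_act : A -> gm_sort -> gm_sort;
  gm_actA : forall a b v, gm_act (ga_mul a b) v = gm_act a (gm_act b v);
  gm_actPl : forall v, linear (gm_act^~ v);
  gm_actPr : forall a, linear (gm_act a);
  gm_act_hom : forall d e a v, a \in ga_gr A d -> v \in gm_gr e ->
    gm_act a v \in gm_gr (d + e);
  gm_unital : forall v, in_span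
    (fun w => exists i u, w = gm_act (ga_idem A i) u) v }.

Record gbimod (I J : choiceType) (A : galg I) (B : galg J) := GBimod {
  gb_left :> gmod A;
  gb_act : gb_left -> B -> gb_left;
  gb_actA : forall m b c, gb_act m (ga_mul b c) = gb_act (gb_act m b) c;
  gb_actC : forall a m b, gb_act (gm_act a m) b = gm_act a (gb_act m b);
  gb_actPl : forall b, linear (gb_act^~ b);
  gb_actPr : forall m, linear (gb_act m);
  gb_act_hom : forall d e m b, m \in gm_gr gb_left d -> b \in ga_gr B e ->
    gb_act m b \in gm_gr gb_left (d + e);
  gb_unital : forall m, in_span
    (fun n => exists j m', n = gb_act m' (ga_idem B j)) m }.

End Structures.

Notation "x ** y" := (ga_mul x y) (at level 40, left associativity).
Notation "a *> v" := (gm_act a v) (at level 40, left associativity).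
Notation "m <* b" := (gb_act m b) (at level 40, left associativity).
Notation "'1_[' A ]_ i" := (ga_idem A i) (at level 0, i at level 2,
  format "'1_[' A ]_ i").
Arguments gm_act {k I A} V a v : rename.
Arguments gb_act {k I J A B} M m b : rename.

Section BasicLemmas.
Variables (k : fieldType) (I : choiceType) (A : galg k I).
Implicit Types x y z : A.

Lemma ga_mulDl x y z : (x + y) ** z = x ** z + y ** z.
Proof. by have := ga_mulPl z 1 x y; rewrite /= !scale1r. Qed.
Lemma ga_mulDr x y z : x ** (y + z) = x ** y + x ** z.
Proof. by have := ga_mulPr x 1 y z; rewrite /= !scale1r. Qed.
Lemma ga_mul0l x : 0 ** x = 0.
Proof. by apply: (addrI (0 ** x)); rewrite -ga_mulDl !addr0. Qed.
Lemma ga_mul0r x : x ** 0 = 0.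
Proof. by apply: (addrI (x ** 0)); rewrite -ga_mulDr !addr0. Qed.
Lemma ga_mulZl a x y : (a *: x) ** y = a *: (x ** y).
Proof. by have := ga_mulPl y a x 0; rewrite /= !addr0 ga_mul0l addr0. Qed.
Lemma ga_mulZr a x y : x ** (a *: y) = a *: (x ** y).
Proof. by have := ga_mulPr x a y 0; rewrite /= !addr0 ga_mul0r addr0. Qed.
Lemma ga_mulBl x y z : (x - y) ** z = x ** z - y ** z.
Proof. by rewrite -scaleN1r ga_mulDl ga_mulZl scaleN1r. Qed.
Lemma ga_mulBr x y z : x ** (y - z) = x ** y - x ** z.
Proof. by rewrite -scaleN1r ga_mulDr ga_mulZr scaleN1r. Qed.

Section Mod.
Variable V : gmod A.
Implicit Types v w : V.
Lemma gm_actDl x y v : (x + y) *> v = x *> v + y *> v.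
Proof. by have := gm_actPl v 1 x y; rewrite /= !scale1r. Qed.
Lemma gm_actDr x v w : x *> (v + w) = x *> v + x *> w.
Proof. by have := gm_actPr x 1 v w; rewrite /= !scale1r. Qed.
Lemma gm_act0l v : 0 *> v = 0.
Proof. by apply: (addrI (0 *> v)); rewrite -gm_actDl !addr0. Qed.
Lemma gm_act0r x : x *> (0 : V) = 0.
Proof. by apply: (addrI (x *> 0)); rewrite -gm_actDr !addr0. Qed.
Lemma gm_actZl a x v : (a *: x) *> v = a *: (x *> v).
Proof. by have := gm_actPl v a x 0; rewrite /= !addr0 gm_act0l addr0. Qed.
Lemma gm_actZr a x v : x *> (a *: v) = a *: (x *> v).
Proof. by have := gm_actPr x a v 0; rewrite /= !addr0 gm_act0r addr0. Qed.
Lemma gm_actBl x y v : (x - y) *> v = x *> v - y *> v.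
Proof. by rewrite -scaleN1r gm_actDl gm_actZl scaleN1r. Qed.
Lemma gm_actBr x v w : x *> (v - w) = x *> v - x *> w.
Proof. by rewrite -scaleN1r gm_actDr gm_actZr scaleN1r. Qed.
End Mod.

Lemma ga_idem_idem i : 1_[A]_i ** 1_[A]_i = 1_[A]_i.
Proof. by rewrite ga_idem_mul eqxx. Qed.

(* Every element of A is a sum of homogeneous elements of the 1_i A 1_j. *)
Lemma ga_span x : in_span (fun y => exists i j d,
  [/\ y \in ga_gr A d, 1_[A]_i ** y = y & y ** 1_[A]_j = y]) x.
Proof.
apply: (in_span_ind_sub (in_span_axiom _) _ (ga_unital x)) => _ [i [j [z ->]]].
apply: (in_span_ind_sub (P := fun z => exists d, z \in ga_gr A d)
  (Q := fun z => in_span _ (1_[A]_i ** z ** 1_[A]_j)) _ _ (hcomp_span (ga_gr A) z)).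
  split; first by rewrite ga_mul0r ga_mul0l; left.
  move=> a u v hu hv; rewrite ga_mulDr ga_mulDl ga_mulZr ga_mulZl.
  exact: in_span_closed.
move=> u [d ud]; apply: in_span1; exists i, j, d; split.
- by rewrite -[d]add0r -[0 + d]addr0 !ga_mul_hom// ga_idem_hom.
- by rewrite !ga_mulA ga_idem_idem.
- by rewrite -ga_mulA ga_idem_idem.
Qed.
End BasicLemmas.

Section BimodLemmas.
Variables (k : fieldType) (I J : choiceType) (A : galg k I) (B : galg k J).
Variable M : gbimod A B.
Lemma gb_actDl (m n : M) b : (m + n) <* b = m <* b + n <* b.
Proof. by have := gb_actPl (g := M) b 1 m n; rewrite /= !scale1r. Qed.
Lemma gb_actDr (m : M) b c : m <* (b + c) = m <* b + m <* c.
Proof. by have := gb_actPr m 1 b c; rewrite /= !scale1r. Qed.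
Lemma gb_act0l b : (0 : M) <* b = 0.
Proof. by apply: (addrI ((0 : M) <* b)); rewrite -gb_actDl !addr0. Qed.
Lemma gb_act0r (m : M) : m <* 0 = 0.
Proof. by apply: (addrI (m <* 0)); rewrite -gb_actDr !addr0. Qed.
Lemma gb_actZl a (m : M) b : (a *: m) <* b = a *: (m <* b).
Proof. by have := gb_actPl (g := M) b a m 0; rewrite /= !addr0 gb_act0l addr0. Qed.
Lemma gb_actZr a (m : M) b : m <* (a *: b) = a *: (m <* b).
Proof. by have := gb_actPr m a b 0; rewrite /= !addr0 gb_act0r addr0. Qed.
End BimodLemmas.

Section Homs.
Variables (k : fieldType) (I : choiceType) (A : galg k I).
Implicit Types V W : gmod A.

(* Hom_A(V, W)_d *)
Definition is_hom V W (d : int) (f : V -> W) : Prop :=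
  [/\ linear f, forall a v, f (a *> v) = a *> f v &
      forall n v, v \in gm_gr V n -> f v \in gm_gr W (n + d)].

Definition gmod_iso V W : Prop := exists (f : V -> W) (g : W -> V),
  [/\ is_hom 0 f, is_hom 0 g, cancel f g & cancel g f].

Record gsub V := GSub {
  gs_sub :> submodClosed V;
  gs_act : forall a v, v \in gs_sub -> a *> v \in gs_sub;
  gs_gr : graded_sub (gm_gr V) gs_sub }.

End Homs.

Section Shift.
Variables (k : fieldType) (I : choiceType) (A : galg k I) (d : int) (V : gmod A).

Lemma shift_span v :
  in_span (fun u => exists n, u \in (fun n => gm_gr V (n - d)) n) v.
Proof.
apply: (in_span_ind_sub (in_span_axiom _) _ (hcomp_span (gm_gr V) v)) => u [n un].
by apply: in_span1; exists (n + d); rewrite addrK.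
Qed.
Lemma shift_free (f : int -> V) (s : seq int) : uniq s ->
    (forall n, f n \in gm_gr V (n - d)) -> \sum_(n <- s) f n = 0 ->
    forall n, n \in s -> f n = 0.
Proof.
move=> us fV sf n ns; rewrite -[n](addrNK d).
apply: (hcomp_free (g := gm_gr V) (f := fun n => f (n + d))
  (s := [seq n - d | n <- s])).
- by rewrite map_inj_uniq//; apply: addIr.
- by move=> e; have := fV (e + d); rewrite addrK.
- by rewrite big_map -[RHS]sf; apply: eq_bigr => e _; rewrite addrNK.
- exact: map_f.
Qed.

Lemma shift_act_hom n e a v : a \in ga_gr A n -> v \in gm_gr V (e - d) ->
  a *> v \in gm_gr V (n + e - d).
Proof. by move=> ha hv; rewrite -addrA gm_act_hom. Qed.

(* The shift q^d V, whose component of degree n is V_(n - d). *)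
Definition gshift : gmod A :=
  @GMod k I A V (Grading shift_span shift_free) (gm_act V)
    (@gm_actA _ _ _ V) (@gm_actPl _ _ _ V) (@gm_actPr _ _ _ V)
    shift_act_hom (@gm_unital _ _ _ V).
End Shift.

Section SubQuotient.
Variables (k : fieldType) (I : choiceType) (A : galg k I) (V : gmod A).

Lemma gm_unital_seq (v : V) : exists s : seq I,
  uniq s /\ v = \sum_(i <- s) 1_[A]_i *> v.
Proof.
suff [s us sv] : exists2 s : seq I, uniq s &
    forall t, uniq t -> {subset s <= t} -> v = \sum_(i <- t) 1_[A]_i *> v.
  by exists s; split=> //; apply: sv.
elim: {v}(gm_unital v) => [|a _ w [i [u ->]] _ [s us sw]].
  by exists [::] => // t _ _; rewrite big1// => i _; rewrite gm_act0r.
exists (undup (i :: s)); first exact: undup_uniq.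
move=> t ut st; under eq_bigr do rewrite gm_actDr gm_actZr -gm_actA ga_idem_mul.
rewrite big_split /= -sw//; last by move=> j js; rewrite st// mem_undup inE js orbT.
congr (_ + _); rewrite -scaler_sumr; congr (_ *: _).
rewrite (bigD1_seq i)//=; last by rewrite st// mem_undup mem_head.
rewrite eqxx big1 ?addr0// => j /negPf->; exact: gm_act0l.
Qed.

Section Sub.
Variable U : gsub V.
Definition sub_act (a : A) (u : subm U) : subm U := Subm (gs_act a (submP u)).
Lemma sub_actA a b v : sub_act (a ** b) v = sub_act a (sub_act b v).
Proof. by apply: val_inj; rewrite /= gm_actA. Qed.
Lemma sub_actPl v : linear (sub_act^~ v).
Proof. by move=> a x y; apply: val_inj; rewrite /= gm_actDl gm_actZl. Qed.
Lemma sub_actPr a : linear (sub_act a).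
Proof. by move=> c x y; apply: val_inj; rewrite /= gm_actDr gm_actZr. Qed.
Lemma sub_act_hom d e a v : a \in ga_gr A d ->
  v \in subm_grading (@gs_gr _ _ _ _ U) e ->
  sub_act a v \in subm_grading (@gs_gr _ _ _ _ U) (d + e).
Proof. by move=> ha; rewrite /= !subm_hcompP /=; apply: gm_act_hom. Qed.

Lemma sub_unital v : in_span
  (fun w => exists i u, w = sub_act (ga_idem A i) u) v.
Proof.
have [s [_ sv]] := gm_unital_seq (subm_val v).
have -> : v = \sum_(i <- s) sub_act (1_[A]_i) v.
  by apply: val_inj; rewrite [RHS]subm_val_sum /= {1}sv.
elim: s {sv} => [|i s IH]; first by rewrite big_nil; left.
by rewrite big_cons -[X in X + _]scale1r; apply: in_spanD => //; exists i, v.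
Qed.

(* The graded submodule U as a module in its own right. *)
Definition gsubmod : gmod A :=
  GMod sub_actA sub_actPl sub_actPr sub_act_hom sub_unital.
End Sub.

Section Quot.
Variable U : gsub V.
Definition quot_act (a : A) (x : quotm U) : quotm U := qpi U (a *> qrepr x).
Lemma quot_actE a v : quot_act a (qpi U v) = qpi U (a *> v).
Proof. by apply/qpi_eq; rewrite -gm_actBr gs_act//; apply/qpi_eq/qreprK. Qed.
Lemma quot_actA a b v : quot_act (a ** b) v = quot_act a (quot_act b v).
Proof. by rewrite -[v]qreprK !quot_actE gm_actA. Qed.
Lemma quot_actPl v : linear (quot_act^~ v).
Proof. by move=> a x y; rewrite -[v]qreprK !quot_actE gm_actDl gm_actZl linearP. Qed.
Lemma quot_actPr a : linear (quot_act a).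
Proof.
move=> c x y; rewrite -[x]qreprK -[y]qreprK -linearP !quot_actE.
by rewrite gm_actDr gm_actZr linearP.
Qed.
Lemma quot_act_hom d e a v : a \in ga_gr A d ->
  v \in quot_grading (@gs_gr _ _ _ _ U) e ->
  quot_act a v \in quot_grading (@gs_gr _ _ _ _ U) (d + e).
Proof.
move=> ha /subspaceP[u ue ->]; rewrite quot_actE; apply: quot_hcomp_pi.
exact: gm_act_hom.
Qed.
Lemma quot_unital v : in_span
  (fun w => exists i u, w = quot_act (ga_idem A i) u) v.
Proof.
rewrite -[v]qreprK; elim: {v}(gm_unital (qrepr v)) => [|a _ w [i [u ->]] _ IH].
  by rewrite linear0; left.
rewrite linearP; apply: in_spanD => //.
by exists i, (qpi U u); rewrite quot_actE.
Qed.
Definition gquot : gmod A :=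
  GMod quot_actA quot_actPl quot_actPr quot_act_hom quot_unital.
End Quot.
End SubQuotient.

Section Subquotient.
Variables (k : fieldType) (I : choiceType) (A : galg k I) (V : gmod A).
Variables (U W : gsub V).

Lemma relsub_axiom : subspace_axiom (fun w : gsubmod W => subm_val w \in U).
Proof.
split; first exact: rpred0.
by move=> a u v hu hv; rewrite [subm_val _]/= rpredD// rpredZ.
Qed.
Lemma relsub_act a w : w \in subspace relsub_axiom -> a *> w \in subspace relsub_axiom.
Proof. by move=> /subspaceP h; apply/subspaceP; apply: gs_act. Qed.
Lemma relsub_gr : graded_sub (gm_gr (gsubmod W)) (subspace relsub_axiom).
Proof.
move=> w /subspaceP wU.
rewrite (hproj_sum (gm_gr (gsubmod W)) w).
have h d : subm_val (hproj (gm_gr (gsubmod W)) d w) \in U.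
  suff -> : subm_val (hproj (gm_gr (gsubmod W)) d w)
            = hproj (gm_gr V) d (subm_val w).
    exact: graded_sub_proj (@gs_gr _ _ _ _ U) _ _ wU.
  symmetry; apply: (hproj_unique
    (f := fun d => subm_val (hproj (gm_gr (gsubmod W)) d w))
    (hsupp_uniq (gm_gr (gsubmod W)) w)).
  - by move=> e; rewrite -(subm_hcompP (gm_gr V)); apply: hproj_mem.
  - by move=> e /hproj_out ->.
  - by rewrite {1}(hproj_sum (gm_gr (gsubmod W)) w); apply: (subm_val_sum (U := W)).
elim: (hsupp _ w) => [|d s IH]; first by rewrite big_nil; left.
rewrite big_cons -[X in X + _]scale1r; apply: in_spanD => //.
by split; [apply/subspaceP|exists d; apply: hproj_mem].
Qed.

(* The section W / U of V, for graded submodules U <= W. *)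
Definition gsection : gmod A := gquot (GSub relsub_act relsub_gr).
End Subquotient.

Section QuotientAlgebra.
Variables (k : fieldType) (I : choiceType) (A : galg k I).

Record gideal := GIdeal {
  gi_sub :> submodClosed A;
  gi_mull : forall a x, x \in gi_sub -> a ** x \in gi_sub;
  gi_mulr : forall a x, x \in gi_sub -> x ** a \in gi_sub;
  gi_gr : graded_sub (ga_gr A) gi_sub }.

Variable J : gideal.

Definition qalg_mul (x y : quotm J) : quotm J := qpi J (qrepr x ** qrepr y).
Lemma qalg_mulE x y : qalg_mul (qpi J x) (qpi J y) = qpi J (x ** y).
Proof.
have hx : qrepr (qpi J x) - x \in J by apply/qpi_eq; rewrite qreprK.
have hy : qrepr (qpi J y) - y \in J by apply/qpi_eq; rewrite qreprK.
rewrite /qalg_mul; apply/qpi_eq.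
rewrite -(subrKA (x ** qrepr (qpi J y))) -ga_mulBl -ga_mulBr.
by apply: rpredD; [apply: gi_mulr|apply: gi_mull].
Qed.

Definition qalg_idem (i : I) : quotm J := qpi J 1_[A]_i.
Definition qalg_gr : grading (quotm J) := quot_grading (@gi_gr J).

Lemma qalg_mulA : associative qalg_mul.
Proof.
move=> x y z; rewrite -[x]qreprK -[y]qreprK -[z]qreprK !qalg_mulE.
by rewrite ga_mulA.
Qed.
Lemma qalg_mulPl y : linear (qalg_mul^~ y).
Proof.
move=> a x z; rewrite -[x]qreprK -[y]qreprK -[z]qreprK -linearP !qalg_mulE.
by rewrite ga_mulDl ga_mulZl linearP.
Qed.
Lemma qalg_mulPr x : linear (qalg_mul x).
Proof.
move=> a y z; rewrite -[x]qreprK -[y]qreprK -[z]qreprK -linearP !qalg_mulE.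
by rewrite ga_mulDr ga_mulZr linearP.
Qed.
Lemma qalg_mul_hom d e x y : x \in qalg_gr d -> y \in qalg_gr e ->
  qalg_mul x y \in qalg_gr (d + e).
Proof.
move=> /subspaceP[u ud ->] /subspaceP[v vd ->]; rewrite qalg_mulE.
by apply: quot_hcomp_pi; apply: ga_mul_hom.
Qed.
Lemma qalg_idem_hom i : qalg_idem i \in qalg_gr 0.
Proof. by apply: quot_hcomp_pi; apply: ga_idem_hom. Qed.
Lemma qalg_idem_mul i j :
  qalg_mul (qalg_idem i) (qalg_idem j) = if i == j then qalg_idem i else 0.
Proof. by rewrite /qalg_idem qalg_mulE ga_idem_mul; case: eqP => // _; rewrite linear0. Qed.
Lemma qalg_unital x : in_span
  (fun y => exists i j z, y = qalg_mul (qalg_mul (qalg_idem i) z) (qalg_idem j)) x.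
Proof.
rewrite -[x]qreprK; elim: {x}(ga_unital (qrepr x)) => [|a _ w [i [j [u ->]]] _ IH].
  by rewrite linear0; left.
rewrite linearP; apply: in_spanD => //.
by exists i, j, (qpi J u); rewrite /qalg_idem !qalg_mulE.
Qed.

Definition qalg : galg k I := GAlg qalg_mulA qalg_mulPl qalg_mulPr qalg_mul_hom
  qalg_idem_hom qalg_idem_mul qalg_unital.

(* Modules over A / J viewed as A-modules. *)
Section Inflation.
Variable V : gmod qalg.
Definition infl_act (a : A) (v : V) : V := (qpi J a : qalg) *> v.
Lemma infl_actA a b v : infl_act (a ** b) v = infl_act a (infl_act b v).
Proof.
by rewrite /infl_act -gm_actA; congr (_ *> v); symmetry; apply: qalg_mulE.
Qed.
Lemma infl_actPl v : linear (infl_act^~ v).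
Proof. by move=> a x y; rewrite /infl_act linearP gm_actDl gm_actZl. Qed.
Lemma infl_actPr a : linear (infl_act a).
Proof. exact: gm_actPr. Qed.
Lemma infl_act_hom d e a v : a \in ga_gr A d -> v \in gm_gr V e ->
  infl_act a v \in gm_gr V (d + e).
Proof. by move=> ha hv; apply: gm_act_hom => //; apply: quot_hcomp_pi. Qed.

Definition inflate : gmod A :=
  GMod infl_actA infl_actPl infl_actPr infl_act_hom (@gm_unital _ _ _ V).
End Inflation.
End QuotientAlgebra.

Section Corner.
Variables (k : fieldType) (I : choiceType) (C : galg k I).

Record idem0 := Idem0 {
  id_elt :> C;
  id_deg : id_elt \in ga_gr C 0;
  id_mul : id_elt ** id_elt = id_elt }.

Variable e : idem0.

Lemma id_hom_l d x : x \in ga_gr C d -> (e : C) ** x \in ga_gr C d.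
Proof. by move=> h; rewrite -[d]add0r ga_mul_hom// id_deg. Qed.
Lemma id_hom_r d x : x \in ga_gr C d -> x ** (e : C) \in ga_gr C d.
Proof. by move=> h; rewrite -[d]addr0 ga_mul_hom// id_deg. Qed.

(* The subspaces C e, e C and e C e of C. *)
Lemma rightid_axiom : subspace_axiom (fun x : C => x ** (e : C) = x).
Proof.
split; first exact: ga_mul0l.
by move=> a u v hu hv; rewrite ga_mulDl ga_mulZl hu hv.
Qed.
Lemma leftid_axiom : subspace_axiom (fun x : C => (e : C) ** x = x).
Proof.
split; first exact: ga_mul0r.
by move=> a u v hu hv; rewrite ga_mulDr ga_mulZr hu hv.
Qed.
Lemma bothid_axiom :
  subspace_axiom (fun x : C => (e : C) ** x = x /\ x ** (e : C) = x).
Proof.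
split; first by rewrite ga_mul0r ga_mul0l.
move=> a u v [hu hu'] [hv hv'].
by rewrite ga_mulDr ga_mulZr ga_mulDl ga_mulZl hu hv hu' hv'.
Qed.
Definition Ce_sub : submodClosed C := subspace rightid_axiom.
Definition eC_sub : submodClosed C := subspace leftid_axiom.
Definition eCe_sub : submodClosed C := subspace bothid_axiom.

Lemma hom_span_map (f : C -> C) (P : C -> Prop) (x : C) : linear f ->
  f x = x -> (forall d y, y \in ga_gr C d -> P (f y)) -> in_span P x.
Proof.
move=> lf fx fP; rewrite -fx.
have f0 : f 0 = 0.
  by have := lf (-1) 0 0; rewrite !scaler0 addr0 scaleN1r addNr.
elim: {x fx}(hcomp_span (ga_gr C) x) => [|a v w [d vd] _ IH].
  by rewrite f0; left.
by rewrite lf; apply: in_spanD => //; apply: fP vd.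
Qed.

Lemma Ce_gr : graded_sub (ga_gr C) Ce_sub.
Proof.
move=> x /subspaceP xe; apply: (hom_span_map (f := fun y => y ** (e : C))) => //.
  exact: ga_mulPl.
move=> d y yd; split; last by exists d; apply: id_hom_r.
by apply/subspaceP; rewrite -ga_mulA id_mul.
Qed.
Lemma eC_gr : graded_sub (ga_gr C) eC_sub.
Proof.
move=> x /subspaceP xe; apply: (hom_span_map (f := fun y => (e : C) ** y)) => //.
  exact: ga_mulPr.
move=> d y yd; split; last by exists d; apply: id_hom_l.
by apply/subspaceP; rewrite ga_mulA id_mul.
Qed.
Lemma eCe_gr : graded_sub (ga_gr C) eCe_sub.
Proof.
move=> x /subspaceP[ex xe].
apply: (hom_span_map (f := fun y => (e : C) ** y ** (e : C))) => //.
- by move=> a u v; rewrite ga_mulDr ga_mulDl ga_mulZr ga_mulZl.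
- by rewrite ex xe.
move=> d y yd; split; last by exists d; apply/id_hom_r/id_hom_l.
apply/subspaceP; split; first by rewrite !ga_mulA id_mul.
by rewrite -(ga_mulA _ (e : C)) id_mul.
Qed.

Lemma eCe_mul_subproof (x y : subm eCe_sub) :
  (x : C) ** (y : C) \in eCe_sub.
Proof.
have /subspaceP[ex _] := submP x; have /subspaceP[_ ye] := submP y.
by apply/subspaceP; rewrite ga_mulA ex -ga_mulA ye.
Qed.
Definition eCe_mul x y := Subm (eCe_mul_subproof x y).
Lemma eCe_idem_subproof : (e : C) \in eCe_sub.
Proof. by apply/subspaceP; rewrite id_mul. Qed.
Definition eCe_idem (_ : unit) := Subm eCe_idem_subproof.

Lemma eCe_mulA : associative eCe_mul.
Proof. by move=> x y z; apply: val_inj; rewrite /= ga_mulA. Qed.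
Lemma eCe_mulPl y : linear (eCe_mul^~ y).
Proof. by move=> a x z; apply: val_inj; rewrite /= ga_mulDl ga_mulZl. Qed.
Lemma eCe_mulPr x : linear (eCe_mul x).
Proof. by move=> a y z; apply: val_inj; rewrite /= ga_mulDr ga_mulZr. Qed.
Lemma eCe_mul_hom d d' x y : x \in subm_grading eCe_gr d ->
  y \in subm_grading eCe_gr d' -> eCe_mul x y \in subm_grading eCe_gr (d + d').
Proof. by rewrite !subm_hcompP; apply: ga_mul_hom. Qed.
Lemma eCe_idem_hom i : eCe_idem i \in subm_grading eCe_gr 0.
Proof. by rewrite subm_hcompP; apply: id_deg. Qed.
Lemma eCe_idem_mul i j :
  eCe_mul (eCe_idem i) (eCe_idem j) = if i == j then eCe_idem i else 0.
Proof. by case: i j => -[]; apply: val_inj; rewrite /= id_mul. Qed.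
Lemma eCe_unital x : in_span
  (fun y => exists i j z, y = eCe_mul (eCe_mul (eCe_idem i) z) (eCe_idem j)) x.
Proof.
apply: in_span1; exists tt, tt, x; apply: val_inj => /=.
by have /subspaceP[-> ->] := submP x.
Qed.

(* The unital graded algebra e C e, as a locally unital one with a single
   distinguished idempotent, its identity e. *)
Definition corner : galg k unit := GAlg eCe_mulA eCe_mulPl eCe_mulPr
  eCe_mul_hom eCe_idem_hom eCe_idem_mul eCe_unital.

(* C e as a (C, e C e)-bimodule. *)
Lemma Ce_act_subproof (c : C) (x : subm Ce_sub) : c ** (x : C) \in Ce_sub.
Proof. by have /subspaceP h := submP x; apply/subspaceP; rewrite -ga_mulA h. Qed.
Definition Ce_act c x := Subm (Ce_act_subproof c x).
Lemma Ce_actA a b v : Ce_act (a ** b) v = Ce_act a (Ce_act b v).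
Proof. by apply: val_inj; rewrite /= ga_mulA. Qed.
Lemma Ce_actPl v : linear (Ce_act^~ v).
Proof. by move=> a x y; apply: val_inj; rewrite /= ga_mulDl ga_mulZl. Qed.
Lemma Ce_actPr a : linear (Ce_act a).
Proof. by move=> c x y; apply: val_inj; rewrite /= ga_mulDr ga_mulZr. Qed.
Lemma Ce_act_hom d d' a v : a \in ga_gr C d -> v \in subm_grading Ce_gr d' ->
  Ce_act a v \in subm_grading Ce_gr (d + d').
Proof. by rewrite !subm_hcompP; apply: ga_mul_hom. Qed.
Lemma Ce_proj_subproof (x : C) : x ** (e : C) \in Ce_sub.
Proof. by apply/subspaceP; rewrite -ga_mulA id_mul. Qed.
Lemma Ce_unital v : in_span
  (fun w => exists i u, w = Ce_act (ga_idem C i) u) v.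
Proof.
pose p x : subm Ce_sub := Subm (Ce_proj_subproof x).
have -> : v = p (v : C).
  by apply: val_inj; rewrite /=; have /subspaceP -> := submP v.
elim: {v}(ga_unital (v : C)) => [|a _ w [i [j [z ->]]] _ IH].
  by have -> : p 0 = 0; [apply: val_inj; rewrite /= ga_mul0l|left].
have -> : p (a *: (1_[C]_i ** z ** 1_[C]_j) + w) =
          a *: p (1_[C]_i ** z ** 1_[C]_j) + p w.
  by apply: val_inj; rewrite /= ga_mulDl ga_mulZl.
apply: in_spanD => //; exists i, (p (z ** 1_[C]_j)).
by apply: val_inj; rewrite /= !ga_mulA.
Qed.
Definition Ce_left : gmod C := GMod Ce_actA Ce_actPl Ce_actPr Ce_act_hom Ce_unital.

Lemma Ce_ract_subproof (x : Ce_left) (b : corner) :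
  subm_val x ** subm_val b \in Ce_sub.
Proof.
have /subspaceP[_ h] := submP b; apply/subspaceP.
by rewrite -ga_mulA h.
Qed.
Definition Ce_ract (x : Ce_left) (b : corner) : Ce_left :=
  Subm (Ce_ract_subproof x b).
Lemma Ce_ractA m b c : Ce_ract m (b ** c) = Ce_ract (Ce_ract m b) c.
Proof. by apply: val_inj; rewrite /= ga_mulA. Qed.
Lemma Ce_ractC a m b : Ce_ract (a *> m) b = a *> Ce_ract m b.
Proof. by apply: val_inj; rewrite /= ga_mulA. Qed.
Lemma Ce_ractPl b : linear (Ce_ract^~ b).
Proof. by move=> a x z; apply: val_inj; rewrite /= ga_mulDl ga_mulZl. Qed.
Lemma Ce_ractPr m : linear (Ce_ract m).
Proof. by move=> a x z; apply: val_inj; rewrite /= ga_mulDr ga_mulZr. Qed.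
Lemma Ce_ract_hom d d' m b : m \in gm_gr Ce_left d -> b \in ga_gr corner d' ->
  Ce_ract m b \in gm_gr Ce_left (d + d').
Proof. by rewrite !subm_hcompP; apply: ga_mul_hom. Qed.
Lemma Ce_runital m : in_span
  (fun n => exists j m', n = Ce_ract m' (ga_idem corner j)) m.
Proof.
apply: in_span1; exists tt, m; apply: val_inj => /=.
by have /subspaceP -> := submP m.
Qed.
Definition Ce : gbimod C corner :=
  GBimod Ce_ractA Ce_ractC Ce_ractPl Ce_ractPr Ce_ract_hom Ce_runital.

(* e C as an (e C e, C)-bimodule. *)
Lemma eC_act_subproof (c : corner) (x : subm eC_sub) :
  subm_val c ** (x : C) \in eC_sub.
Proof. by have /subspaceP[h _] := submP c; apply/subspaceP; rewrite ga_mulA h. Qed.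
Definition eC_act (c : corner) x := Subm (eC_act_subproof c x).
Lemma eC_actA (a b : corner) v : eC_act (a ** b) v = eC_act a (eC_act b v).
Proof. by apply: val_inj; rewrite /= ga_mulA. Qed.
Lemma eC_actPl v : linear (eC_act^~ v).
Proof. by move=> a x y; apply: val_inj; rewrite /= ga_mulDl ga_mulZl. Qed.
Lemma eC_actPr a : linear (eC_act a).
Proof. by move=> c x y; apply: val_inj; rewrite /= ga_mulDr ga_mulZr. Qed.
Lemma eC_act_hom d d' a v : a \in ga_gr corner d -> v \in subm_grading eC_gr d' ->
  eC_act a v \in subm_grading eC_gr (d + d').
Proof. by rewrite !subm_hcompP; apply: ga_mul_hom. Qed.
Lemma eC_unital v : in_span
  (fun w => exists i u, w = eC_act (ga_idem corner i) u) v.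
Proof.
apply: in_span1; exists tt, v; apply: val_inj => /=.
by have /subspaceP -> := submP v.
Qed.
Definition eC_left : gmod corner :=
  GMod eC_actA eC_actPl eC_actPr eC_act_hom eC_unital.

Lemma eC_ract_subproof (x : eC_left) (b : C) : subm_val x ** b \in eC_sub.
Proof. by have /subspaceP h := submP x; apply/subspaceP; rewrite ga_mulA h. Qed.
Definition eC_ract (x : eC_left) (b : C) : eC_left := Subm (eC_ract_subproof x b).
Lemma eC_ractA m b c : eC_ract m (b ** c) = eC_ract (eC_ract m b) c.
Proof. by apply: val_inj; rewrite /= ga_mulA. Qed.
Lemma eC_ractC a m b : eC_ract (a *> m) b = a *> eC_ract m b.
Proof. by apply: val_inj; rewrite /= ga_mulA. Qed.
Lemma eC_ractPl b : linear (eC_ract^~ b).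
Proof. by move=> a x z; apply: val_inj; rewrite /= ga_mulDl ga_mulZl. Qed.
Lemma eC_ractPr m : linear (eC_ract m).
Proof. by move=> a x z; apply: val_inj; rewrite /= ga_mulDr ga_mulZr. Qed.
Lemma eC_ract_hom d d' m b : m \in gm_gr eC_left d -> b \in ga_gr C d' ->
  eC_ract m b \in gm_gr eC_left (d + d').
Proof. by rewrite !subm_hcompP; apply: ga_mul_hom. Qed.
Lemma eC_proj_subproof (x : C) : (e : C) ** x \in eC_sub.
Proof. by apply/subspaceP; rewrite ga_mulA id_mul. Qed.
Lemma eC_runital m : in_span
  (fun n => exists j m', n = eC_ract m' (ga_idem C j)) m.
Proof.
pose p x : eC_left := Subm (eC_proj_subproof x).
have -> : m = p (subm_val m).
  by apply: val_inj; rewrite /=; have /subspaceP -> := submP m.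
elim: {m}(ga_unital (subm_val m)) => [|a _ w [i [j [z ->]]] _ IH].
  by have -> : p 0 = 0; [apply: val_inj; rewrite /= ga_mul0r|left].
have -> : p (a *: (1_[C]_i ** z ** 1_[C]_j) + w) =
          a *: p (1_[C]_i ** z ** 1_[C]_j) + p w.
  by apply: val_inj; rewrite /= ga_mulDr ga_mulZr.
apply: in_spanD => //; exists j, (p (1_[C]_i ** z)).
by apply: val_inj; rewrite /= !ga_mulA.
Qed.
Definition eC : gbimod corner C :=
  GBimod eC_ractA eC_ractC eC_ractPl eC_ractPr eC_ract_hom eC_runital.
End Corner.

Lemma fglift_scalable (k : fieldType) (K : choiceType) (W : lmodType k)
    (f : K -> W) : linear (fglift f : {freeg K / k} -> W).
Proof.
pose F : {additive {freeg K / k} -> W} :=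
  HB.pack (fglift f) (GRing.isZmodMorphism.Build {freeg K / k} W (fglift f)
    (lift_is_additive f)).
move=> a D E; rewrite -[fglift f]/(F : _ -> _) raddfD; congr (_ + _).
rewrite -[D]Freeg_enum; move: (fgenum D) => s.
have -> : a *: Freeg s = Freeg [seq (a * x.1, x.2) | x <- s].
  apply/eqP/freeg_eqP => y; rewrite coeffZ !coeff_Freeg /precoeff.
  by rewrite big_map mulr_sumr.
rewrite /= !fglift_Freeg /prelift big_map scaler_sumr.
by apply: eq_bigr => x _; rewrite scalerA.
Qed.

Section Tensor.
Variables (k : fieldType) (I J : choiceType) (C : galg k I) (B : galg k J).
Variables (M : gbimod C B) (V : gmod B).

Definition fgen (m : M) (v : V) : {freeg (M * V)%type / k} :=
  Freeg [:: (1, (m, v))].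

Inductive tens_rel : {freeg (M * V)%type / k} -> Prop :=
| tens_rel_l a m n v :
    tens_rel (fgen (a *: m + n) v - (a *: fgen m v + fgen n v))
| tens_rel_r a m v w :
    tens_rel (fgen m (a *: v + w) - (a *: fgen m v + fgen m w))
| tens_rel_b m b v : tens_rel (fgen (m <* b) v - fgen m (b *> v)).

(* The k-vector space M (x)_B V: the free vector space on M * V modulo the
   relations of bilinearity and B-balancedness. *)
Definition tens_space : lmodType k := quotm (span tens_rel).
Definition tens (m : M) (v : V) : tens_space := qpi _ (fgen m v).

Lemma tensPl v : linear (tens^~ v).
Proof.
move=> a m n; rewrite /tens -linearP; apply/qpi_eq.
by apply/subspaceP; apply: in_span1; apply: tens_rel_l.
Qed.
Lemma tensPr m : linear (tens m).
Proof.
move=> a v w; rewrite /tens -linearP; apply/qpi_eq.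
by apply/subspaceP; apply: in_span1; apply: tens_rel_r.
Qed.
Lemma tens_bal m b v : tens (m <* b) v = tens m (b *> v).
Proof.
by apply/qpi_eq; apply/subspaceP; apply: in_span1; apply: tens_rel_b.
Qed.
Lemma tens0l v : tens 0 v = 0.
Proof. by have := tensPl v (-1) 0 0; rewrite scaler0 addr0 scaleN1r addNr. Qed.
Lemma tens0r m : tens m 0 = 0.
Proof. by have := tensPr m (-1) 0 0; rewrite scaler0 addr0 scaleN1r addNr. Qed.

Lemma tens_span x : in_span (fun y => exists m v, y = tens m v) x.
Proof.
rewrite -[x]qreprK; move: (qrepr x) => D.
rewrite -[D]freeg_sumE linear_sum /=.
elim: (dom D) => [|[m v] s IH]; first by rewrite big_nil; left.
rewrite big_cons; set a := coeff _ _.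
have -> : << a *g (m, v) >> = a *: fgen m v.
  by apply/eqP/freeg_eqP => y; rewrite coeffZ !coeffU mul1r.
by rewrite linearZ /=; apply: in_spanD => //; exists m, v.
Qed.

Record balanced (W : lmodType k) := Balanced {
  bal_fun :> M -> V -> W;
  bal_l : forall v, linear (bal_fun^~ v);
  bal_r : forall m, linear (bal_fun m);
  bal_b : forall m b v, bal_fun (m <* b) v = bal_fun m (b *> v) }.

Section Lift.
Variables (W : lmodType k) (g : balanced W).
Let G (D : {freeg (M * V)%type / k}) : W := fglift (fun p => g p.1 p.2) D.
Let G_linear : linear G. Proof. exact: fglift_scalable. Qed.
Let G0 : G 0 = 0.
Proof. by have := G_linear (-1) 0 0; rewrite scaler0 addr0 scaleN1r addNr. Qed.
Let GB D E : G (D - E) = G D - G E.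
Proof.
have := G_linear (-1) E D; rewrite !scaleN1r [RHS]addrC => <-.
by congr G; rewrite addrC.
Qed.
Let G_gen m v : G (fgen m v) = g m v.
Proof. by rewrite /G liftU scale1r. Qed.
Let G_rel D : D \in span tens_rel -> G D = 0.
Proof.
have GL a x y : G (a *: x + y) = a *: G x + G y by exact: G_linear.
move=> /subspaceP; apply: (in_span_ind_sub (Q := fun D => G D = 0)).
  by split=> // a x y Gx Gy; rewrite GL Gx Gy scaler0 addr0.
move=> _ [b m n v|b m v w|m b v]; apply: etrans (GB _ _) _.
- apply/eqP; rewrite subr_eq0; apply/eqP; rewrite [RHS]G_linear !G_gen.
  exact: bal_l.
- apply/eqP; rewrite subr_eq0; apply/eqP; rewrite [RHS]G_linear !G_gen.
  exact: bal_r.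
- by rewrite !G_gen bal_b subrr.
Qed.

Definition tens_lift (x : tens_space) : W := G (qrepr x).

Lemma tens_lift_pi D : tens_lift (qpi _ D) = G D.
Proof.
apply/eqP; rewrite -subr_eq0 -GB; apply/eqP/G_rel.
by apply/qpi_eq; rewrite qreprK.
Qed.
Lemma tens_liftE m v : tens_lift (tens m v) = g m v.
Proof. by rewrite tens_lift_pi G_gen. Qed.
Lemma tens_lift_linear : linear tens_lift.
Proof.
move=> a x y; rewrite -[x]qreprK -[y]qreprK -linearP !tens_lift_pi.
exact: G_linear.
Qed.
HB.instance Definition _ :=
  GRing.isLinear.Build k tens_space W *:%R tens_lift tens_lift_linear.
End Lift.

Definition tens_hcomp (d : int) : submodClosed tens_space :=
  span (fun x => exists e f m v,
    [/\ m \in gm_gr M e, v \in gm_gr V f, e + f = d & x = tens m v]).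

Lemma tens_hcomp_tens e f m v : m \in gm_gr M e -> v \in gm_gr V f ->
  tens m v \in tens_hcomp (e + f).
Proof. by move=> hm hv; apply/subspaceP/in_span1; exists e, f, m, v. Qed.

Lemma in_span_tens (P : tens_space -> Prop) :
  (forall e f m v, m \in gm_gr M e -> v \in gm_gr V f -> in_span P (tens m v)) ->
  forall m v, in_span P (tens m v).
Proof.
move=> hP m v.
elim: {m}(hcomp_span (gm_gr M) m) => [|a m n [e me] _ IH].
  by rewrite tens0l; left.
rewrite tensPl; apply: in_span_closed => //.
elim: {v IH}(hcomp_span (gm_gr V) v) => [|b v w [f vf] _ IH].
  by rewrite tens0r; left.
by rewrite tensPr; apply: in_span_closed => //; apply: hP me vf.
Qed.

Lemma tens_hcomp_span x : in_span (fun u => exists d, u \in tens_hcomp d) x.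
Proof.
apply: (in_span_ind_sub (in_span_axiom _) _ (tens_span x)) => _ [m [v ->]].
apply: in_span_tens => e f m' v' hm hv; apply: in_span1.
by exists (e + f); apply: tens_hcomp_tens.
Qed.

Section TensProj.
Variable d : int.
Let Phi (m : M) (v : V) : tens_space :=
  \sum_(e <- hsupp (gm_gr M) m) tens (hproj (gm_gr M) e m) (hproj (gm_gr V) (d - e) v).

Let Phi_widen m v (t : seq int) : uniq t -> {subset hsupp (gm_gr M) m <= t} ->
  Phi m v = \sum_(e <- t) tens (hproj (gm_gr M) e m) (hproj (gm_gr V) (d - e) v).
Proof.
move=> ut st; rewrite [RHS](bigID (fun e => e \in hsupp (gm_gr M) m)) /=.
rewrite [X in _ = _ + X]big1; last by move=> e /hproj_out ->; rewrite tens0l.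
rewrite addr0 -[RHS]big_filter; apply: perm_big; apply: uniq_perm.
- exact: hsupp_uniq.
- exact: filter_uniq.
by move=> e; rewrite mem_filter; case: (boolP (e \in hsupp _ _)) => //= /st ->.
Qed.

Let Phi_l v : linear (Phi^~ v).
Proof.
move=> a m n; pose t := undup (hsupp (gm_gr M) (a *: m + n) ++
  hsupp (gm_gr M) m ++ hsupp (gm_gr M) n).
have ut : uniq t by exact: undup_uniq.
rewrite !(Phi_widen _ ut); first 1 last.
- by move=> e h; rewrite mem_undup !mem_cat h !orbT.
- by move=> e h; rewrite mem_undup !mem_cat h !orbT.
- by move=> e h; rewrite mem_undup !mem_cat h.
rewrite scaler_sumr -big_split /=; apply: eq_bigr => e _.
by rewrite linearP tensPl.
Qed.

Let Phi_r m : linear (Phi m).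
Proof.
move=> a v w; rewrite /Phi scaler_sumr -big_split /=; apply: eq_bigr => e _.
by rewrite linearP tensPr.
Qed.

Let Phi_hom e f m v : m \in gm_gr M e -> v \in gm_gr V f ->
  Phi m v = if d == e + f then tens m v else 0.
Proof.
move=> me vf; pose t := undup (e :: hsupp (gm_gr M) m).
have ut : uniq t by exact: undup_uniq.
have et : e \in t by rewrite mem_undup mem_head.
rewrite (Phi_widen _ ut); last by move=> x h; rewrite mem_undup inE h orbT.
rewrite (bigD1_seq e)//= big1 => [|x xe]; last first.
  by rewrite (hproj_hom _ me) (negPf xe) tens0l.
rewrite addr0 (hproj_id me) (hproj_hom _ vf) subr_eq addrC.
by case: ifP => //; rewrite tens0r.
Qed.

Let Phi_b m b v : Phi (m <* b) v = Phi m (b *> v).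
Proof.
have P0l u : Phi 0 u = 0.
  by have := Phi_l u (-1) 0 0; rewrite scaler0 addr0 scaleN1r addNr.
have P0r n : Phi n 0 = 0.
  by have := Phi_r n (-1) 0 0; rewrite scaler0 addr0 scaleN1r addNr.
elim: {m}(hcomp_span (gm_gr M) m) => [|a m n [e me] _ IH].
  by rewrite gb_act0l !P0l.
rewrite gb_actDl gb_actZl !Phi_l {}IH; congr (_ *: _ + _).
elim: {v}(hcomp_span (gm_gr V) v) => [|c0 v w [f vf] _ IH].
  by rewrite gm_act0r !P0r.
rewrite gm_actDr gm_actZr !Phi_r {}IH; congr (_ *: _ + _).
elim: {b}(hcomp_span (ga_gr B) b) => [|c1 b b' [g bg] _ IH].
  by rewrite gm_act0l gb_act0r P0l P0r.
rewrite gm_actDl gm_actZl gb_actDr gb_actZr Phi_l Phi_r {}IH; congr (_ *: _ + _).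
rewrite (Phi_hom (gb_act_hom me bg) vf) (Phi_hom me (gm_act_hom bg vf)).
by rewrite addrA tens_bal.
Qed.

Definition tens_proj : {linear tens_space -> tens_space} :=
  tens_lift (Balanced Phi_l Phi_r Phi_b).

Lemma tens_projE e f m v : m \in gm_gr M e -> v \in gm_gr V f ->
  tens_proj (tens m v) = if d == e + f then tens m v else 0.
Proof. by move=> hm hv; rewrite [LHS]tens_liftE /=; apply: Phi_hom. Qed.
End TensProj.

Lemma tens_hcomp_free (f : int -> tens_space) (s : seq int) : uniq s ->
    (forall d, f d \in tens_hcomp d) -> \sum_(d <- s) f d = 0 ->
    forall d, d \in s -> f d = 0.
Proof.
apply: (hcomp_free_of_proj (p := tens_proj)) => d e x /subspaceP.
apply: (in_span_ind_sub (Q := fun x => tens_proj d x = if d == e then x else 0)).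
  split; first by rewrite linear0 if_same.
  by move=> a u v hu hv; rewrite linearP hu hv; case: ifP => // _; rewrite scaler0 addr0.
by move=> _ [f' [g [m [v [hm hv <- ->]]]]]; apply: tens_projE.
Qed.

Lemma tens_act_l a v : linear (fun m : M => tens (a *> m) v).
Proof. by move=> c m n; rewrite gm_actDr gm_actZr tensPl. Qed.
Lemma tens_act_r a m : linear (fun v : V => tens (a *> m) v).
Proof. exact: tensPr. Qed.
Lemma tens_act_b a m b v : tens (a *> (m <* b)) v = tens (a *> m) (b *> v).
Proof. by rewrite -gb_actC tens_bal. Qed.
Definition tens_act (a : C) (x : tens_space) : tens_space :=
  tens_lift (Balanced (tens_act_l a) (tens_act_r a) (tens_act_b a)) x.

Lemma tens_actE a m v : tens_act a (tens m v) = tens (a *> m) v.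
Proof. exact: tens_liftE. Qed.
Lemma tens_actPr a : linear (tens_act a).
Proof. exact: tens_lift_linear. Qed.
Lemma tens_act0 a : tens_act a 0 = 0.
Proof. exact: linear0. Qed.
Lemma tens_actA a b x : tens_act (a ** b) x = tens_act a (tens_act b x).
Proof.
elim: {x}(tens_span x) => [|c _ y [m [v ->]] _ IH]; first by rewrite !tens_act0.
by rewrite !tens_actPr IH !tens_actE gm_actA.
Qed.
Lemma tens_actPl x : linear (tens_act^~ x).
Proof.
move=> c a b; elim: {x}(tens_span x) => [|c' _ y [m [v ->]] _ IH].
  by rewrite !tens_act0 scaler0 addr0.
rewrite !tens_actPr IH !tens_actE gm_actDl gm_actZl tensPl.
by rewrite !scalerDr !scalerA [c' * c]mulrC addrACA.
Qed.
Lemma tens_act_hom d e a x : a \in ga_gr C d -> x \in tens_hcomp e ->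
  tens_act a x \in tens_hcomp (d + e).
Proof.
move=> ha /subspaceP.
apply: (in_span_ind_sub (Q := fun x => tens_act a x \in tens_hcomp (d + e))).
  split; first by rewrite tens_act0 rpred0.
  by move=> c u v hu hv; rewrite tens_actPr rpredD// rpredZ.
move=> _ [f [g [m [v [hm hv <- ->]]]]]; rewrite tens_actE addrA.
by apply: tens_hcomp_tens => //; apply: gm_act_hom.
Qed.
Lemma tens_unital x : in_span
  (fun y => exists i u, y = tens_act (ga_idem C i) u) x.
Proof.
apply: (in_span_ind_sub (in_span_axiom _) _ (tens_span x)) => _ [m [v ->]].
elim: {m}(gm_unital m) => [|a _ n [i [m ->]] _ IH]; first by rewrite tens0l; left.
rewrite tensPl; apply: in_spanD => //.
by exists i, (tens m v); rewrite tens_actE.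
Qed.

(* The graded left C-module M (x)_B V. *)
Definition tensor : gmod C := @GMod k I C tens_space
  (Grading tens_hcomp_span tens_hcomp_free) tens_act
  tens_actA tens_actPl tens_actPr tens_act_hom tens_unital.
End Tensor.

Lemma subm_span_in (k : fieldType) (V : lmodType k) (P : V -> Prop)
  (x : subm (span P)) : in_span (fun y : subm (span P) => P (subm_val y)) x.
Proof.
case: x => v vU; have /subspaceP hv := vU.
suff: forall vU : v \in span P, in_span (fun y => P (subm_val y)) (Subm vU) by apply.
elim: {v vU} hv => [|a v w Pv hw IH] vU.
  by have -> : Subm vU = 0; [apply: val_inj|left].
have wU : w \in span P by apply/subspaceP.
have vU' : v \in span P by apply/subspaceP/in_span1.
have -> : Subm vU = a *: Subm vU' + Subm wU by apply: val_inj.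
by apply: in_spanD => //; apply: IH.
Qed.

Section Coinduction.
Variables (k : fieldType) (I J : choiceType) (B : galg k J) (C : galg k I).
Variables (M : gbimod B C) (V : gmod B).

Lemma is_hom_axiom (U W : gmod B) d :
  subspace_axiom (fun f : U -> W => is_hom d f).
Proof.
split; first split=> [a u v|a v|n v _]; rewrite /= ?scaler0 ?addr0 ?gm_act0r//.
  exact: rpred0.
move=> a f g [fl fa fh] [gl ga gh]; split=> [c u v|b v|n v hv].
- rewrite -![(a *: f + g) _]/(a *: f _ + g _) fl gl !scalerDr !scalerA.
  by rewrite [a * c]mulrC addrACA.
- rewrite -![(a *: f + g) _]/(a *: f _ + g _) fa ga.
  by rewrite gm_actDr gm_actZr.
- rewrite -![(a *: f + g) _]/(a *: f _ + g _).
  by rewrite rpredD ?rpredZ ?fh ?gh.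
Qed.

(* Hom_B(M 1_i, V)_d, identified with the homogeneous homomorphisms f of
   degree d from M to V such that f(x) = f(x 1_i). *)
Definition coind_gen (f : M -> V) : Prop := exists d i,
  is_hom d f /\ forall x, f (x <* 1_[C]_i) = f x.

(* The direct sum over i and d of the Hom_B(M 1_i, V)_d. *)
Definition coind_sub : submodClosed (M -> V) := span coind_gen.
Definition coind_space : lmodType k := subm coind_sub.

Lemma coind_linear (f : coind_space) : linear (subm_val f).
Proof.
have /subspaceP := submP f; move: (subm_val f) => {f}.
apply: (@in_span_ind_sub _ _ coind_gen (fun f : M -> V => linear f)).
  split; first by move=> a u v /=; rewrite scaler0 addr0.
  move=> a g h gl hl c u v; rewrite -![(a *: g + h) _]/(a *: g _ + h _) gl hl.
  by rewrite !scalerDr !scalerA [a * c]mulrC addrACA.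
by move=> g [d [i [[]]]].
Qed.

Lemma coind_hcomp_axiom d :
  subspace_axiom (fun f : coind_space => is_hom (V := M) (W := V) d (subm_val f)).
Proof.
have [h0 hD] := is_hom_axiom M V d.
by split=> [|a f g hf hg]; [exact: h0|apply: hD].
Qed.
Definition coind_hcomp d : submodClosed coind_space := subspace (coind_hcomp_axiom d).

Lemma coind_hcomp_span f :
  in_span (fun u : coind_space => exists d, u \in coind_hcomp d) f.
Proof.
apply: (in_span_ind_sub (in_span_axiom _) _ (subm_span_in f)) => g [d [i [gd _]]].
by apply: in_span1; exists d; apply/subspaceP.
Qed.

Lemma coind_hcomp_free (f : int -> coind_space) (s : seq int) : uniq s ->
    (forall d, f d \in coind_hcomp d) -> \sum_(d <- s) f d = 0 ->
    forall d, d \in s -> f d = 0.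
Proof.
move=> us fH sf d ds; apply: val_inj; apply/funext => x /=.
have fd e : is_hom (V := M) (W := V) e (subm_val (f e)).
  by have /subspaceP := fH e.
have [fl _ _] := fd d.
have f0 : subm_val (f d) 0 = 0.
  by have := fl (-1) 0 0; rewrite scaler0 addr0 scaleN1r addNr.
elim: {x}(hcomp_span (gm_gr M) x) => [//|a x y [n xn] _ IH].
rewrite fl IH addr0 [subm_val (f d) x](_ : _ = 0) ?scaler0//.
have -> : subm_val (f d) x = (fun e => subm_val (f (e - n)) x) (n + d).
  by rewrite /= [n + d]addrC addrK.
apply: (hcomp_free (g := gm_gr V) (f := fun e => subm_val (f (e - n)) x)
  (s := [seq n + e | e <- s])).
- by rewrite map_inj_uniq//; apply: addrI.
- by move=> e; have [_ _ /(_ n x xn)] := fd (e - n); rewrite [n + _]addrC addrNK.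
- rewrite big_map -[RHS](congr1 (fun h => subm_val h x) sf) subm_val_sum fct_sumE.
  by apply: eq_bigr => e _; rewrite [n + e]addrC addrK.
- exact: map_f.
Qed.

Lemma coind_act_subproof (a : C) (f : coind_space) :
  (fun x => subm_val f (x <* a)) \in coind_sub.
Proof.
have fl := coind_linear f.
have f0 : subm_val f 0 = 0.
  by have := fl (-1) 0 0; rewrite scaler0 addr0 scaleN1r addNr.
apply/subspaceP.
elim: {a}(ga_span a) => [|c a b [i [j [d [ad ia _]]]] _ IH].
  rewrite (_ : (fun x => _) = 0); first by left.
  by apply/funext => x; rewrite gb_act0r.
rewrite (_ : (fun x => _) = c *: (fun x => subm_val f (x <* a)) +
                            (fun x => subm_val f (x <* b))); last first.
  by apply/funext => x; rewrite gb_actDr gb_actZr fl.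
apply: in_span_closed => // {IH}.
have /subspaceP := submP f; move: (subm_val f) => {f fl f0}.
apply: (@in_span_ind_sub _ _ coind_gen (fun f : M -> V => in_span coind_gen (fun x => f (x <* a)))).
  split=> [|e g h hg hh]; first by left.
  by have := in_span_closed e hg hh.
move=> g [e [l [[gl ga gh] _]]]; apply: in_span1; exists (d + e), i; split.
  split=> [e' x y|e' x|n x xn].
  - by rewrite gb_actDl gb_actZl gl.
  - by rewrite gb_actC ga.
  - by rewrite addrA; apply: gh; apply: gb_act_hom.
by move=> x; rewrite -gb_actA ia.
Qed.
Definition coind_act (a : C) (f : coind_space) : coind_space :=
  Subm (coind_act_subproof a f).

Lemma coind_actA a b f : coind_act (a ** b) f = coind_act a (coind_act b f).
Proof. by apply: val_inj; apply/funext => x /=; rewrite gb_actA. Qed.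
Lemma coind_actPl f : linear (coind_act^~ f).
Proof.
move=> c a b; apply: val_inj; apply/funext => x.
rewrite -[RHS]/(c *: subm_val f (x <* a) + subm_val f (x <* b)) /=.
by rewrite gb_actDr gb_actZr; apply: coind_linear.
Qed.
Lemma coind_actPr a : linear (coind_act a).
Proof. by move=> c f g; apply: val_inj. Qed.
Lemma coind_act_hom d e a f : a \in ga_gr C d -> f \in coind_hcomp e ->
  coind_act a f \in coind_hcomp (d + e).
Proof.
move=> ha /subspaceP[fl fa fh]; apply/subspaceP; split=> [c x y|c x|n x xn] /=.
- by rewrite gb_actDl gb_actZl fl.
- by rewrite gb_actC fa.
- by rewrite addrA; apply: fh; apply: gb_act_hom.
Qed.
Lemma coind_unital f : in_span
  (fun g => exists i u, g = coind_act (ga_idem C i) u) f.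
Proof.
apply: (in_span_ind_sub (in_span_axiom _) _ (subm_span_in f)) => g [d [i [_ gi]]].
apply: in_span1; exists i, g; apply: val_inj; apply/funext => x /=.
by rewrite gi.
Qed.

(* The graded left C-module (+)_i Hom_B(M 1_i, V), with (a f)(x) = f(x a). *)
Definition coind : gmod C := @GMod k I C coind_space
  (Grading coind_hcomp_span coind_hcomp_free) coind_act
  coind_actA coind_actPl coind_actPr coind_act_hom coind_unital.
End Coinduction.

Section Duality.
Variable k : fieldType.

Lemma conc_axiom (d : int) : subspace_axiom (fun x : k^o => d = 0 \/ x = 0).
Proof.
split; first by right.
by move=> a u v [->|->] [h|->]; [left|left|left|right; rewrite scaler0 addr0].
Qed.
Definition conc_hcomp d : submodClosed k^o := subspace (conc_axiom d).
Lemma conc_hcomp_span x : in_span (fun u => exists d, u \in conc_hcomp d) x.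
Proof. by apply: in_span1; exists 0; apply/subspaceP; left. Qed.
Lemma conc_hcomp_free (f : int -> k^o) (s : seq int) : uniq s ->
    (forall d, f d \in conc_hcomp d) -> \sum_(d <- s) f d = 0 ->
    forall d, d \in s -> f d = 0.
Proof.
move=> us fH sf d ds; have /subspaceP[d0|//] := fH d.
move: sf; rewrite (bigD1_seq d)//= big1 ?addr0// => e ed.
by have /subspaceP[e0|//] := fH e; rewrite e0 d0 eqxx in ed.
Qed.

(* k concentrated in degree 0, as a graded algebra and as a module over it. *)
Definition kgr : grading k^o := Grading conc_hcomp_span conc_hcomp_free.
Definition kidem (_ : unit) : k^o := 1.
Definition kmul (x y : k^o) : k^o := x * y.
Lemma kmulA : associative kmul. Proof. exact: mulrA. Qed.
Lemma kmulPl y : linear (kmul^~ y).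
Proof. by move=> a u v; rewrite /kmul mulrDl -scalerAl. Qed.
Lemma kmulPr x : linear (kmul x).
Proof. by move=> a u v; rewrite /kmul mulrDr scalerAr. Qed.
Lemma kmul_hom d e x y : x \in kgr d -> y \in kgr e -> kmul x y \in kgr (d + e).
Proof.
move=> /subspaceP[->|->] /subspaceP[->|->]; apply/subspaceP; rewrite /kmul.
- by left.
- by right; rewrite mulr0.
- by right; rewrite mul0r.
- by right; rewrite mul0r.
Qed.
Lemma kidem_hom i : kidem i \in kgr 0.
Proof. by apply/subspaceP; left. Qed.
Lemma kidem_mul i j : kmul (kidem i) (kidem j) = if i == j then kidem i else 0.
Proof. by case: i j => -[]; rewrite /kmul mulr1. Qed.
Lemma k_unital x : in_span
  (fun y => exists i j z, y = kmul (kmul (kidem i) z) (kidem j)) x.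
Proof. by apply: in_span1; exists tt, tt, x; rewrite /kmul mulr1 mul1r. Qed.
Definition kalg : galg k unit :=
  GAlg kmulA kmulPl kmulPr kmul_hom kidem_hom kidem_mul k_unital.

Definition kmod (V : lmodType k) (G : grading V) : gmod kalg.
Proof.
unshelve refine (@GMod k _ kalg V G (fun (a : k) v => a *: v) _ _ _ _ _).
- by move=> a b v; rewrite scalerA.
- by move=> v a b c; rewrite scalerDl scalerA.
- by move=> a c v w; rewrite scalerDr !scalerA mulrC.
- move=> d e a v /subspaceP[->|->] hv; first by rewrite add0r rpredZ.
  by rewrite scale0r rpred0.
- by move=> v; apply: in_span1; exists tt, v; rewrite scale1r.
Defined.

Variables (I : choiceType) (A : galg k I).

(* Graded algebra anti-automorphisms fixing the distinguished idempotents. *)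
Record duality := Duality {
  tau :> A -> A;
  tau_linear : linear tau;
  tau_bij : bijective tau;
  tau_mul : forall a b, tau (a ** b) = tau b ** tau a;
  tau_hom : forall d a, a \in ga_gr A d -> tau a \in ga_gr A d;
  tau_idem : forall i, tau (1_[A]_i) = 1_[A]_i }.

Variables (t : duality) (V : gmod A).

(* V viewed as a right A-module through t. *)
Definition twist : gbimod kalg A.
Proof.
unshelve refine (@GBimod k _ _ kalg A (kmod (gm_gr V))
  (fun (v : V) (a : A) => t a *> v) _ _ _ _ _ _).
- by move=> v b c; rewrite tau_mul gm_actA.
- by move=> a v b; rewrite /= gm_actZr.
- by move=> b a v w; rewrite gm_actDr gm_actZr.
- by move=> v a b c; rewrite tau_linear gm_actDl gm_actZl.
- by move=> d e v b vd be; rewrite addrC; apply: gm_act_hom => //; apply: tau_hom.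
- move=> v; apply: (in_span_ind_sub (in_span_axiom _) _ (@gm_unital _ _ _ V v)).
  move=> _ [i [u ->]]; apply: in_span1; exists i, u; by rewrite tau_idem.
Defined.

(* The graded dual of V: the direct sum of the dual spaces of the 1_i V_d, the
   dual of 1_i V_d being in degree -d, with (a f)(v) = f(t(a) v). *)
Definition gdual : gmod A := coind twist (kmod kgr).
End Duality.

Section ModuleNotions.
Variables (k : fieldType) (I : choiceType) (A : galg k I).

Definition alg_loc_fin_dim : Prop := forall i j d,
  fin_dim (fun x : A => x \in ga_gr A d /\ 1_[A]_i ** x ** 1_[A]_j = x).
Definition alg_bounded_below : Prop := forall i j, exists N : int,
  forall d, d < N -> forall x : A, x \in ga_gr A d ->
    1_[A]_i ** x ** 1_[A]_j = x -> x = 0.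

Implicit Types V W L P Q : gmod A.

Definition loc_fin_dim V : Prop := forall i d,
  fin_dim (fun v : V => v \in gm_gr V d /\ 1_[A]_i *> v = v).
Definition bounded_below V : Prop := forall i, exists N : int,
  forall d, d < N -> forall v : V, v \in gm_gr V d -> 1_[A]_i *> v = v -> v = 0.

Definition surj V W (f : V -> W) : Prop := forall w, exists v, f v = w.

Definition irreducible V : Prop := (exists v : V, v <> 0) /\
  forall U : gsub V, (forall v, v \in U -> v = 0) \/ (forall v, v \in U).

Definition projective P : Prop :=
  forall V W (g : V -> W) (f : P -> W),
    is_hom 0 g -> surj g -> is_hom 0 f ->
    exists h : P -> V, is_hom 0 h /\ forall x, g (h x) = f x.

(* The last clause says that the kernel of p is superfluous. *)
Definition proj_cover P L : Prop := projective P /\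
  exists p : P -> L, [/\ is_hom 0 p, surj p &
    forall U : gsub P, (forall x, exists2 u, u \in U & p (x - u) = 0) ->
      forall x, x \in U].

Definition irr_quotient L V : Prop :=
  irreducible L /\ exists p : V -> L, is_hom 0 p /\ surj p.

Definition full_irreducibles (T : Type) (L : T -> gmod A) : Prop :=
  [/\ forall b, irreducible (L b),
      forall V, irreducible V -> exists b d, gmod_iso V (gshift d (L b)) &
      forall b b' d, gmod_iso (L b) (gshift d (L b')) -> b = b'].

(* A finite filtration 0 = F 0 <= F 1 <= ... <= F n = V. *)
Definition is_filtration V (n : nat) (F : nat -> gsub V) : Prop :=
  [/\ forall v, v \in F 0%N -> v = 0, forall v, v \in F n &
      forall r, (r < n)%N -> forall v, v \in F r -> v \in F r.+1].

Definition nb_sections V L (d : int) (n : nat) (F : nat -> gsub V) : nat :=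
  #|[pred r : 'I_n | `[< gmod_iso (gsection (F r) (F r.+1)) (gshift d L) >]]|.

Definition series := int -> nat.
Definition qbar (f : series) : series := fun d => f (- d).

(* [V : L]_q = f *)
Definition irr_mult V L (f : series) : Prop := forall d,
  (exists n (F : nat -> gsub V), is_filtration n F /\ nb_sections L d n F = f d) /\
  (forall n (F : nat -> gsub V), is_filtration n F -> (nb_sections L d n F <= f d)%N).

(* dim_q Hom_A(V, W) = f *)
Definition hom_qdim V W (f : series) : Prop :=
  forall d, has_dim (fun g : V -> W => is_hom d g) (f d).

End ModuleNotions.

Section TriangularBasis.
Variables (k : fieldType) (I : choiceType) (A : galg k I).
Variables (disp : Order.disp_t) (Lam : porderType disp).

(* Only the values of tb_dot on tb_S, and of tb_X, tb_H, tb_Y at indices s, t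
   in tb_S, are meaningful; tb_fib l is the finite fiber S_l. *)
Record tri_basis := TriBasis {
  tb_S : {pred I};
  tb_dot : I -> Lam;
  tb_fib : Lam -> {fset I};
  tb_X : I -> I -> set A;
  tb_H : I -> I -> set A;
  tb_Y : I -> I -> set A;
  tb_lower_finite : forall l, exists F : {fset Lam}, forall m, (m <= l)%O -> m \in F;
  tb_fibP : forall l s, (s \in tb_fib l) = (s \in tb_S) && (tb_dot s == l);
  tb_X_hom : forall i s x, s \in tb_S -> tb_X i s x ->
    1_[A]_i ** x ** 1_[A]_s = x /\ exists d, x \in ga_gr A d;
  tb_H_hom : forall s t h, s \in tb_S -> t \in tb_S -> tb_H s t h ->
    1_[A]_s ** h ** 1_[A]_t = h /\ exists d, h \in ga_gr A d;
  tb_Y_hom : forall t j y, t \in tb_S -> tb_Y t j y ->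
    1_[A]_t ** y ** 1_[A]_j = y /\ exists d, y \in ga_gr A d;
  tb_basis : is_basis
    (fun p : A * A * A => exists s t, [/\ s \in tb_S, t \in tb_S,
       exists i, tb_X i s p.1.1, tb_H s t p.1.2 & exists j, tb_Y t j p.2])
    (fun p => p.1.1 ** p.1.2 ** p.2);
  tb_unit : forall s, s \in tb_S -> forall x,
    (tb_X s s x <-> x = 1_[A]_s) /\ (tb_Y s s x <-> x = 1_[A]_s);
  tb_order : forall s t, s \in tb_S -> t \in tb_S -> s <> t -> forall x,
    [/\ tb_X s t x -> (tb_dot t < tb_dot s)%O,
        tb_H s t x -> tb_dot s = tb_dot t &
        tb_Y s t x -> (tb_dot s < tb_dot t)%O];
  tb_finite : forall i, i \notin tb_S -> exists F : {fset I},
    forall s, s \in tb_S ->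
      ((exists x, tb_X i s x) -> s \in F) /\ ((exists y, tb_Y s i y) -> s \in F) }.

Variable T : tri_basis.

Definition e_ (l : Lam) : A := \sum_(s <- tb_fib T l) 1_[A]_s.

Lemma e_hom l : e_ l \in ga_gr A 0.
Proof. by rewrite /e_ rpred_sum// => s _; apply: ga_idem_hom. Qed.

Lemma e_mul l : e_ l ** e_ l = e_ l.
Proof.
have suml (s : seq I) (F : I -> A) y :
    (\sum_(i <- s) F i) ** y = \sum_(i <- s) F i ** y.
  by elim: s => [|i s IH]; rewrite ?big_nil ?ga_mul0l// !big_cons ga_mulDl IH.
have sumr (s : seq I) (F : I -> A) y :
    y ** (\sum_(i <- s) F i) = \sum_(i <- s) y ** F i.
  by elim: s => [|i s IH]; rewrite ?big_nil ?ga_mul0r// !big_cons ga_mulDr IH.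
rewrite {1}/e_ suml [RHS]/e_; apply: eq_big_seq => s sl.
rewrite sumr (bigD1_seq s)//= ?fset_uniq// ga_idem_idem big1 ?addr0// => t ts.
by rewrite ga_idem_mul eq_sym (negPf ts).
Qed.

(* The two-sided ideal generated by the e_m, m not >= l; as e_m is an
   idempotent, it is spanned by the products a e_m b. *)
Definition ideal_gen (l : Lam) (x : A) : Prop :=
  exists m a b, ~~ (l <= m)%O /\ x = a ** e_ m ** b.
Definition ideal_sub (l : Lam) : submodClosed A := span (ideal_gen l).

Lemma ideal_mull l a x : x \in ideal_sub l -> a ** x \in ideal_sub l.
Proof.
move=> /subspaceP h; apply/subspaceP; elim: {x}h => [|c y z [m [b [b' [lm ->]]]] _ IH].
  by rewrite ga_mul0r; left.
rewrite ga_mulDr ga_mulZr; apply: in_spanD => //.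
by exists m, (a ** b), b'; rewrite !ga_mulA.
Qed.
Lemma ideal_mulr l a x : x \in ideal_sub l -> x ** a \in ideal_sub l.
Proof.
move=> /subspaceP h; apply/subspaceP; elim: {x}h => [|c y z [m [b [b' [lm ->]]]] _ IH].
  by rewrite ga_mul0l; left.
rewrite ga_mulDl ga_mulZl; apply: in_spanD => //.
by exists m, b, (b' ** a); rewrite !ga_mulA.
Qed.
Lemma ideal_gr l : graded_sub (ga_gr A) (ideal_sub l).
Proof.
move=> x /subspaceP; apply: (in_span_ind_sub (in_span_axiom _)).
move=> {x} _ [m [a [b [lm ->]]]].
elim: {a}(hcomp_span (ga_gr A) a) => [|c a a' [d ad] _ IH].
  by rewrite !ga_mul0l; left.
rewrite !(ga_mulDl, ga_mulZl); apply: in_span_closed => // {IH}.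
elim: {b}(hcomp_span (ga_gr A) b) => [|c' b b' [f bf] _ IH].
  by rewrite ga_mul0r; left.
rewrite ga_mulDr ga_mulZr; apply: in_spanD => //; split.
  by apply/subspaceP/in_span1; exists m, a, b.
by exists (d + 0 + f); rewrite !ga_mul_hom// e_hom.
Qed.
Definition ideal (l : Lam) : gideal A :=
  GIdeal (@ideal_mull l) (@ideal_mulr l) (@ideal_gr l).

Definition A_geq (l : Lam) : galg k I := qalg (ideal l).

Definition ebar_elt (l : Lam) : A_geq l := qpi (ideal l) (e_ l).
Lemma ebar_hom l : ebar_elt l \in ga_gr (A_geq l) 0.
Proof. by apply: quot_hcomp_pi; apply: e_hom. Qed.
Lemma ebar_mul l : ebar_elt l ** ebar_elt l = ebar_elt l.
Proof. by apply: etrans (qalg_mulE _ _ _) _; rewrite e_mul. Qed.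
Definition ebar (l : Lam) : idem0 (A_geq l) := Idem0 (ebar_hom l) (ebar_mul l).

Definition A_at (l : Lam) : galg k unit := corner (ebar l).

(* The functors j^l_! and j^l_*, followed by inflation to A. *)
Definition j_shriek (l : Lam) (V : gmod (A_at l)) : gmod A :=
  inflate (tensor (Ce (ebar l)) V).
Definition j_star (l : Lam) (V : gmod (A_at l)) : gmod A :=
  inflate (coind (eC (ebar l)) V).

Definition delta_layer (l : Lam) (V : gmod A) : Prop :=
  exists Vbar : gmod (A_at l), [/\ projective Vbar, loc_fin_dim Vbar,
    bounded_below Vbar & gmod_iso V (j_shriek Vbar)].

Definition delta_flag (V : gmod A) : Prop :=
  exists n (F : nat -> gsub V) (l : 'I_n -> Lam),
    [/\ is_filtration n F, injective l &
        forall r : 'I_n, delta_layer (l r) (gsection (F r) (F r.+1))].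

(* (V : Delta(a))_q = f, where Na is the module bar-nabla(a). *)
Definition delta_mult (V Na : gmod A) (f : series) : Prop :=
  exists2 h : series, hom_qdim V Na h & f = qbar h.

End TriangularBasis.

(* Main.v *)
From HB Require Import structures.
From mathcomp Require Import all_boot all_order all_algebra.
From mathcomp Require Import finmap boolp functions.
From mathcomp Require Import zify.
Require Import Defs.

Set Implicit Arguments.
Unset Strict Implicit.
Unset Printing Implicit Defensive.

Import Order.TTheory GRing.Theory Num.Theory.
Local Open Scope ring_scope.

(** Why the theorem holds.

    Write P = P(b), L = L(b) and let p : P -> L be the covering map.  An
    irreducible module is generated by a homogeneous vector of some 1_i L, so
    P is a quotient, hence a direct summand, of a shift of A 1_i.  This is
    recorded as a presentation: a generator x0 of P and an A-linear section
    sg : P -> A of a |-> a x0 ([projective_presentation]).  It reduces questions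
    about P to questions about A.

    Flag.  The key fact about the basis is [bspan_idem]: a 1_s c is a combination
    of basis vectors whose inner indices have weights at most that of s.
    Consequently the ideal J defining A_{>= l} is spanned by the basis vectors of
    inner weights not >= l ([idealP]).  Only finitely many weights occur in
    A 1_i.  List them so that smaller weights come first, and filter P by the
    preimages under sg of the ideals generated by the first r weights.  The
    section at a weight l is A e_l P modulo J P.  With Q = e_l (P / J P),
    multiplication A_{>= l} e_l (x) Q -> P / J P is injective: since A has a
    basis, linear maps can be prescribed on basis vectors, and sending xhy to
    the tensor of x and hy x0 gives a left inverse ([tmul_left_inv]).  In the
    same way, maps out of Q can be prescribed on the classes of y x0, so Q is
    projective ([layer_projective]).

    Multiplicities.  For a module N with finite-dimensional spaces Hom(P, N)_d,
    the multiplicity of q^d L in N is the dimension of Hom(P, N)_d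
    ([irr_mult_hom]).  A section W / U isomorphic to q^d L yields a homomorphism
    P -> W that does not land in U; conversely a homomorphism g : P -> W not
    landing in U produces the section of U + g(P) by U + g(ker p), and by
    Schur's lemma this costs exactly one dimension.  An irreducible A_l-module is
    finite-dimensional, because A_l is unital and bounded below
    ([irr_unital_supp]).  Hence standard and costandard modules are locally
    finite-dimensional, and for N = bar-nabla(a) the counting statement is the
    reciprocity formula.

    Duality.  It remains to compare Hom(P, bar-nabla(a)) in degree -d with
    Hom(P, bar-Delta(a)) in degree d.  The isomorphism of L(a) with a shift of its
    dual is a contravariant form, which restricts to L_l(a) = e_l L(a)
    ([weight_space_exists]) and induces a contravariant pairing of bar-Delta(a)
    and bar-nabla(a).  As L_l(a) is finite-dimensional, the pairing is
    nondegenerate on both sides ([pair_nd_l], [pair_nd_r]).  Let eps = sg x0, an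
    idempotent with P = A eps up to a shift.  The pairing makes eps on one module
    adjoint to tau eps, or to tau^-1 eps, on the other.  As L(b) is self-dual up
    to a shift, P has generators fixed by tau eps and by tau^-1 eps too
    ([tau_generator], [tau_inv_generator]).  Evaluating at these generators
    bounds each of the two dimensions by the other ([hom_dim_swap]). *)

(** * Linear algebra *)

Section LinearMaps.
Variables (k : fieldType) (V W : lmodType k) (f : V -> W) (lf : linear f).

Definition lin : {linear V -> W} :=
  HB.pack f (GRing.isLinear.Build k V W *:%R f lf).

Lemma lin0 : f 0 = 0. Proof. exact: (linear0 lin). Qed.
Lemma linB u v : f (u - v) = f u - f v. Proof. exact: (linearB lin). Qed.
Lemma linZ a v : f (a *: v) = a *: f v. Proof. exact: (linearZ_LR lin). Qed.
Lemma lin_sum (J : Type) (s : seq J) (P : pred J) (F : J -> V) :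
  f (\sum_(j <- s | P j) F j) = \sum_(j <- s | P j) f (F j).
Proof. exact: (linear_sum lin). Qed.

Lemma lin_span_eq0 (P : V -> Prop) v :
  (forall u, P u -> f u = 0) -> in_span P v -> f v = 0.
Proof.
move=> h; apply: (in_span_ind_sub (Q := fun v => f v = 0)) => //.
by split=> [|a x y hx hy]; rewrite ?lin0// lf hx hy scaler0 addr0.
Qed.

Lemma lin_span (P : V -> Prop) (Q : W -> Prop) v :
  (forall u, P u -> in_span Q (f u)) -> in_span P v -> in_span Q (f v).
Proof.
move=> h; apply: (in_span_ind_sub (Q := fun v => in_span Q (f v))) => //.
split=> [|a x y hx hy]; first by rewrite lin0; left.
by rewrite lf; apply: in_span_closed.
Qed.

End LinearMaps.

Section Spans.
Variables (k : fieldType) (V : lmodType k).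
Implicit Types (P Q : V -> Prop) (v : V).

Lemma lin_span_eq (W : lmodType k) (f g : V -> W) P v :
  linear f -> linear g -> (forall u, P u -> f u = g u) ->
  in_span P v -> f v = g v.
Proof.
move=> lf lg h; apply: (in_span_ind_sub (Q := fun v => f v = g v)) => //.
by split=> [|a x y hx hy]; rewrite ?(lin0 lf) ?(lin0 lg)// lf lg hx hy.
Qed.

Lemma in_span_mono P Q v : (forall u, P u -> Q u) -> in_span P v -> in_span Q v.
Proof.
move=> PQ; apply: in_span_ind_sub; first exact: in_span_axiom.
by move=> u /PQ; apply: in_span1.
Qed.

Lemma in_span_bind P Q v :
  (forall u, P u -> in_span Q u) -> in_span P v -> in_span Q v.
Proof. by move=> PQ; apply: in_span_ind_sub => //; apply: in_span_axiom. Qed.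

Lemma in_span_sum (J : eqType) (s : seq J) (F : J -> V) P :
  (forall j, j \in s -> in_span P (F j)) -> in_span P (\sum_(j <- s) F j).
Proof.
move=> h; rewrite big_seq; elim/big_rec: _ => [|j x js IH]; first by left.
by apply: in_span_D => //; apply: h.
Qed.

Lemma in_span_coef (T : eqType) (D : T -> Prop) (F : T -> V) v :
  in_span (fun u => exists2 t, D t & u = F t) v ->
  exists (s : seq T) (c : T -> k),
    [/\ uniq s, forall t, t \in s -> D t & v = \sum_(t <- s) c t *: F t].
Proof.
elim=> {v} [|a v w [t Dt ->] _ [s [c [us sD ->]]]].
  by exists [::], (fun=> 0); split=> //; rewrite big_nil.
pose c' x := (if x == t then a else 0) + (if x \in s then c x else 0).
pose s' := undup (t :: s).
exists s', c'; split; first exact: undup_uniq.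
  by move=> x; rewrite mem_undup inE => /orP[/eqP->//|/sD].
under [in RHS]eq_bigr do rewrite scalerDl.
rewrite big_split /=; congr (_ + _).
  rewrite (bigD1_seq t) ?undup_uniq//= ?mem_undup ?mem_head// eqxx.
  by rewrite big1 ?addr0// => x /negPf->; rewrite scale0r.
rewrite [RHS](bigID (fun x => x \in s)) /= [X in _ = _ + X]big1; last first.
  by move=> x /negPf->; rewrite scale0r.
rewrite addr0 -[RHS]big_filter big_seq_cond [LHS](_ : _ = \sum_(i <- s) (if i \in s then c i else 0) *: F i).
  apply: perm_big; apply: uniq_perm => //; first by rewrite filter_uniq ?undup_uniq.
  by move=> x; rewrite mem_filter mem_undup inE; case: (boolP (x \in s)); rewrite ?orbT.
by rewrite [RHS]big_seq_cond; apply: eq_bigr => x /andP[->].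
Qed.
End Spans.

Section Bases.
Variables (k : fieldType) (V : lmodType k) (T : eqType).
Variables (D : T -> Prop) (f : T -> V) (fB : is_basis D f).

Let D_ (K : T -> Prop) (u : V) : Prop := exists2 t, D t /\ K t & u = f t.

(** The graph of the extension is the span of the pairs of a basis vector and
    its prescribed image; independence of the basis makes it functional. *)
Lemma basis_lift (W : lmodType k) (g : T -> W) :
  exists h : V -> W, linear h /\ forall t, D t -> h (f t) = g t.
Proof.
pose Gr := in_span (fun p : V * W => exists2 t, D t & p = (f t, g t)).
have fst_lin : linear (fst : V * W -> V) by [].
have snd_lin : linear (snd : V * W -> W) by [].
have Gr0 w : Gr (0, w) -> w = 0.
  move=> /in_span_coef[s [c [us sD e]]].
  have e1 := congr1 fst e; have /= -> := congr1 snd e.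
  rewrite (lin_sum snd_lin) big_seq big1// => t ts /=.
  rewrite (proj2 fB s c us sD _ t ts) ?scale0r//.
  by rewrite (lin_sum fst_lin) in e1; exact/esym.
have tot v : exists w, Gr (v, w).
  elim: {v}(proj1 fB v) => [|a _ v [t Dt ->] _ [w hw]]; first by exists 0; left.
  exists (a *: g t + w); have -> : (a *: f t + v, a *: g t + w) =
    a *: (f t, g t) + (v, w) :> (V * W)%type by [].
  by apply: in_spanD => //; exists t.
pose h v := projT1 (cid (tot v)); have hP v : Gr (v, h v) by rewrite /h; case: cid.
have Gr_uniq v w : Gr (v, w) -> h v = w.
  move=> hw; apply/eqP; rewrite -subr_eq0; apply/eqP/Gr0.
  rewrite -[0](subrr v); have -> : (v - v, h v - w) = -1 *: (v, w) + (v, h v)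
      :> (V * W)%type by rewrite scaleN1r; congr pair; rewrite /= addrC.
  exact: in_span_closed hw (hP v).
exists h; split=> [a u v|t Dt]; apply: Gr_uniq.
  have -> : (a *: u + v, a *: h u + h v) =
    a *: (u, h u) + (v, h v) :> (V * W)%type by [].
  exact: in_span_closed (hP u) (hP v).
by apply: in_span1; exists t.
Qed.

(** The linear map that fixes the basis vectors in L and kills the others is
    the identity on v. *)
Lemma basis_span_cap (K L : T -> Prop) v :
  in_span (D_ K) v -> in_span (D_ L) v -> in_span (D_ (fun t => K t /\ L t)) v.
Proof.
move=> vK vL.
have [h [lh hf]] := basis_lift (fun t => if `[< L t >] then f t else 0).
have -> : v = h v.
  apply/esym; apply: (lin_span_eq lh (g := idfun) _ _ vL) => // _ [t [Dt Lt] ->].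
  by rewrite hf// asboolT.
apply: (lin_span lh _ vK) => _ [t [Dt Kt] ->]; rewrite hf//.
by case: asboolP => Lt; [apply: in_span1; exists t|left].
Qed.

(** Expand v in the basis and apply p.  For the projections of A onto 1_i A,
    A 1_j and A_d, this shows that these subspaces are spanned by basis
    vectors. *)
Lemma basis_span_proj (p : V -> V) v : linear p ->
  (forall t, D t -> p (f t) = f t \/ p (f t) = 0) -> p v = v ->
  in_span (D_ (fun t => p (f t) = f t)) v.
Proof.
move=> lp hp <-; apply: (lin_span lp _ (proj1 fB v)) => _ [t Dt ->].
case: (hp t Dt) => pt; rewrite pt; last by left.
by apply: in_span1; exists t.
Qed.

Lemma basis_neq0 t : D t -> f t <> 0.
Proof.
move=> Dt ft; have c0 : (1 : k) = 0; last by have := oner_neq0 k; rewrite c0 eqxx.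
apply: (proj2 fB [:: t] (fun=> 1) isT _ _ t (mem_head _ _)).
  by move=> x; rewrite inE => /eqP->.
by rewrite big_seq1 ft scaler0.
Qed.

End Bases.

Section Dimension.
Variable k : fieldType.

Definition indep (V : lmodType k) m (g : 'I_m -> V) : Prop :=
  forall c : 'I_m -> k, \sum_i c i *: g i = 0 -> forall i, c i = 0.

Definition fin_gen (V : lmodType k) (P : V -> Prop) : Prop :=
  exists s : seq V, forall v, P v -> in_span (fun u => u \in s) v.

Lemma in_span_ord (V : lmodType k) m (b : 'I_m -> V) v :
  in_span (fun u => exists i, u = b i) v -> exists c : 'I_m -> k, v = \sum_i c i *: b i.
Proof.
elim=> {v} [|a v w [i ->] _ [c ->]].
  by exists (fun=> 0); rewrite big1// => i _; rewrite scale0r.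
exists (fun j => a *+ (j == i) + c j).
under [RHS]eq_bigr do rewrite scalerDl.
rewrite big_split /=; congr (_ + _).
by rewrite (bigD1 i)//= eqxx big1 ?addr0// => j /negPf->; rewrite scale0r.
Qed.

(** A linear dependency between the rows of the coefficient matrix would be
    one between the g i. *)
Lemma indep_le_span (V : lmodType k) m n (g : 'I_m -> V) (b : 'I_n -> V) :
  indep g -> (forall j, in_span (fun u => exists i, u = b i) (g j)) -> (m <= n)%N.
Proof.
move=> gI gb; pose M := \matrix_(j < m, i < n) projT1 (cid (in_span_ord (gb j))) i.
have gM j : g j = \sum_i M j i *: b i.
  by rewrite [LHS](projT2 (cid (in_span_ord (gb j)))); apply: eq_bigr => i _; rewrite mxE.
have [/row_freeP[N MN]|nf] := boolP (row_free M).
  rewrite -(mxrank1 k m) -MN; apply: leq_trans (mxrankM_maxl _ _) _.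
  exact: rank_leq_col.
have /rowV0Pn[r /sub_kermxP rM r0] : kermx M != 0 by rewrite kermx_eq0.
case/eqP: r0; apply/rowP => j; rewrite [RHS]mxE; apply: (gI (fun j => r 0 j)).
under eq_bigr do rewrite gM scaler_sumr.
rewrite exchange_big /= big1// => i _.
under eq_bigr do rewrite scalerA.
by rewrite -scaler_suml; have /rowP/(_ i) := rM; rewrite !mxE => ->; rewrite scale0r.
Qed.

(** A family of maximal size among the independent ones in P spans P. *)
Lemma fin_dim_bounded (V : lmodType k) (P : V -> Prop) n : subspace_axiom P ->
  (forall m (g : 'I_m -> V), indep g -> (forall j, P (g j)) -> (m <= n)%N) ->
  fin_dim P.
Proof.
move=> PS bnd; pose Q m := `[< exists g : 'I_m -> V, indep g /\ forall j, P (g j) >].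
have Q0 : exists m, Q m.
  exists 0%N; apply/asboolP; exists (fun=> 0); split=> [c _ []//|[]//].
have Qn m : Q m -> (m <= n)%N by move=> /asboolP[g [gI gP]]; apply: bnd gI gP.
case: (ex_maxnP Q0 Qn) => m /asboolP[g [gI gP]] mmax.
exists m, g; split=> // v Pv; apply: contrapT => ng.
pose g' (i : 'I_m.+1) := if unlift ord0 i is Some j then g j else v.
suff /mmax : Q m.+1 by rewrite ltnn.
apply/asboolP; exists g'; split=> [c|j]; last by rewrite /g'; case: unlift.
rewrite big_ord_recl /g' unlift_none; under eq_bigr do rewrite liftK.
move=> e; have c0 : c ord0 = 0.
  apply: contrapT => /eqP c0; apply: ng.
  exists (fun j => - (c ord0)^-1 * c (lift ord0 j)).
  under eq_bigr do rewrite -scalerA.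
  rewrite -scaler_sumr; apply: (scalerI c0); rewrite scalerA mulrN divff// scaleN1r.
  by apply/eqP; rewrite -addr_eq0 e.
move=> i; case: (unliftP ord0 i) => [j ->|->]//.
by apply: (gI (fun j => c (lift ord0 j))); rewrite -[RHS]e c0 scale0r add0r.
Qed.

Section OneSpace.
Variable V : lmodType k.
Implicit Types P Q : V -> Prop.

Lemma mem_span_nth (s : seq V) v : in_span (fun u => u \in s) v ->
  in_span (fun u => exists i : 'I_(size s), u = nth 0 s i) v.
Proof.
apply: in_span_mono => u us; have h : (index u s < size s)%N by rewrite index_mem.
by exists (Ordinal h); rewrite nth_index.
Qed.

Lemma fin_dim_gen P : subspace_axiom P -> fin_gen P -> fin_dim P.
Proof.
move=> PS [s Ps]; apply: (fin_dim_bounded (n := size s)) => // m g gI gP.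
by apply: (indep_le_span gI) => j; apply: mem_span_nth; apply/Ps/gP.
Qed.

Lemma fin_gen_dim P : fin_dim P -> fin_gen P.
Proof.
move=> [n [b [_ _ bP]]]; exists [seq b i | i : 'I_n] => v /bP[c ->].
by apply: in_span_sum => i _; apply/in_span_Z/in_span1/map_f; rewrite mem_enum.
Qed.

Lemma fin_gen_sub P Q : (forall v, P v -> in_span Q v) -> fin_gen Q -> fin_gen P.
Proof. by move=> PQ [s Qs]; exists s => v /PQ; apply: in_span_bind. Qed.

Lemma fin_gen_sum (J : eqType) (r : seq J) (P : J -> V -> Prop) :
  (forall j, j \in r -> fin_gen (P j)) ->
  fin_gen (fun v => exists2 j, j \in r & P j v).
Proof.
elim: r => [|j r IH] h; first by exists [::] => v [].
have [|s hs] := IH; first by move=> i ir; apply: h; rewrite inE ir orbT.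
have [s' hs'] := h j (mem_head _ _).
exists (s' ++ s) => v [i]; rewrite inE => /orP[/eqP->|ir] Pv.
  by apply: in_span_mono (hs' _ Pv) => u; rewrite mem_cat => ->.
by apply: in_span_mono (hs v _) => [u|]; [rewrite mem_cat orbC => ->|exists i].
Qed.

Lemma dim_gen_le P n (b : 'I_n -> V) m : has_dim P m ->
  (forall v, P v -> in_span (fun u => exists i, u = b i) v) -> (m <= n)%N.
Proof. by move=> [g [gP gI _]] h; apply: (indep_le_span gI) => j; apply/h/gP. Qed.

Lemma has_dim_span P n : has_dim P n -> exists b : 'I_n -> V,
  [/\ indep b, forall i, P (b i) &
      forall v, P v -> in_span (fun u => exists i, u = b i) v].
Proof.
move=> [b [bP bI bS]]; exists b; split=> // v /bS[c ->].
by apply: in_span_sum => i _; apply/in_span_Z/in_span1; exists i.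
Qed.

Lemma dim_le P Q m n : (forall v, P v -> Q v) -> has_dim P m -> has_dim Q n ->
  (m <= n)%N.
Proof.
move=> PQ Pm /has_dim_span[b [_ _ bS]].
by apply: (dim_gen_le Pm) => v /PQ; apply: bS.
Qed.

Lemma dim_lt P Q m n v : (forall u, P u -> Q u) -> subspace_axiom P ->
  Q v -> ~ P v -> has_dim P m -> has_dim Q n -> (m < n)%N.
Proof.
move=> PQ [P0 PD] Qv nPv [b [bP bI bS]] /has_dim_span[b' [_ _ bS']].
pose g (i : 'I_m.+1) := if unlift ord0 i is Some j then b j else v.
apply: (@indep_le_span _ _ _ g b'); last first.
  by move=> j; apply: bS'; rewrite /g; case: unlift => // i; apply/PQ/bP.
move=> c; rewrite big_ord_recl /g unlift_none; under eq_bigr do rewrite liftK.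
move=> e; have PS (F : 'I_m -> k) : P (\sum_i F i *: b i).
  by elim/big_rec: _ => // i x _; apply: PD.
have c0 : c ord0 = 0.
  apply: contrapT => /eqP c0; apply: nPv.
  rewrite (_ : v = (- (c ord0)^-1) *: \sum_i c (lift ord0 i) *: b i + 0).
    by apply: PD.
  rewrite addr0; apply: (scalerI c0); rewrite scalerA mulrN divff// scaleN1r.
  by apply/eqP; rewrite -addr_eq0 e.
move=> i; case: (unliftP ord0 i) => [j ->|->]//.
by apply: (bI (fun j => c (lift ord0 j))); rewrite -[RHS]e c0 scale0r add0r.
Qed.

Lemma dim_le_add1 P Q m n w : has_dim P m -> has_dim Q n ->
  (forall v, Q v -> exists a, P (v - a *: w)) -> (n <= m.+1)%N.
Proof.
move=> /has_dim_span[b [_ _ bS]] Qn h.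
pose g (i : 'I_m.+1) := if unlift ord0 i is Some j then b j else w.
apply: (@dim_gen_le _ _ g _ Qn) => v /h[a /bS hv].
rewrite -(subrK (a *: w) v); apply: in_span_D; last first.
  by apply/in_span_Z/in_span1; exists ord0; rewrite /g unlift_none.
by apply: in_span_mono hv => _ [i ->]; exists (lift ord0 i); rewrite /g liftK.
Qed.

Lemma fin_dim_sub P Q : (forall v, P v -> Q v) -> subspace_axiom P ->
  fin_dim Q -> fin_dim P.
Proof.
move=> PQ PS /fin_gen_dim Qf; apply: fin_dim_gen => //.
by apply: fin_gen_sub Qf => v /PQ; apply: in_span1.
Qed.

End OneSpace.

Lemma fin_gen_image (V W : lmodType k) (P : V -> Prop) (Q : W -> Prop) (f : V -> W) :
  linear f -> fin_gen P -> (forall w, Q w -> exists2 v, P v & w = f v) -> fin_gen Q.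
Proof.
move=> lf [s Ps] h; exists [seq f v | v <- s] => w /h[v /Ps hv ->].
by apply: (lin_span lf _ hv) => u us; apply/in_span1/map_f.
Qed.

Lemma fin_dim_inj (V W : lmodType k) (P : V -> Prop) (Q : W -> Prop) (f : V -> W) :
  subspace_axiom P -> linear f -> fin_gen Q -> (forall v, P v -> Q (f v)) ->
  (forall v, P v -> f v = 0 -> v = 0) -> fin_dim P.
Proof.
move=> PS lf [s Qs] PQ inj; apply: (fin_dim_bounded (n := size s)) => // m g gI gP.
have fgI : indep (f \o g).
  move=> c; under eq_bigr do rewrite /= -(linZ lf).
  rewrite -(lin_sum lf) => /inj h; apply/gI/h.
  by case: PS => P0 PD; elim/big_rec: _ => // i x _; apply: PD.
by apply: (indep_le_span fgI) => j; apply: mem_span_nth; apply/Qs/PQ/gP.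
Qed.

Lemma dim_le_pairing (V W : lmodType k) (P : V -> Prop) (Q : W -> Prop) m n
    (B : V -> W -> k) :
  subspace_axiom P -> has_dim P m -> has_dim Q n ->
  (forall w, linear (B^~ w : V -> k^o)) -> (forall v, linear (B v : W -> k^o)) ->
  (forall v, P v -> (forall w, Q w -> B v w = 0) -> v = 0) -> (m <= n)%N.
Proof.
move=> [P0 PD] [b [bP bI _]] /has_dim_span[b' [_ _ bS']] Bl Br nd.
pose F v : 'rV[k]_n := \row_i B v (b' i).
have lF : linear F.
  by move=> a u v; apply/rowP => i; rewrite !mxE; apply: (Bl (b' i)).
have FbI : indep (F \o b).
  move=> c; under eq_bigr do rewrite /= -(linZ lF).
  rewrite -(lin_sum lF) => F0; apply: bI; apply: nd.
    by elim/big_rec: _ => // i x _; apply: PD.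
  move=> w /bS'; apply: (lin_span_eq0 (Br _)) => _ [i ->].
  by have /rowP/(_ i) := F0; rewrite !mxE.
apply: (@indep_le_span _ _ _ _ (fun i => delta_mx 0 i) FbI) => j.
rewrite [X in in_span _ X]row_sum_delta; apply: in_span_sum => i _.
by apply/in_span_Z/in_span1; exists i.
Qed.

(** Take for f a coordinate in a basis of P that does not vanish at p v. *)
Lemma dim_separate (V : lmodType k) (P : V -> Prop) (p : V -> V) v :
  linear p -> (forall u, P (p u)) -> fin_dim P -> p v <> 0 ->
  exists f : V -> k^o, [/\ linear f, f v <> 0 & forall u, p u = 0 -> f u = 0].
Proof.
move=> lp pP [n [b [_ bI bS]]] pv.
have co u : exists c : 'rV[k]_n, p u = \sum_i c 0 i *: b i.
  have [c ->] := bS _ (pP u); exists (\row_i c i).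
  by apply: eq_bigr => i _; rewrite mxE.
pose c u := projT1 (cid (co u)).
have cE u : p u = \sum_i c u 0 i *: b i by exact: projT2 (cid (co u)).
have cU u (r : 'rV[k]_n) : p u = \sum_i r 0 i *: b i -> c u = r.
  rewrite cE => e; apply/rowP => i; apply/eqP; rewrite -subr_eq0; apply/eqP.
  apply: (bI (fun i => c u 0 i - r 0 i)).
  under eq_bigr do rewrite scalerBl.
  by rewrite sumrB e subrr.
have lc : linear c.
  move=> a x y; apply: cU; rewrite lp !cE scaler_sumr -big_split /=.
  by apply: eq_bigr => i _; rewrite !mxE scalerDl scalerA.
have [i ci] : exists i, c v 0 i <> 0.
  apply: contrapT => h; apply: pv; rewrite cE big1// => i _.
  have -> : c v 0 i = 0 by apply: contrapT => ?; apply: h; exists i.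
  exact: scale0r.
exists (fun u => c u 0 i); split=> // [a x y|u pu]; first by rewrite lc !mxE.
by rewrite (cU u 0) ?mxE// pu big1// => j _; rewrite mxE scale0r.
Qed.

End Dimension.

(** * Graded modules *)

Section GradedMaps.
Variables (k : fieldType) (V W : lmodType k) (G : grading V) (H : grading W).

Lemma hproj_comm (f : V -> W) d n v : linear f ->
  (forall m u, u \in G m -> f u \in H (m + d)) ->
  f (hproj G n v) = hproj H (n + d) (f v).
Proof.
move=> lf hf; apply: (lin_span_eq (f := fun v => f (hproj G n v))
  (g := fun v => hproj H (n + d) (f v)) _ _ _ (hcomp_span G v)).
- by move=> a x y /=; rewrite linearP lf.
- by move=> a x y /=; rewrite lf linearP.
move=> u [m um]; rewrite (hproj_hom _ um) (hproj_hom _ (hf _ _ um)).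
by rewrite (inj_eq (addIr d)); case: eqP => // _; apply: lin0.
Qed.

Lemma hproj_neq0 v : v <> 0 -> exists d, hproj G d v <> 0.
Proof.
move=> v0; apply: contrapT => h; apply: v0; rewrite (hproj_sum G v) big1// => d _.
by apply: contrapT => hd; apply: h; exists d.
Qed.
End GradedMaps.

Section Modules.
Variables (k : fieldType) (I : choiceType) (A : galg k I).
Implicit Types V W X Y : gmod A.

Lemma ga_sum_l (J : Type) (s : seq J) (F : J -> A) y :
  (\sum_(j <- s) F j) ** y = \sum_(j <- s) F j ** y.
Proof. exact: (lin_sum (ga_mulPl y)). Qed.

Lemma gm_sum_l V (J : Type) (s : seq J) (F : J -> A) (v : V) :
  (\sum_(j <- s) F j) *> v = \sum_(j <- s) F j *> v.
Proof. exact: (lin_sum (gm_actPl v)). Qed.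

Lemma act_idem_hom V i d (v : V) : v \in gm_gr V d -> 1_[A]_i *> v \in gm_gr V d.
Proof. by move=> vd; rewrite -[d]add0r gm_act_hom ?ga_idem_hom. Qed.

Lemma act_idem_hproj V i d (v : V) :
  1_[A]_i *> hproj (gm_gr V) d v = hproj (gm_gr V) d (1_[A]_i *> v).
Proof.
rewrite -{2}[d]addr0; apply: (hproj_comm (f := gm_act V _)); first exact: gm_actPr.
by move=> m u um; rewrite addr0 act_idem_hom.
Qed.

Lemma gm_span V (v : V) :
  in_span (fun u => exists i d, u \in gm_gr V d /\ 1_[A]_i *> u = u) v.
Proof.
apply: (in_span_bind _ (gm_unital v)) => _ [i [u ->]].
apply: (lin_span (gm_actPr _) _ (hcomp_span (gm_gr V) u)) => w [d wd].
apply: in_span1; exists i, d; split; first exact: act_idem_hom.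
by rewrite -gm_actA ga_idem_idem.
Qed.

(** ** Graded submodules given by predicates *)

Definition gsub_axiom V (Q : V -> Prop) : Prop :=
  [/\ subspace_axiom Q, forall a v, Q v -> Q (a *> v) &
      forall d v, Q v -> Q (hproj (gm_gr V) d v)].

Section MkGsub.
Variables (V : gmod A) (Q : V -> Prop) (hQ : gsub_axiom Q).
Let QS : subspace_axiom Q. Proof. by case: hQ. Qed.

Lemma mkgsub_act a v : v \in subspace QS -> a *> v \in subspace QS.
Proof. by move=> /subspaceP h; apply/subspaceP; case: hQ => _ + _; apply. Qed.
Lemma mkgsub_gr : graded_sub (gm_gr V) (subspace QS).
Proof.
move=> v /subspaceP vQ; rewrite [v](hproj_sum (gm_gr V)).
apply: in_span_sum => d _; apply: in_span1; split; last by exists d; apply: hproj_mem.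
by apply/subspaceP; case: hQ => _ _; apply.
Qed.
Definition mkgsub : gsub V := GSub mkgsub_act mkgsub_gr.
Lemma mkgsubP v : v \in mkgsub <-> Q v.
Proof. by split=> [/(subspaceP QS)|h]//; apply/(subspaceP QS). Qed.
End MkGsub.

Lemma gsubP V (U : gsub V) : gsub_axiom (fun v => v \in U).
Proof.
split; first exact: submod_axiom.
  by move=> a v; apply: gs_act.
exact: graded_sub_proj (@gs_gr _ _ _ _ U).
Qed.

Lemma irr_gsub V (Q : V -> Prop) v : irreducible V -> gsub_axiom Q ->
  Q v -> v <> 0 -> forall w, Q w.
Proof.
move=> [_ irr] hQ Qv v0 w; case: (irr (mkgsub hQ)) => h; last exact/(mkgsubP hQ)/h.
by case: v0; apply/h/(mkgsubP hQ).
Qed.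

Lemma irr_vec V : irreducible V -> exists i d (v : V), [/\ v \in gm_gr V d, 1_[A]_i *> v = v & v <> 0].
Proof.
move=> [[v v0] _]; apply: contrapT => h; apply: v0.
apply: (lin_span_eq0 (f := idfun) _ _ (gm_span v)) => // u [i [d [ud iu]]].
by apply: contrapT => u0; apply: h; exists i, d, u.
Qed.

Lemma gsub_axiom0 V : gsub_axiom (fun v : V => v = 0).
Proof.
split=> [|a v ->|d v ->]; last by rewrite linear0.
  by split=> // a u v -> ->; rewrite scaler0 addr0.
exact: gm_act0r.
Qed.

Lemma gsub_axiomT V : gsub_axiom (fun _ : V => True). Proof. by []. Qed.

Lemma gsub_axiomD V (P Q : V -> Prop) : gsub_axiom P -> gsub_axiom Q ->
  gsub_axiom (fun v => exists x y, [/\ P x, Q y & v = x + y]).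
Proof.
move=> [[P0 PD] Pa Ph] [[Q0 QD] Qa Qh]; split.
- split; first by exists 0, 0; rewrite addr0.
  move=> a _ _ [x [y [Px Qy ->]]] [x' [y' [Px' Qy' ->]]].
  exists (a *: x + x'), (a *: y + y'); split; [exact: PD|exact: QD|].
  by rewrite scalerDr addrACA.
- move=> a _ [x [y [Px Qy ->]]]; exists (a *> x), (a *> y).
  by rewrite gm_actDr; split; [exact: Pa|exact: Qa|].
move=> d _ [x [y [Px Qy ->]]].
by eexists; eexists; split; [apply: (Ph d _ Px)|apply: (Qh d _ Qy)|rewrite linearD].
Qed.

Lemma gsub_axiom_cyclic V d (x : V) : x \in gm_gr V d ->
  gsub_axiom (fun y => exists a, y = a *> x).
Proof.
move=> xd; split.
- split; first by exists 0; rewrite gm_act0l.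
  move=> a _ _ [b ->] [c ->]; exists (a *: b + c).
  by rewrite gm_actDl gm_actZl.
- by move=> a _ [b ->]; exists (a ** b); rewrite gm_actA.
move=> e _ [b ->]; exists (hproj (ga_gr A) (e - d) b).
rewrite (hproj_comm (f := gm_act V ^~ x) (d := d) (H := gm_gr V)) ?addrNK//.
  exact: gm_actPl.
by move=> m u um; apply: gm_act_hom.
Qed.

Lemma mem_cyclic V (x : V) : exists a, x = a *> x.
Proof.
have [s [_ xs]] := gm_unital_seq x; exists (\sum_(i <- s) 1_[A]_i).
by rewrite gm_sum_l.
Qed.

(** ** Homomorphisms *)

Section Homs.
Variables (V W : gmod A) (d : int) (f : V -> W) (hf : is_hom d f).

Lemma hom_lin : linear f. Proof. by case: hf. Qed.
Lemma hom_act a v : f (a *> v) = a *> f v. Proof. by case: hf. Qed.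
Lemma hom_deg n v : v \in gm_gr V n -> f v \in gm_gr W (n + d).
Proof. by case: hf => _ _; apply. Qed.
Lemma hom_hproj n v : f (hproj (gm_gr V) n v) = hproj (gm_gr W) (n + d) (f v).
Proof. by apply: hproj_comm; [exact: hom_lin|exact: hom_deg]. Qed.

Lemma gsub_axiom_preim (Q : W -> Prop) :
  gsub_axiom Q -> gsub_axiom (fun v => Q (f v)).
Proof.
move=> [[Q0 QD] Qa Qh]; split=> [|a v Qv|n v Qv]; last 2 first.
- by rewrite hom_act; apply: Qa.
- by rewrite hom_hproj; apply: Qh.
split; first by rewrite (lin0 hom_lin).
by move=> a u v Qu Qv; rewrite hom_lin; apply: QD.
Qed.

Lemma gsub_axiom_im (Q : V -> Prop) :
  gsub_axiom Q -> gsub_axiom (fun w => exists2 v, Q v & w = f v).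
Proof.
move=> [[Q0 QD] Qa Qh]; split.
- split; first by exists 0; rewrite ?(lin0 hom_lin).
  move=> a _ _ [u Qu ->] [v Qv ->]; exists (a *: u + v); first exact: QD.
  by rewrite hom_lin.
- by move=> a _ [v Qv ->]; exists (a *> v); [exact: Qa|rewrite hom_act].
move=> n _ [v Qv ->]; exists (hproj (gm_gr V) (n - d) v); first exact: Qh.
by rewrite hom_hproj addrNK.
Qed.
End Homs.

Lemma is_hom_id V : is_hom 0 (@id V).
Proof. by split=> // n v; rewrite addr0. Qed.

Lemma is_hom_comp V W X d e f g : @is_hom _ _ _ V W d f -> @is_hom _ _ _ W X e g ->
  is_hom (d + e) (g \o f).
Proof.
move=> hf hg; split=> [a u v|a v|n v vn] /=.
- by rewrite (hom_lin hf) (hom_lin hg).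
- by rewrite (hom_act hf) (hom_act hg).
by rewrite addrA; apply/(hom_deg hg)/(hom_deg hf).
Qed.

Lemma is_hom_shift V W d c (f : V -> W) :
  is_hom d f <-> is_hom (V := V) (W := gshift c W) (d + c) f.
Proof. by split=> -[l a h]; split=> // n v /h /=; rewrite addrA addrK. Qed.

Lemma is_hom_shift_l V W d c (f : V -> W) :
  is_hom d f <-> is_hom (V := gshift c V) (W := W) (d - c) f.
Proof.
split=> -[l a h]; split=> // n v vn.
  by have := h _ _ vn; rewrite addrAC -addrA.
by have := h (n + c) v; rewrite /= addrK [d - c]addrC addrA addrK; apply.
Qed.

Lemma gmod_iso_bij V W (f : V -> W) : is_hom 0 f -> (forall v, f v = 0 -> v = 0) ->
  surj f -> gmod_iso V W.
Proof.
move=> hf inj sf; have lf := hom_lin hf.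
have inj' u v : f u = f v -> u = v.
  move=> e; apply/eqP; rewrite -subr_eq0; apply/eqP/inj.
  by rewrite (linB lf) e subrr.
pose g w := projT1 (cid (sf w)); have fg w : f (g w) = w by rewrite /g; case: cid.
exists f, g; split=> // [|v]; last by apply: inj'; rewrite fg.
split=> [a u v|a v|n v vn]; try by apply: inj'; rewrite ?lf ?(hom_act hf) !fg.
have -> : g v = hproj (gm_gr V) n (g v); last by rewrite addr0 hproj_mem.
by apply: inj'; rewrite (hom_hproj hf) !fg addr0 hproj_id.
Qed.

Lemma gmod_iso_hom V W : gmod_iso V W -> exists f : V -> W,
  [/\ is_hom 0 f, forall v, f v = 0 -> v = 0 & surj f].
Proof.
move=> [f [g [hf hg fK gK]]]; exists f; split=> [//|v|w]; last by exists (g w).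
by move=> e; rewrite -[v]fK e (lin0 (hom_lin hg)).
Qed.

Lemma gmod_iso_sym V W : gmod_iso V W -> gmod_iso W V.
Proof. by move=> [f [g []]]; exists g, f. Qed.

Lemma factor_lin (U X Y : lmodType k) (f : U -> X) (g : U -> Y) :
  linear f -> linear g -> (forall x, exists u, f u = x) ->
  (forall u, f u = 0 -> g u = 0) ->
  exists h : X -> Y, linear h /\ forall u, h (f u) = g u.
Proof.
move=> lf lg sf fg; pose s x := projT1 (cid (sf x)).
have sK x : f (s x) = x by rewrite /s; case: cid.
have hE u v : f u = f v -> g u = g v.
  move=> e; apply/eqP; rewrite -subr_eq0 -(linB lg); apply/eqP/fg.
  by rewrite (linB lf) e subrr.
exists (g \o s); split=> [a x y|u] /=; last by apply: hE; rewrite sK.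
by rewrite -lg; apply: hE; rewrite lf !sK.
Qed.

Lemma factor_hom V X Y (f : V -> X) (g : V -> Y) : is_hom 0 f -> is_hom 0 g ->
  surj f -> (forall v, f v = 0 -> g v = 0) ->
  exists h : X -> Y, is_hom 0 h /\ forall v, h (f v) = g v.
Proof.
move=> hf hg sf fg.
have [h [lh hE]] := factor_lin (hom_lin hf) (hom_lin hg) sf fg.
exists h; split=> //; split=> // [a x|n x xn].
  by have [v <-] := sf x; rewrite -(hom_act hf) !hE (hom_act hg).
have [v vx] := sf x; rewrite -vx in xn *.
have -> : f v = f (hproj (gm_gr V) n v) by rewrite (hom_hproj hf) addr0 hproj_id.
by rewrite hE (hom_deg hg)// hproj_mem.
Qed.

Lemma gmod_iso_ker V X Y (f : V -> X) (g : V -> Y) : is_hom 0 f -> is_hom 0 g ->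
  surj f -> surj g -> (forall v, f v = 0 <-> g v = 0) -> gmod_iso X Y.
Proof.
move=> hf hg sf sg fg; have [v /fg//|h [hh hE]] := factor_hom hf hg sf.
apply: (gmod_iso_bij hh) => [x|y].
  by have [v <-] := sf x; rewrite hE => /fg.
by have [v <-] := sg y; exists (f v); rewrite hE.
Qed.

(** This compares X and Y when neither has an evident map to the other. *)
Lemma gmod_iso_im X Y V (f : X -> V) (g : Y -> V) : is_hom 0 f -> is_hom 0 g ->
  (forall x, f x = 0 -> x = 0) -> (forall y, g y = 0 -> y = 0) ->
  (forall x, exists y, f x = g y) -> (forall y, exists x, f x = g y) -> gmod_iso X Y.
Proof.
move=> hf hg fi gi fg gf.
have gi' y y' : g y = g y' -> y = y'.
  move=> e; apply/eqP; rewrite -subr_eq0; apply/eqP/gi.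
  by rewrite (linB (hom_lin hg)) e subrr.
pose h x := projT1 (cid (fg x)); have hE x : f x = g (h x) by rewrite /h; case: cid.
apply: (@gmod_iso_bij _ _ h) => [|x hx|y]; last 2 first.
- by apply: fi; rewrite hE hx (lin0 (hom_lin hg)).
- by have [x e] := gf y; exists x; apply: gi'; rewrite -hE.
split=> [a u v|a v|n v vn].
- by apply: gi'; rewrite (hom_lin hg) -!hE (hom_lin hf).
- by apply: gi'; rewrite (hom_act hg) -!hE (hom_act hf).
have -> : h v = hproj (gm_gr Y) n (h v); last by rewrite addr0 hproj_mem.
by apply: gi'; rewrite (hom_hproj hg) -!hE addr0 hproj_id// -[n]addr0 (hom_deg hf).
Qed.

Section Quotients.
Variables (V : gmod A) (U : gsub V).
Lemma gquot_act a v : a *> (qpi U v : gquot U) = qpi U (a *> v).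
Proof. exact: quot_actE. Qed.
Lemma gquot_hom : is_hom 0 (qpi U : V -> gquot U).
Proof.
split=> [||n v vn]; first exact: qpi_linear.
  by move=> a v; rewrite gquot_act.
by rewrite addr0; apply: quot_hcomp_pi.
Qed.
Lemma gsubmod_hom : is_hom 0 (@subm_val _ _ U : gsubmod U -> V).
Proof. by split=> // n v; rewrite addr0 /= subm_hcompP. Qed.
Lemma qpi_surj : surj (qpi U : V -> gquot U).
Proof. by move=> x; exists (qrepr x); rewrite qreprK. Qed.
End Quotients.

Definition sec_pi V (U W : gsub V) (w : gsubmod W) : gsection U W :=
  qpi (GSub (@relsub_act _ _ _ _ U W) (@relsub_gr _ _ _ _ U W)) w.

Section Sections.
Variables (V : gmod A) (U W : gsub V).
Lemma sec_pi_hom : is_hom 0 (@sec_pi V U W). Proof. exact: gquot_hom. Qed.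
Lemma sec_pi_surj : surj (@sec_pi V U W). Proof. exact: qpi_surj. Qed.
Lemma sec_pi_eq0 (w : gsubmod W) : sec_pi U w = 0 <-> subm_val w \in U.
Proof. by split=> [/qpi0 /subspaceP|h]//; apply/qpi0/subspaceP. Qed.
End Sections.

End Modules.

(** * Projective covers and multiplicities *)

Section Irreducible.
Variables (k : closedFieldType) (I : choiceType) (A : galg k I) (L : gmod A).
Hypotheses (irrL : irreducible L).

(** Schur's lemma: an eigenvector in some nonzero 1_i L_d, which is of finite
    dimension over an algebraically closed field, generates L. *)
Lemma schur_endo (c : L -> L) : loc_fin_dim L -> is_hom 0 c ->
  exists a, forall v, c v = a *: v.
Proof.
move=> lfd hc; have lc := hom_lin hc.
have [i [d [v [vd iv v0]]]] := irr_vec irrL.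
have [n [b [bP bI bS]]] := lfd i d.
have cb j : exists e : 'I_n -> k, c (b j) = \sum_l e l *: b l.
  apply: bS; have [bd ib] := bP j; split; first by rewrite -[d]addr0 (hom_deg hc).
  by rewrite -(hom_act hc) ib.
pose M := \matrix_(j, l) projT1 (cid (cb j)) l.
have cM j : c (b j) = \sum_l M j l *: b l.
  by rewrite [LHS](projT2 (cid (cb j))); apply: eq_bigr => l _; rewrite mxE.
have n0 : n != 0%N.
  apply/eqP => n0; case: v0; have [//|e ->] := bS v.
  by rewrite big1// => j _; have := ltn_ord j; rewrite [X in (_ < X)%N]n0.
have [|a] := closed_rootP (char_poly M) _; first by rewrite size_char_poly eqSS.
rewrite -eigenvalue_root_char => /eigenvalueP[r rM r0].
pose u := \sum_j r 0 j *: b j.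
have cu : c u = a *: u.
  rewrite (lin_sum lc) scaler_sumr; under eq_bigr do rewrite (linZ lc) cM scaler_sumr.
  rewrite exchange_big /=; apply: eq_bigr => l _.
  under eq_bigr do rewrite scalerA.
  by rewrite -scaler_suml scalerA; have /rowP/(_ l) := rM; rewrite !mxE => ->.
have u0 : u <> 0.
  by move=> u0; case/eqP: r0; apply/rowP => j; rewrite [RHS]mxE; apply: (bI (fun j => r 0 j)).
exists a => w; apply/eqP; rewrite -subr_eq0; apply/eqP; move: w.
apply: (@irr_gsub _ _ _ _ (fun w => c w - a *: w = 0) u) => //; last by rewrite cu subrr.
split=> [|x w e|m w e].
- split=> [|x y z ey ez]; first by rewrite (lin0 lc) scaler0 subrr.
  rewrite lc scalerDr opprD addrACA ez addr0 scalerA mulrC -scalerA -scalerBr ey.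
  exact: scaler0.
- by rewrite (hom_act hc) -gm_actZr -gm_actBr e gm_act0r.
by rewrite (hom_hproj hc) addr0 -linearZ_LR -linearB e linear0.
Qed.

End Irreducible.

Section Cover.
Variables (k : closedFieldType) (I : choiceType) (A : galg k I) (P L : gmod A).
Hypotheses (projP : projective P) (irrL : irreducible L).
Variables (p : P -> L) (hp : is_hom 0 p) (sp : surj p).
Hypothesis p_cover :
  forall U : gsub P, (forall x, exists2 u, u \in U & p (x - u) = 0) ->
    forall x, x \in U.

Lemma cover_neq0 : exists x, p x <> 0.
Proof. by have [[v v0] _] := irrL; have [x px] := sp v; exists x; rewrite px. Qed.

(** If Q is not contained in ker p then p(Q) = L, so Q + ker p = P, and Q = P
    because ker p is superfluous. *)
Lemma cover_max (Q : P -> Prop) x : gsub_axiom Q -> Q x -> p x <> 0 -> forall y, Q y.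
Proof.
move=> hQ Qx px y; apply/(mkgsubP hQ)/p_cover => z.
have [q Qq pq] := irr_gsub irrL (gsub_axiom_im hp hQ)
  (ex_intro2 _ _ x Qx erefl) px (p z).
by exists q; [apply/(mkgsubP hQ)|rewrite (linB (hom_lin hp)) pq subrr].
Qed.

Lemma cover_gen x d : x \in gm_gr P d -> p x <> 0 -> forall y, exists a, y = a *> x.
Proof.
by move=> /gsub_axiom_cyclic xd; apply: cover_max xd (mem_cyclic x).
Qed.

(** Shifting X and Y reduces this to the case d = 0. *)
Lemma lift_hom (X Y : gmod A) d (g : X -> Y) (f : P -> Y) : @is_hom _ _ A X Y 0 g -> surj g ->
  is_hom d f -> exists h : P -> X, is_hom d h /\ forall x, g (h x) = f x.
Proof.
move=> hg sg /(is_hom_shift _ (- d)) /=; rewrite subrr => hf.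
have hg' : is_hom (V := gshift (- d) X) (W := gshift (- d) Y) 0 g.
  by split=> [||n v vn]; [apply: hom_lin hg|apply: hom_act hg|move: vn => /(hom_deg hg); rewrite /= !addr0].
have [h [hh gh]] := projP hg' sg hf.
by exists h; split=> //; apply/(is_hom_shift _ (- d)); rewrite subrr.
Qed.

Hypothesis L_lfd : loc_fin_dim L.

(** A nonzero f has the same kernel as p, so p = c f for some endomorphism c
    of L. *)
Lemma schur_cover (f : P -> L) : is_hom 0 f -> exists a, forall x, f x = a *: p x.
Proof.
move=> hf; have [f0|/existsNP[y fy]] := pselect (forall x, f x = 0).
  by exists 0 => x; rewrite f0 scale0r.
have fp x : f x = 0 -> p x = 0.
  move=> fx; apply: contrapT => px; apply: fy.
  apply: (cover_max (Q := fun y => f y = 0) _ fx px).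
  exact: (gsub_axiom_preim hf (gsub_axiom0 L)).
have sf : surj f.
  move=> w; have [x _ ->] := irr_gsub irrL (gsub_axiom_im hf (gsub_axiomT P))
    (ex_intro2 _ _ y Logic.I erefl) fy w.
  by exists x.
have [c [hc cE]] := factor_hom hf hp sf fp.
have [a ca] := schur_endo irrL L_lfd hc.
have a0 : a != 0.
  apply/eqP => a0; have [x px] := cover_neq0; apply: px.
  by rewrite -cE ca a0 scale0r.
by exists a^-1 => x; rewrite -cE ca scalerA mulVf// scale1r.
Qed.

Lemma corestrict (X N : gmod A) d (U : gsub N) (g : X -> N) : @is_hom _ _ A X N d g ->
  (forall x, g x \in U) -> exists h : X -> gsubmod U,
    is_hom d h /\ forall x, subm_val (h x) = g x.
Proof.
move=> hg gU; exists (fun x => Subm (gU x)); split=> //; split=> [a u v|a v|n v vn].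
- by apply: val_inj; rewrite /= (hom_lin hg).
- by apply: val_inj; rewrite /= (hom_act hg).
by rewrite /= subm_hcompP (hom_deg hg).
Qed.

(** ** Multiplicities as dimensions of spaces of homomorphisms *)

Section Count.
Variables (N : gmod A) (d : int).
Hypothesis N_fd : fin_dim (fun g : P -> N => is_hom d g).

Definition hom_in (U : gsub N) (g : P -> N) : Prop :=
  is_hom d g /\ forall x, g x \in U.

Lemma hom_in_axiom U : subspace_axiom (hom_in U).
Proof.
have [h0 hD] := is_hom_axiom P N d.
split; first by split=> // x; apply: rpred0.
move=> a f g [hf fU] [hg gU]; split=> [|x]; first exact: hD.
by rewrite -[_ x]/(a *: f x + g x) rpredD// rpredZ.
Qed.

Lemma hom_in_dim U : fin_dim (hom_in U).
Proof. by apply: fin_dim_sub (hom_in_axiom U) N_fd => g []. Qed.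
Definition dim_in U : nat := projT1 (cid (hom_in_dim U)).
Lemma dim_inP U : has_dim (hom_in U) (dim_in U).
Proof. by rewrite /dim_in; case: cid. Qed.

Lemma dim_in_le (U W : gsub N) : (forall v, v \in U -> v \in W) ->
  (dim_in U <= dim_in W)%N.
Proof.
move=> UW; apply: dim_le (dim_inP U) (dim_inP W) => g [hg gU].
by split=> // x; apply: UW.
Qed.

Definition is_sec (U W : gsub N) : bool := `[< gmod_iso (gsection U W) (gshift d L) >].

(** The projection P -> L = W / U lifts to P -> W, and the lift does not land
    in U. *)
Lemma dim_in_sec (U W : gsub N) : (forall v, v \in U -> v \in W) -> is_sec U W ->
  (dim_in U < dim_in W)%N.
Proof.
move=> UW /asboolP/gmod_iso_sym/gmod_iso_hom[f [hf inj_f sf]].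
have hp' : is_hom (W := gshift d L) d p.
  by have /(is_hom_shift _ d) := hp; rewrite add0r.
have hfp := is_hom_comp hp' hf; rewrite addr0 in hfp.
have [h [hh secE]] := lift_hom (sec_pi_hom U W) (@sec_pi_surj _ _ _ _ U W) hfp.
have hg := is_hom_comp hh (gsubmod_hom W); rewrite addr0 in hg.
apply: (dim_lt (v := (@subm_val _ _ W : gsubmod W -> N) \o h)) (dim_inP U) (dim_inP W).
- by move=> g [? gU]; split=> // x; apply: UW.
- exact: hom_in_axiom.
- by split=> // x; apply: submP.
move=> [_ gU]; have [x px] := cover_neq0; apply/px/inj_f.
by have /sec_pi_eq0 := gU x; rewrite secE.
Qed.

Lemma nb_sectionsE n (F : nat -> gsub N) :
  nb_sections L d n F = (\sum_(0 <= r < n) is_sec (F r) (F r.+1))%N.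
Proof.
rewrite /nb_sections -sum1_card big_mkcond big_mkord.
by apply: eq_bigr => r _; rewrite inE /is_sec; case: `[< _ >].
Qed.

Lemma count_le n (F : nat -> gsub N) h : is_filtration n F ->
  has_dim (fun g : P -> N => is_hom d g) h -> (nb_sections L d n F <= h)%N.
Proof.
move=> [_ _ Fle] hN; rewrite nb_sectionsE.
have : (dim_in (F n) <= h)%N by apply: dim_le (dim_inP _) hN => g [].
apply: leq_trans.
elim: n Fle {hN} => [|n IH] Fle; first by rewrite big_nil.
have {}IH := IH (fun r rn => Fle r (leqW rn)).
rewrite big_nat_recr//=; have Fn := Fle n (ltnSn n).
case: (boolP (is_sec _ _)) => [/(dim_in_sec Fn)|_].
  by rewrite addn1; apply: leq_ltn_trans.
by rewrite addn0; apply: leq_trans IH (dim_in_le Fn).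
Qed.

(** The ends are equal to U and W, and do not just have the same elements, so
    that chains can be concatenated without transporting their sections. *)
Definition chain (U W : gsub N) (m : nat) : Prop := exists n (F : nat -> gsub N),
  [/\ F 0%N = U, F n = W, forall r, (r < n)%N -> forall v, v \in F r -> v \in F r.+1 &
      (m <= \sum_(0 <= r < n) is_sec (F r) (F r.+1))%N].

Lemma chain_step (U W : gsub N) : (forall v, v \in U -> v \in W) -> chain U W (is_sec U W : nat).
Proof.
move=> UW; exists 1%N, (fun r => if r is 0%N then U else W).
by rewrite big_nat1; split=> // -[].
Qed.

Lemma chain_cat U W X m m' : chain U W m -> chain W X m' -> chain U X (m + m').
Proof.
move=> [n [F [F0 Fn Fle Fm]]] [n' [F' [F'0 F'n F'le F'm]]].
pose G r := if (r <= n)%N then F r else F' (r - n)%N.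
have GF r : (r <= n)%N -> G r = F r by rewrite /G => ->.
have GF' r : G (r + n)%N = F' r.
  rewrite /G addnK; case: ifP => //; rewrite -{2}[n]add0n leq_add2r leqn0 => /eqP->.
  by rewrite Fn F'0.
exists (n' + n)%N, G; split=> [||r rn|].
- by rewrite GF.
- by rewrite GF'.
- have [rn'|nr] := ltnP r n; first by rewrite !GF//; [apply: Fle|apply: ltnW].
  rewrite -(subnK nr) -addSn !GF'; apply: F'le.
  by rewrite -(ltn_add2r n) subnK.
rewrite (big_cat_nat (n := n)) ?leq_addl//=; apply: leq_add.
  rewrite (eq_big_nat _ _ (F2 := fun r => is_sec (F r) (F r.+1) : nat))// => r /andP[_ rn].
  by rewrite !GF// ltnW.
rewrite -{1}[n]add0n big_addn addnK.
by under eq_bigr do rewrite -addSn !GF'.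
Qed.

(** Take W' = U + g(P) and W'' = U + g(ker p).  The elements that g maps to U
    form a proper submodule, contained in ker p, so g induces an isomorphism of
    P / ker p with W' / W''.  The bound on dimensions is Schur's lemma. *)
Lemma chain_refine (U W : gsub N) (g : P -> N) : (forall v, v \in U -> v \in W) ->
  hom_in W g -> ~ hom_in U g -> exists W'' W' : gsub N,
  [/\ forall v, v \in U -> v \in W'', forall v, v \in W'' -> v \in W',
      forall v, v \in W' -> v \in W, is_sec W'' W' &
      (dim_in W' <= (dim_in W'').+1)%N].
Proof.
move=> UW [hg gW] gU; have lg := hom_lin hg.
have kerQ : gsub_axiom (fun x => p x = 0).
  exact: (gsub_axiom_preim hp (gsub_axiom0 L)).
have hW'' := gsub_axiomD (gsubP U) (gsub_axiom_im hg kerQ).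
have hW' := gsub_axiomD (gsubP U) (gsub_axiom_im hg (gsub_axiomT P)).
pose W'' := mkgsub hW''; pose W' := mkgsub hW'.
have gW' x : g x \in W'.
  by apply/(mkgsubP hW'); exists 0, (g x); rewrite add0r rpred0; split=> //; exists x.
have gUp x : g x \in U -> p x = 0.
  move=> gx; apply: contrapT => px; apply: gU; split=> // y.
  apply: (cover_max (Q := fun y => g y \in U) _ gx px).
  exact: (gsub_axiom_preim hg (gsubP U)).
have gW'' x : g x \in W'' <-> p x = 0.
  split=> [/(mkgsubP hW'')[u [_ [uU [z pz ->] e]]]|px].
    have : p (x - z) = 0 by apply: gUp; rewrite (linB lg) e addrK.
    by rewrite (linB (hom_lin hp)) pz subr0.
  apply/(mkgsubP hW''); exists 0, (g x); rewrite rpred0 add0r.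
  by split=> //; exists x.
have W''W' v : v \in W'' -> v \in W'.
  move=> /(mkgsubP hW'')[u [w [uU [z pz ->] ->]]]; apply/(mkgsubP hW').
  by exists u, (g z); split=> //; exists z.
have ls := hom_lin (sec_pi_hom W'' W').
have [gam [hgam gamE]] := corestrict hg gW'.
have hsg := is_hom_comp hgam (sec_pi_hom W'' W'); rewrite addr0 in hsg.
have iso : gmod_iso (gsection W'' W') (gshift d L).
  apply: (@gmod_iso_ker _ _ _ (gshift d P) (gsection W'' W') (gshift d L)
    (fun x => sec_pi W'' (gam x)) p).
  - by have /(is_hom_shift_l _ d) := hsg; rewrite subrr.
  - have /(is_hom_shift_l _ d) /(is_hom_shift _ d) := hp.
    by rewrite add0r addNr.
  - move=> X; have [w <-] := sec_pi_surj X.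
    have /(mkgsubP hW')[u [_ [uU [x _ ->] e]]] := submP w.
    exists x; suff : sec_pi W'' (gam x - w) = 0.
      by rewrite (linB ls) => /eqP; rewrite subr_eq0 => /eqP.
    apply/sec_pi_eq0; rewrite /= gamE e opprD addrCA subrr addr0.
    apply/(mkgsubP hW''); exists (- u), 0; rewrite addr0; split=> //.
      by rewrite -scaleN1r rpredZ.
    by exists 0; rewrite ?(lin0 lg)// (lin0 (hom_lin hp)).
  - exact: sp.
  by move=> x; apply: iff_trans (sec_pi_eq0 W'' (gam x)) _; rewrite gamE.
exists W'', W'; split=> //.
- move=> v vU; apply/(mkgsubP hW''); exists v, 0; rewrite addr0; split=> //.
  by exists 0; rewrite ?(lin0 lg)// (lin0 (hom_lin hp)).
- move=> v /(mkgsubP hW')[u [_ [uU [x _ ->] ->]]].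
  by apply: rpredD (UW _ uU) (gW x).
- exact/asboolP.
apply: (dim_le_add1 (w := g) (dim_inP W'') (dim_inP W')) => g' [hg' g'W'].
have [f [hf inj_f _]] := gmod_iso_hom iso.
have [gam' [hgam' gamE']] := corestrict hg' g'W'.
have hsg' := is_hom_comp hgam' (sec_pi_hom W'' W'); rewrite addr0 in hsg'.
have sch h : is_hom d h -> exists a, forall x, f (h x) = a *: p x.
  move=> hh; apply: schur_cover; apply/(is_hom_shift _ d).
  by have := is_hom_comp hh hf; rewrite addr0 add0r.
have [b fb] := sch _ hsg; have [b' fb'] := sch _ hsg'.
have b0 : b != 0.
  apply/eqP => b0; have [x px] := cover_neq0; apply/px/gW''.
  by rewrite -gamE; apply/sec_pi_eq0/inj_f; rewrite fb b0 scale0r.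
exists (b' / b); split=> [|x].
  have [_ hD] := is_hom_axiom P N d.
  by rewrite addrC -scaleNr; apply: hD.
rewrite -[_ x]/(g' x - (b' / b) *: g x) -gamE -gamE'.
apply/(sec_pi_eq0 W'' (gam' x - (b' / b) *: gam x))/inj_f.
rewrite (linB ls) (linZ ls) (linB (hom_lin hf)) (linZ (hom_lin hf)) fb fb'.
by rewrite scalerA divfK// subrr.
Qed.

(** As long as some homomorphism to W does not land in U, there is a section
    W' / W'' that accounts for one dimension; recursion on W'' / U and W / W'
    provides the others. *)
Lemma chain_exists (U W : gsub N) : (forall v, v \in U -> v \in W) ->
  chain U W (dim_in W - dim_in U)%N.
Proof.
have [m] := ubnP (dim_in W - dim_in U)%N; elim: m U W => // m IH U W mUW UW.
have [WU|/existsNP[g]] := pselect (forall g, hom_in W g -> hom_in U g).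
  have := chain_step UW; rewrite (_ : (_ - _)%N = 0%N).
    by move=> [n [F [? ? ? _]]]; exists n, F.
  by apply/eqP; rewrite subn_eq0; apply: dim_le WU (dim_inP _) (dim_inP _).
move=> /not_implyP[gW gU].
have [W'' [W' [UW'' W''W' W'W sec dW']]] := chain_refine UW gW gU.
have dlt := dim_in_sec W''W' sec.
have l1 := dim_in_le UW''; have l2 := dim_in_le W'W.
have -> : (dim_in W - dim_in U = (dim_in W'' - dim_in U) + 1 + (dim_in W - dim_in W'))%N.
  by lia.
apply: chain_cat; first apply: chain_cat.
- by apply: IH => //; lia.
- by rewrite -[1%N]/(nat_of_bool true) -sec; apply: chain_step.
by apply: IH => //; lia.
Qed.

Lemma count_attained h : has_dim (fun g : P -> N => is_hom d g) h ->
  exists n (F : nat -> gsub N), is_filtration n F /\ nb_sections L d n F = h.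
Proof.
move=> hN; pose Z := mkgsub (gsub_axiom0 N); pose T := mkgsub (gsub_axiomT N).
have [|n [F [F0 Fn Fle Fm]]] := @chain_exists Z T.
  by move=> v _; apply/(mkgsubP (gsub_axiomT N)).
have hF : is_filtration n F.
  split=> // [v|v]; first by rewrite F0 => /(mkgsubP (gsub_axiom0 N)).
  by rewrite Fn; apply/(mkgsubP (gsub_axiomT N)).
exists n, F; split=> //; apply/eqP; rewrite eqn_leq count_le//= nb_sectionsE.
apply: leq_trans Fm.
have dT : (h <= dim_in T)%N.
  apply: dim_le hN (dim_inP T) => g hg; split=> // x.
  exact/(mkgsubP (gsub_axiomT N)).
suff -> : dim_in Z = 0%N by rewrite subn0.
have [b [bP bI _]] := dim_inP Z; apply/eqP; rewrite -leqn0 leqNgt; apply/negP => Z0.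
have b0 : b (Ordinal Z0) = 0.
  by apply/funext => x; have [_ /(_ x) /(mkgsubP (gsub_axiom0 N))] := bP (Ordinal Z0).
suff h0 : (1 : k) = 0 by have := oner_neq0 k; rewrite h0 eqxx.
have := bI (fun i => (i == Ordinal Z0)%:R) _ (Ordinal Z0); rewrite eqxx; apply.
rewrite (bigD1 (Ordinal Z0))//= b0 scaler0 big1 ?addr0// => i /negPf->.
exact: scale0r.
Qed.

End Count.

Lemma irr_mult_hom (N : gmod A) (f : series) : hom_qdim P N f -> irr_mult N L f.
Proof.
move=> hf d; have fd : fin_dim (fun g : P -> N => is_hom d g) by exists (f d).
by split; [apply: count_attained|move=> n F hF; apply: count_le (hf d)].
Qed.

End Cover.

(** * Cyclic modules and finiteness *)

Section Cyclic.
Variables (k : fieldType) (I : choiceType) (A : galg k I).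

Lemma hom_le_l i d (a : A) : a \in ga_gr A d -> 1_[A]_i ** a \in ga_gr A d.
Proof. by move=> ad; rewrite -[d]add0r ga_mul_hom ?ga_idem_hom. Qed.
Lemma hom_le_r i d (a : A) : a \in ga_gr A d -> a ** 1_[A]_i \in ga_gr A d.
Proof. by move=> ad; rewrite -[d]addr0 ga_mul_hom ?ga_idem_hom. Qed.

Lemma idem_axiom i j d : subspace_axiom
  (fun x : A => x \in ga_gr A d /\ 1_[A]_i ** x ** 1_[A]_j = x).
Proof.
split; first by rewrite rpred0 ga_mul0r ga_mul0l.
move=> a u v [ud iu] [vd iv]; rewrite rpredD ?rpredZ//.
by rewrite ga_mulDr ga_mulDl ga_mulZr ga_mulZl iu iv.
Qed.

Lemma idem_mod_axiom (V : gmod A) i d : subspace_axiom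
  (fun x : V => x \in gm_gr V d /\ 1_[A]_i *> x = x).
Proof.
split; first by rewrite rpred0 gm_act0r.
move=> a u v [ud iu] [vd iv]; rewrite rpredD ?rpredZ//.
by rewrite gm_actDr gm_actZr iu iv.
Qed.

Section Gen.
Variables (V : gmod A) (i : I) (n : int) (x : V).
Hypotheses (xn : x \in gm_gr V n) (ix : 1_[A]_i *> x = x).
Hypothesis xgen : forall y, exists a, y = a *> x.

(** Project an arbitrary a with y = a x to 1_j A 1_i and to degree d - n. *)
Lemma cyclic_rep j d y : y \in gm_gr V d -> 1_[A]_j *> y = y ->
  exists a, [/\ a \in ga_gr A (d - n), 1_[A]_j ** a ** 1_[A]_i = a & y = a *> x].
Proof.
move=> yd jy; have [b yb] := xgen y.
exists (hproj (ga_gr A) (d - n) (1_[A]_j ** b ** 1_[A]_i)); split.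
- exact: hproj_mem.
- have lf : linear (fun b : A => 1_[A]_j ** b ** 1_[A]_i).
    by move=> a u v; rewrite ga_mulDr ga_mulDl ga_mulZr ga_mulZl.
  have hf m u : u \in ga_gr A m -> 1_[A]_j ** u ** 1_[A]_i \in ga_gr A (m + 0).
    by move=> um; rewrite addr0; apply/hom_le_r/hom_le_l.
  rewrite (hproj_comm _ _ lf hf) addr0 -!ga_mulA ga_idem_idem.
  by rewrite [1_[A]_j ** (1_[A]_j ** _)]ga_mulA ga_idem_idem.
have lf : linear (fun b : A => b *> x) by exact: gm_actPl.
have hf m u : u \in ga_gr A m -> u *> x \in gm_gr V (m + n).
  by move=> um; apply: gm_act_hom.
rewrite (hproj_comm _ _ lf hf) addrNK -ga_mulA gm_actA gm_actA ix -yb jy.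
by rewrite hproj_id.
Qed.

Lemma cyclic_lfd : alg_loc_fin_dim A -> loc_fin_dim V.
Proof.
move=> Af j d; apply: fin_dim_gen; first exact: idem_mod_axiom.
apply: (fin_gen_image (gm_actPl x) (fin_gen_dim (Af j i (d - n)))).
by move=> y [yd jy]; have [a [ad ja ->]] := cyclic_rep yd jy; exists a.
Qed.

Lemma hom_fin_dim N d : loc_fin_dim N ->
  fin_dim (fun g : V -> N => is_hom d g).
Proof.
move=> Nf; apply: (fin_dim_inj (f := fun g : V -> N => g x) _ _
  (fin_gen_dim (Nf i (n + d)))); first exact: is_hom_axiom.
- by [].
- by move=> g hg; rewrite (hom_deg hg)// -(hom_act hg) ix.
move=> g hg gx; apply/funext => y; have [a ->] := xgen y.
by rewrite (hom_act hg) gx gm_act0r.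
Qed.
End Gen.

Lemma irr_gen (L : gmod A) d (v w : L) : irreducible L -> v \in gm_gr L d -> v <> 0 ->
  exists a, w = a *> v.
Proof.
by move=> irrL /gsub_axiom_cyclic hv v0; apply: irr_gsub irrL hv (mem_cyclic v) v0 w.
Qed.

(** P is a direct summand of the shift by n of the left ideal A 1_i: the map
    a |-> a x onto P has the section s. *)
Record presentation (P : gmod A) (i : I) (n : int) (x : P) (s : P -> A) : Prop := {
  pr_hom : x \in gm_gr P n;
  pr_idem : 1_[A]_i *> x = x;
  pr_lin : linear s;
  pr_act : forall a y, s (a *> y) = a ** s y;
  pr_deg : forall m y, y \in gm_gr P m -> s y \in ga_gr A (m - n);
  pr_r : forall y, s y ** 1_[A]_i = s y;
  pr_K : forall y, s y *> x = y }.

Lemma projective_presentation (P : gmod A) i n x : projective P ->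
  x \in gm_gr P n -> 1_[A]_i *> x = x -> (forall y, exists a, y = a *> x) ->
  exists s, presentation i n x s.
Proof.
move=> prP xn ix xgen.
pose e := Idem0 (ga_idem_hom A i) (ga_idem_idem A i).
pose g (a : gshift n (Ce_left e)) : P := subm_val a *> x.
have hg : is_hom 0 g.
  split=> [a u v|a u|m u]; rewrite /g.
  - by rewrite /= gm_actDl gm_actZl.
  - by rewrite /= gm_actA.
  rewrite /= subm_hcompP => um; rewrite addr0 -[m](addrNK n); exact: gm_act_hom.
have sg : surj g.
  move=> y; have [a ->] := xgen y.
  have ai : a ** 1_[A]_i \in Ce_sub e.
    by apply/subspaceP; rewrite -ga_mulA ga_idem_idem.
  by exists (Subm ai); rewrite /g /= gm_actA ix.
have [h [hh gh]] := prP _ _ g id hg sg (is_hom_id P).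
exists (fun y => subm_val (h y)); split=> // [a u v|a y|m y ym|y].
- by rewrite (hom_lin hh).
- by rewrite (hom_act hh).
- by have := hom_deg hh ym; rewrite /= subm_hcompP addr0.
by have /subspaceP := submP (h y).
Qed.

End Cyclic.

Section Unital.
Variables (k : fieldType) (A : galg k unit).

Lemma unit_act (V : gmod A) (v : V) : 1_[A]_tt *> v = v.
Proof.
apply: (lin_span_eq (f := gm_act V 1_[A]_tt) (g := idfun) _ _ _ (gm_unital v)) => //.
  exact: gm_actPr.
by move=> _ [[] [u ->]]; rewrite -gm_actA ga_idem_idem.
Qed.

(** Below and above by the same bound: if v and w generate an irreducible L
    then v = a w and w = b v, so the degrees of v and w differ by at most the
    lower bound of A. *)
Lemma irr_unital_supp (L : gmod A) : alg_bounded_below A -> irreducible L ->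
  exists r : seq int, forall d, d \notin r -> forall v, v \in gm_gr L d -> v = 0.
Proof.
move=> bb irrL; have [[] [n [v [vn _ v0]]]] := irr_vec irrL.
have [N hN] := bb tt tt.
have gap m d (u w : L) : u \in gm_gr L m -> u <> 0 -> w \in gm_gr L d -> w <> 0 ->
    N <= d - m.
  move=> um u0 wd w0; rewrite leNgt; apply/negP => lt; apply: w0.
  have [a [ad ja ->]] := cyclic_rep um (unit_act u) (fun y => irr_gen y irrL um u0)
    wd (unit_act w).
  by rewrite (hN _ lt a ad ja) gm_act0l.
exists [seq n + N + (j%:Z) | j <- iota 0 (absz N + absz N).+1] => d dr w wd.
apply: contrapT => w0; case/negP: dr.
have h1 := gap _ _ _ _ vn v0 wd w0; have h2 := gap _ _ _ _ wd w0 vn v0.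
apply/mapP; exists (absz (d - n - N)%R : nat); last by lia.
by rewrite mem_iota; lia.
Qed.

Lemma irr_unital_fin_gen (L : gmod A) : alg_loc_fin_dim A -> alg_bounded_below A ->
  irreducible L -> fin_gen (fun _ : L => True).
Proof.
move=> lfd bb irrL; have [r hr] := irr_unital_supp bb irrL.
have [[] [n [v [vn iv v0]]]] := irr_vec irrL.
have Lf := cyclic_lfd vn iv (fun y => irr_gen y irrL vn v0) lfd.
have := fin_gen_sum (r := r) (P := fun d (w : L) => w \in gm_gr L d /\ 1_[A]_tt *> w = w)
  (fun d _ => fin_gen_dim (Lf tt d)).
apply: fin_gen_sub => w _; apply: (in_span_bind _ (hcomp_span (gm_gr L) w)).
move=> u [d ud]; have [dr|/hr hd] := boolP (d \in r); last by rewrite (hd u ud); left.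
by apply: in_span1; exists d => //; split; last exact: unit_act.
Qed.
End Unital.

(** * The triangular basis *)

Section Triangular.
Variables (k : fieldType) (I : choiceType) (A : galg k I).
Variables (disp : Order.disp_t) (Lam : porderType disp) (T : tri_basis A Lam).

Local Notation dot := (tb_dot T).
Local Notation S := (tb_S T).
Local Notation triple := (A * A * A)%type.
Local Notation prod3 := (fun p : triple => p.1.1 ** p.1.2 ** p.2).

(** Recording the four idempotents around the factors of a basis vector allows
    conditions on them to be stated directly; they are determined by p, see
    bt_uniq. *)
Record btrip (p : triple) (i s t j : I) : Prop := {
  bt_s : s \in S;
  bt_t : t \in S;
  bt_X : tb_X T i s p.1.1;
  bt_H : tb_H T s t p.1.2;
  bt_Y : tb_Y T t j p.2 }.

Lemma dot_H s t h : s \in S -> t \in S -> tb_H T s t h -> dot s = dot t.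
Proof.
move=> sS tS hh; have [->//|/eqP st] := eqVneq s t.
by have [_ + _] := tb_order sS tS st h; apply.
Qed.

Lemma dot_X s t x : s \in S -> t \in S -> tb_X T s t x -> s = t \/ (dot t < dot s)%O.
Proof.
move=> sS tS hx; have [->|/eqP st] := eqVneq s t; first by left.
by right; have [+ _ _] := tb_order sS tS st x; apply.
Qed.

Lemma dot_Y s t y : s \in S -> t \in S -> tb_Y T s t y -> s = t \/ (dot s < dot t)%O.
Proof.
move=> sS tS hy; have [->|/eqP st] := eqVneq s t; first by left.
by right; have [_ _ +] := tb_order sS tS st y; apply.
Qed.

Lemma X_diag s x : s \in S -> tb_X T s s x <-> x = 1_[A]_s.
Proof. by move=> sS; have [] := tb_unit sS x. Qed.
Lemma Y_diag s y : s \in S -> tb_Y T s s y <-> y = 1_[A]_s.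
Proof. by move=> sS; have [] := tb_unit sS y. Qed.

Lemma sandwich i j (x : A) : 1_[A]_i ** x ** 1_[A]_j = x ->
  1_[A]_i ** x = x /\ x ** 1_[A]_j = x.
Proof.
by move=> e; split; rewrite -{1}e; [rewrite !ga_mulA|rewrite -ga_mulA]; rewrite ga_idem_idem.
Qed.

Section BasicTriples.
Variables (p : triple) (i s t j : I) (hp : btrip p i s t j).

Lemma bt_dot : dot s = dot t.
Proof. by case: hp => sS tS _ hh _; apply: dot_H hh. Qed.

Lemma bt_x : 1_[A]_i ** p.1.1 = p.1.1 /\ p.1.1 ** 1_[A]_s = p.1.1.
Proof. by case: hp => sS _ hx _ _; apply: sandwich; have [] := tb_X_hom sS hx. Qed.
Lemma bt_h : 1_[A]_s ** p.1.2 = p.1.2 /\ p.1.2 ** 1_[A]_t = p.1.2.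
Proof. by case: hp => sS tS _ hh _; apply: sandwich; have [] := tb_H_hom sS tS hh. Qed.
Lemma bt_y : 1_[A]_t ** p.2 = p.2 /\ p.2 ** 1_[A]_j = p.2.
Proof. by case: hp => _ tS _ _ hy; apply: sandwich; have [] := tb_Y_hom tS hy. Qed.

Lemma bt_degs : exists d e f,
  [/\ p.1.1 \in ga_gr A d, p.1.2 \in ga_gr A e, p.2 \in ga_gr A f &
      prod3 p \in ga_gr A (d + e + f)].
Proof.
case: hp => sS tS hx hh hy.
have [_ [d xd]] := tb_X_hom sS hx; have [_ [e he]] := tb_H_hom sS tS hh.
have [_ [f yf]] := tb_Y_hom tS hy; exists d, e, f.
by split=> //; apply: ga_mul_hom => //; apply: ga_mul_hom.
Qed.

Lemma bt_basis : exists s t, [/\ s \in S, t \in S,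
  exists i, tb_X T i s p.1.1, tb_H T s t p.1.2 & exists j, tb_Y T t j p.2].
Proof. by case: hp => ? ? ? ? ?; exists s, t; split=> //; [exists i|exists j]. Qed.

Lemma bt_neq0 : prod3 p <> 0.
Proof. exact: (basis_neq0 (tb_basis T) bt_basis). Qed.

Lemma bt_prod_l : 1_[A]_i ** prod3 p = prod3 p.
Proof. by rewrite /= !ga_mulA; case: bt_x => ->. Qed.
Lemma bt_prod_r : prod3 p ** 1_[A]_j = prod3 p.
Proof. by rewrite /= -!ga_mulA; case: bt_y => _ ->. Qed.
End BasicTriples.

(** The factors of a basis vector are nonzero, and a nonzero vector is fixed by
    at most one of the orthogonal idempotents 1_i. *)
Lemma bt_uniq p i s t j i' s' t' j' : btrip p i s t j -> btrip p i' s' t' j' ->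
  [/\ i = i', s = s', t = t' & j = j'].
Proof.
move=> h h'; have nz := bt_neq0 h.
have idem_l a b (z : A) : z <> 0 -> 1_[A]_a ** z = z -> 1_[A]_b ** z = z -> a = b.
  move=> z0 az bz; apply: contrapT => /eqP/negPf ab; apply: z0.
  by rewrite -az -bz ga_mulA ga_idem_mul ab ga_mul0l.
have idem_r a b (z : A) : z <> 0 -> z ** 1_[A]_a = z -> z ** 1_[A]_b = z -> a = b.
  move=> z0 az bz; apply: contrapT => /eqP/negPf ab; apply: z0.
  by rewrite -bz -az -ga_mulA ga_idem_mul ab ga_mul0r.
have x0 : p.1.1 <> 0 by move=> e; apply: nz; rewrite /= e !ga_mul0l.
have y0 : p.2 <> 0 by move=> e; apply: nz; rewrite /= e ga_mul0r.
have [[xi xs] [xi' xs']] := (bt_x h, bt_x h').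
have [[yt yj] [yt' yj']] := (bt_y h, bt_y h').
by split; [apply: idem_l x0 xi xi'|apply: idem_r x0 xs xs'|
           apply: idem_l y0 yt yt'|apply: idem_r y0 yj yj'].
Qed.

(** ** Spans of sets of basis vectors *)

Implicit Types K L : triple -> I -> I -> I -> I -> Prop.

Definition bgen K (u : A) : Prop := exists p i s t j,
  [/\ btrip p i s t j, K p i s t j & u = prod3 p].
Definition bspan K : A -> Prop := in_span (bgen K).

Let sel K (p : triple) : Prop := exists i s t j, btrip p i s t j /\ K p i s t j.

Let bspanE K a : bspan K a <-> in_span (fun u => exists2 p : triple,
  (exists s t, [/\ s \in S, t \in S, exists i, tb_X T i s p.1.1,
     tb_H T s t p.1.2 & exists j, tb_Y T t j p.2]) /\ sel K p & u = prod3 p) a.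
Proof.
split; apply: in_span_mono => u.
  by move=> [p [i [s [t [j [hp Kp ->]]]]]]; exists p => //; split;
    [apply: bt_basis hp|exists i, s, t, j].
by move=> [p [_ [i [s [t [j [hp Kp]]]]]] ->]; exists p, i, s, t, j.
Qed.

Lemma bspan_mono K L a : (forall p i s t j, btrip p i s t j -> K p i s t j -> L p i s t j) ->
  bspan K a -> bspan L a.
Proof.
move=> KL; apply: in_span_mono => _ [p [i [s [t [j [hp Kp ->]]]]]].
by exists p, i, s, t, j; split=> //; apply: KL.
Qed.

Lemma bspan_gen K p i s t j : btrip p i s t j -> K p i s t j -> bspan K (prod3 p).
Proof. by move=> hp Kp; apply: in_span1; exists p, i, s, t, j. Qed.

Lemma bspan_cap K L a : bspan K a -> bspan L a ->
  bspan (fun p i s t j => K p i s t j /\ L p i s t j) a.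
Proof.
move=> /bspanE Ka /bspanE La; apply/bspanE.
apply: in_span_mono (basis_span_cap (tb_basis T) Ka La) => _ [p [Dp] + ->].
move=> [[i [s [t [j [hp Kp]]]]] [i' [s' [t' [j' [hp' Lp]]]]]].
have [? ? ? ?] := bt_uniq hp hp'; subst i' s' t' j'.
by exists p => //; split=> //; exists i, s, t, j.
Qed.

Let bspan_proj (f : A -> A) a : linear f ->
  (forall p i s t j, btrip p i s t j -> f (prod3 p) = prod3 p \/ f (prod3 p) = 0) ->
  f a = a -> bspan (fun p _ _ _ _ => f (prod3 p) = prod3 p) a.
Proof.
move=> lf hf fa; apply/bspanE.
have hf' p : (exists s t, [/\ s \in S, t \in S, exists i, tb_X T i s p.1.1,
     tb_H T s t p.1.2 & exists j, tb_Y T t j p.2]) ->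
    f (prod3 p) = prod3 p \/ f (prod3 p) = 0.
  by move=> [s [t [sS tS [i hx] hh [j hy]]]]; apply: (hf _ i s t j).
apply: in_span_mono (basis_span_proj (tb_basis T) lf hf' fa) => _ [p [Dp fp] ->]; exists p => //; split=> //.
by have [s [t [sS tS [i hx] hh [j hy]]]] := Dp; exists i, s, t, j.
Qed.

Lemma bspan_l u a : 1_[A]_u ** a = a -> bspan (fun p i s t j => i = u) a.
Proof.
move=> ua; have e i p s t j : btrip p i s t j ->
    1_[A]_u ** prod3 p = if u == i then prod3 p else 0.
  move=> hp; rewrite -{1}(bt_prod_l hp) ga_mulA ga_idem_mul.
  by case: eqP => [->|_]; rewrite ?ga_mul0l// (bt_prod_l hp).
apply: bspan_mono (bspan_proj (f := ga_mul 1_[A]_u) (ga_mulPr _) _ ua); last first.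
  by move=> p i s t j /e->; case: eqP; [left|right].
move=> p i s t j hp; rewrite (e _ _ _ _ _ hp); case: eqP => // _ /esym.
by move=> /(bt_neq0 hp).
Qed.

Lemma bspan_r u a : a ** 1_[A]_u = a -> bspan (fun p i s t j => j = u) a.
Proof.
move=> ua; have e i p s t j : btrip p i s t j ->
    prod3 p ** 1_[A]_u = if j == u then prod3 p else 0.
  move=> hp; rewrite -{1}(bt_prod_r hp) -ga_mulA ga_idem_mul.
  by case: eqP => [_|_]; rewrite ?ga_mul0r// (bt_prod_r hp).
have lf : linear (fun a : A => a ** 1_[A]_u) by exact: ga_mulPl.
apply: bspan_mono (bspan_proj lf _ ua); last first.
  by move=> p i s t j /e->; case: eqP; [left|right].
move=> p i s t j hp; rewrite (e _ _ _ _ _ hp); case: eqP => // _ /esym.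
by move=> /(bt_neq0 hp).
Qed.

Lemma bspan_hom d a : a \in ga_gr A d ->
  bspan (fun p i s t j => prod3 p \in ga_gr A d) a.
Proof.
move=> ad; have lf : linear (hproj (ga_gr A) d) by exact: linearP.
apply: bspan_mono (bspan_proj lf _ (hproj_id ad)); last first.
  move=> p i s t j /bt_degs[d1 [e [f [_ _ _ hp]]]].
  by rewrite (hproj_hom _ hp); case: eqP; [left|right].
by move=> p i s t j hp /= <-; apply: hproj_mem.
Qed.

Lemma bspan_hproj K d a : bspan K a -> bspan K (hproj (ga_gr A) d a).
Proof.
apply: (lin_span (f := hproj (ga_gr A) d)); first exact: linearP.
move=> _ [p [i [s [t [j [hp Kp ->]]]]]].
have [d1 [e [f [_ _ _ hd]]]] := bt_degs hp; rewrite (hproj_hom _ hd).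
by case: eqP => _; [apply: (bspan_gen hp)|left].
Qed.

Lemma bspan_lift (W : lmodType k) (g : triple -> W) K :
  exists F : A -> W, [/\ linear F,
    forall p i s t j, btrip p i s t j -> K p i s t j -> F (prod3 p) = g p &
    forall a, bspan (fun p i s t j => ~ K p i s t j) a -> F a = 0].
Proof.
have [F [lF FE]] := basis_lift (tb_basis T) (fun p => if `[< sel K p >] then g p else 0).
exists F; split=> // [p i s t j hp Kp|a].
  rewrite (FE _ (bt_basis hp)) asboolT//; by exists i, s, t, j.
apply: (lin_span_eq0 lF) => _ [p [i [s [t [j [hp Kp ->]]]]]].
rewrite (FE _ (bt_basis hp)) asboolF// => -[i' [s' [t' [j' [hp' Kp']]]]].
by have [? ? ? ?] := bt_uniq hp hp'; subst i' s' t' j'.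
Qed.

(** ** The ideals generated by weights *)

(** Principal lower sets are finite, so the strict order is well founded. *)
Lemma weight_ind (Q : Lam -> Prop) :
  (forall l, (forall m, (m < l)%O -> Q m) -> Q l) -> forall l, Q l.
Proof.
move=> IH l; have [F hF] := tb_lower_finite T l.
have [n Fn] := ex_intro (fun n => #|` F| <= n)%N _ (leqnn #|` F|).
elim: n l F hF Fn => [|n IHn] l F hF Fn.
  have := hF l (lexx l); move: Fn; rewrite leqn0 cardfs_eq0 => /eqP->.
  by rewrite inE.
apply: IH => m ml; apply: (IHn m (F `\ l)%fset) => [x xm|].
  rewrite !inE hF; last exact: le_trans xm (ltW ml).
  by rewrite andbT; apply: contraTneq xm => ->; rewrite lt_geF.
by have := cardfsD1 l F; rewrite hF// add1n => e; rewrite -ltnS -e.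
Qed.

(** The left factor a 1_s and the right factor 1_s c expand into basis vectors
    whose inner indices have weights at most that of s.  Either some weight
    strictly drops, and induction applies, or the vector has the form
    x h y with h in H(s', t), s' of the same weight as s. *)
Lemma bspan_idem s a c : s \in S ->
  bspan (fun p i s' t j => (dot s' <= dot s)%O) (a ** 1_[A]_s ** c).
Proof.
have [l] : exists l, dot s = l by exists (dot s).
elim/weight_ind: l s a c => l IHl s a c sl sS.
have IH u b b' : u \in S -> (dot u < dot s)%O ->
    bspan (fun p i s' t j => (dot s' <= dot s)%O) (b ** 1_[A]_u ** b').
  rewrite {1}sl => uS us; have := IHl _ us u b b' erefl uS.
  by apply: bspan_mono => p i s' t j _ /le_trans; apply; rewrite sl ltW.
have as_s : a ** 1_[A]_s ** 1_[A]_s = a ** 1_[A]_s by rewrite -ga_mulA ga_idem_idem.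
apply: (lin_span (ga_mulPl c) _ (bspan_r as_s)).
move=> _ [[[x h] y] [i [s1 [t1 [j1 [hp e ->]]]]]]; rewrite {j1}e in hp.
have [/= s1S t1S hx hh hy] := hp.
have [/= _ xs] := bt_x hp; have [/= hs ht] := bt_h hp; have [/= yt ys] := bt_y hp.
have [t1s|t1s] := dot_Y t1S sS hy; last first.
  by rewrite -yt !ga_mulA -ga_mulA; apply: IH.
rewrite t1s in t1S hp hh hy *; have ds : dot s1 = dot s := dot_H s1S sS hh.
move/(Y_diag _ sS): hy => y1; rewrite y1.
have hg : 1_[A]_s1 ** (h ** 1_[A]_s ** c) = h ** 1_[A]_s ** c.
  by rewrite !ga_mulA hs.
rewrite -2!ga_mulA [h ** _]ga_mulA; apply: (lin_span (ga_mulPr x) _ (bspan_l hg)).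
move=> _ [[[x' h'] y'] [i2 [s2 [t2 [j2 [hp' e ->]]]]]]; rewrite {i2}e in hp'.
have [/= s2S t2S hx' hh' hy'] := hp'; have [/= xi' xs'] := bt_x hp'.
have [s12|s21] := dot_X s1S s2S hx'; last first.
  by rewrite -xs' -ga_mulA !ga_mulA -[_ ** h' ** y']ga_mulA; apply: IH; rewrite // -ds.
rewrite -s12 in hx' hh' hp' *; move/(X_diag _ s1S): hx' => ->.
rewrite !ga_mulA xs; apply: (bspan_gen (p := (x, h', y')) (i := i) (s := s1) (t := t2) (j := j2)).
  by split.
by rewrite ds.
Qed.

Lemma fibP l s : (s \in tb_fib T l) = (s \in S) && (dot s == l).
Proof. exact: tb_fibP. Qed.

Lemma e_sum_l l a : e_ T l ** a = \sum_(s <- tb_fib T l) 1_[A]_s ** a.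
Proof. exact: ga_sum_l. Qed.
Lemma e_sum_r l a : a ** e_ T l = \sum_(s <- tb_fib T l) a ** 1_[A]_s.
Proof. exact: (lin_sum (ga_mulPr a)). Qed.

Lemma e_fib_l l s : s \in tb_fib T l -> e_ T l ** 1_[A]_s = 1_[A]_s.
Proof.
move=> sl; rewrite e_sum_l (bigD1_seq s)//= ?fset_uniq// ga_idem_idem big1 ?addr0//.
by move=> t /negPf ts; rewrite ga_idem_mul ts.
Qed.
Lemma e_fib_r l s : s \in tb_fib T l -> 1_[A]_s ** e_ T l = 1_[A]_s.
Proof.
move=> sl; rewrite e_sum_r (bigD1_seq s)//= ?fset_uniq// ga_idem_idem big1 ?addr0//.
by move=> t /negPf ts; rewrite ga_idem_mul eq_sym ts.
Qed.
Lemma e_fib_r' l s a : s \in tb_fib T l -> a ** 1_[A]_s = a -> a ** e_ T l = a.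
Proof. by move=> sl sa; rewrite -sa -ga_mulA e_fib_r. Qed.

(** Both inclusions use e_m = sum of the 1_s: the first one is bspan_idem, the
    second one is the factorization xhy = x e_(dot s) (hy). *)
Lemma idealP l a : a \in ideal_sub T l <-> bspan (fun p i s t j => ~~ (l <= dot s)%O) a.
Proof.
split=> [/subspaceP|ha].
  apply: in_span_bind => _ [m [b [c [lm ->]]]].
  rewrite e_sum_r ga_sum_l; apply: in_span_sum => s; rewrite fibP => /andP[sS /eqP sm].
  apply: bspan_mono (bspan_idem b c sS) => p i s' t j _; rewrite sm => s'm.
  by apply: contra lm => /le_trans; apply.
apply/subspaceP; apply: in_span_mono ha => _ [p [i [s [t [j [hp ls ->]]]]]].
exists (dot s), p.1.1, (p.1.2 ** p.2); split=> //.
have [_ xs] := bt_x hp; rewrite (e_fib_r' (s := s))// ?ga_mulA// fibP eqxx andbT.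
by case: hp.
Qed.

(** ** The weight l part of the basis *)

Section Weight.
Variable l : Lam.
Local Notation J := (ideal_sub T l).
Local Notation Sl := (tb_fib T l).

Lemma fib_S s : s \in Sl -> s \in S. Proof. by rewrite fibP => /andP[]. Qed.
Lemma fib_dot s : s \in Sl -> dot s = l. Proof. by rewrite fibP => /andP[_ /eqP]. Qed.

Lemma bt_lower p i s t j : btrip p i s t j -> ~~ (l <= dot s)%O -> prod3 p \in J.
Proof. by move=> hp hs; apply/idealP; apply: bspan_gen hp hs. Qed.

(** In a basis vector xhy of 1_s A, either x = 1_s or the inner weight is
    smaller than l, and then the vector is in J. *)
Lemma weight_l K s b : s \in Sl -> 1_[A]_s ** b = b -> bspan K b ->
  in_span (fun u => u \in J \/ exists h y t j, [/\ btrip (1_[A]_s, h, y) s s t j,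
    K (1_[A]_s, h, y) s s t j & u = h ** y]) b.
Proof.
move=> sl sb Kb; have sS := fib_S sl.
apply: in_span_mono (bspan_cap Kb (bspan_l sb)).
move=> _ [p [i [s' [t [j [hp [Kp e] ->]]]]]]; rewrite {i}e in hp Kp; have [s'S tS hx _ _] := hp.
have [ss'|lt] := dot_X sS s'S hx; last first.
  left; apply: (bt_lower hp); rewrite -(fib_dot sl); by rewrite lt_geF.
right; rewrite -ss' in hp hx Kp; move/(X_diag _ sS): hx => x1.
case: p hp Kp x1 => -[x h] y hp Kp /= x1; rewrite x1 in hp Kp *.
exists h, y, t, j; split=> //.
by have [/= hs _] := bt_h hp; rewrite hs.
Qed.

Lemma weight_r s b : s \in Sl -> b ** 1_[A]_s = b ->
  in_span (fun u => u \in J \/ exists x h i t, [/\ t \in Sl, tb_X T i t x,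
    1_[A]_t ** h ** 1_[A]_s = h, x ** 1_[A]_t = x & u = x ** h]) b.
Proof.
move=> sl bs; have sS := fib_S sl.
apply: in_span_mono (bspan_r bs).
move=> _ [p [i [s' [t [j [hp e ->]]]]]]; rewrite {j}e in hp.
have [s'S tS hx hh hy] := hp.
have [ts|lt] := dot_Y tS sS hy; last first.
  left; apply: (bt_lower hp); rewrite -(fib_dot sl) (bt_dot hp); by rewrite lt_geF.
right; rewrite ts in hp hy hh; move/(Y_diag _ sS): hy => y1.
case: p hp hx hh y1 => -[x h] y hp hx hh /= y1; rewrite y1 in hp *.
have [/= hs ht] := bt_h hp; have [/= _ xs] := bt_x hp.
exists x, h, i, s'; split=> //; first by rewrite fibP s'S (bt_dot hp) (fib_dot sl) /=.
  by rewrite hs ht.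
by rewrite -ga_mulA ht.
Qed.

Lemma weight_lr s t b : s \in Sl -> t \in Sl -> 1_[A]_s ** b = b -> b ** 1_[A]_t = b ->
  in_span (fun u => u \in J \/ tb_H T s t u) b.
Proof.
move=> sl tl sb bt; apply: in_span_mono (weight_l sl sb (bspan_r bt)) => u.
move=> [|[h [y [t' [j [hp e ->]]]]]]; first by left.
rewrite {j}e in hp.
have [/= sS t'S _ hh hy] := hp; have tS := fib_S tl.
have [t't|lt] := dot_Y t'S tS hy; last first.
  left; have [/= hs _] := bt_h hp.
  have -> : h ** y = prod3 (1_[A]_s, h, y) by rewrite /= hs.
  apply: (bt_lower hp); rewrite -(fib_dot tl) (bt_dot hp); by rewrite lt_geF.
right; rewrite t't in hp hy hh; move/(Y_diag _ tS): hy => ->.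
by have [/= _ ->] := bt_h hp.
Qed.

(** Linear maps out of A / J can be prescribed on the basis vectors of inner
    weights >= l. *)
Lemma weight_lift (W : lmodType k) (g : A -> A -> A -> W) :
  exists F : A -> W, [/\ linear F, forall a, a \in J -> F a = 0 &
    forall x h y i s t j, btrip (x, h, y) i s t j -> s \in Sl ->
      F (x ** h ** y) = g x h y].
Proof.
have [F [lF FE F0]] := bspan_lift (fun p => g p.1.1 p.1.2 p.2)
  (fun p i s t j => (l <= dot s)%O).
exists F; split=> // [a /idealP h|x h y i s t j hp sl].
  by apply: F0; apply: bspan_mono h => p i s t j _ /negP.
by apply: (FE (x, h, y) _ _ _ _ hp); rewrite (fib_dot sl).
Qed.
End Weight.
End Triangular.

(** * Truncation to a weight *)

Section Deflation.
Variables (k : fieldType) (I : choiceType) (A : galg k I) (J : gideal A).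
Variables (V : gmod A) (JV : forall a v, a \in J -> a *> (v : V) = 0).

Definition defl_act (c : qalg J) (v : V) : V := qrepr (c : quotm J) *> v.

Lemma defl_actE a v : defl_act (qpi J a) v = a *> v.
Proof.
apply/eqP; rewrite -subr_eq0 -gm_actBl; apply/eqP/JV.
by apply/qpi_eq; rewrite qreprK.
Qed.
Lemma defl_actA (a b : qalg J) v : defl_act (a ** b) v = defl_act a (defl_act b v).
Proof.
rewrite -[a ** b]/(qpi J (qrepr (a : quotm J) ** qrepr (b : quotm J))).
by rewrite defl_actE gm_actA.
Qed.
Lemma defl_actPl v : linear (defl_act ^~ v).
Proof.
move=> c a b; rewrite -[a](@qreprK _ _ J) -[b](@qreprK _ _ J) -(qpi_linear J).
by rewrite !defl_actE gm_actPl.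
Qed.
Lemma defl_actPr a : linear (defl_act a).
Proof. exact: gm_actPr. Qed.
Lemma defl_act_hom d e (a : qalg J) v : a \in ga_gr (qalg J) d -> v \in gm_gr V e ->
  defl_act a v \in gm_gr V (d + e).
Proof. by move=> /subspaceP[b bd ->] ve; rewrite defl_actE gm_act_hom. Qed.
Lemma defl_unital v : in_span
  (fun w => exists i u, w = defl_act (ga_idem (qalg J) i) u) v.
Proof.
apply: in_span_mono (gm_unital v) => _ [i [u ->]].
by exists i, u; rewrite [RHS]defl_actE.
Qed.

(** Inverse to inflation. *)
Definition deflate : gmod (qalg J) :=
  GMod defl_actA defl_actPl defl_actPr defl_act_hom defl_unital.
End Deflation.

Section Truncation.
Variables (k : fieldType) (I : choiceType) (C : galg k I) (e : idem0 C).
Variable V : gmod C.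

Lemma trunc_axiom : subspace_axiom (fun v : V => (e : C) *> v = v).
Proof.
split; first exact: gm_act0r.
by move=> a u v hu hv; rewrite gm_actDr gm_actZr hu hv.
Qed.
Definition trunc_sub : submodClosed V := subspace trunc_axiom.

Lemma trunc_gr : graded_sub (gm_gr V) trunc_sub.
Proof.
move=> v /subspaceP ev; rewrite -ev.
apply: (lin_span (gm_actPr (e : C)) _ (hcomp_span (gm_gr V) v)) => u [d ud].
apply: in_span1; split; first by apply/subspaceP; rewrite -gm_actA id_mul.
by exists d; rewrite -[d]add0r; apply: gm_act_hom => //; apply: id_deg.
Qed.

Lemma trunc_act_subproof (a : corner e) (v : subm trunc_sub) :
  subm_val a *> (v : V) \in trunc_sub.
Proof.
by have /subspaceP[h _] := submP a; apply/subspaceP; rewrite -gm_actA h.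
Qed.
Definition trunc_act (a : corner e) v := Subm (trunc_act_subproof a v).
Lemma trunc_actA (a b : corner e) v : trunc_act (a ** b) v = trunc_act a (trunc_act b v).
Proof. by apply: val_inj; rewrite /= gm_actA. Qed.
Lemma trunc_actPl v : linear (trunc_act ^~ v).
Proof. by move=> c a b; apply: val_inj; rewrite /= gm_actDl gm_actZl. Qed.
Lemma trunc_actPr a : linear (trunc_act a).
Proof. by move=> c x y; apply: val_inj; rewrite /= gm_actDr gm_actZr. Qed.
Lemma trunc_act_hom d d' (a : corner e) v : a \in ga_gr (corner e) d ->
  v \in subm_grading trunc_gr d' -> trunc_act a v \in subm_grading trunc_gr (d + d').
Proof. by rewrite !subm_hcompP; apply: gm_act_hom. Qed.
Lemma trunc_unital v : in_span
  (fun w => exists i u, w = trunc_act (ga_idem (corner e) i) u) v.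
Proof.
apply: in_span1; exists tt, v; apply: val_inj => /=.
by have /subspaceP -> := submP v.
Qed.

(** For C = A_{>= l} this is the functor j^l. *)
Definition trunc : gmod (corner e) :=
  GMod trunc_actA trunc_actPl trunc_actPr trunc_act_hom trunc_unital.

Lemma trunc_proj_subproof (v : V) : (e : C) *> v \in trunc_sub.
Proof. by apply/subspaceP; rewrite -gm_actA id_mul. Qed.
Definition to_trunc (v : V) : trunc := Subm (trunc_proj_subproof v).

Lemma to_trunc_lin : linear to_trunc.
Proof. by move=> a u v; apply: val_inj; rewrite /= gm_actDr gm_actZr. Qed.
Lemma to_truncK (v : trunc) : to_trunc (subm_val v) = v.
Proof. by apply: val_inj; have /subspaceP := submP v. Qed.
Lemma to_trunc_hom d v : v \in gm_gr V d -> to_trunc v \in gm_gr trunc d.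
Proof.
by move=> vd; rewrite /= subm_hcompP /= -[d]add0r gm_act_hom ?id_deg.
Qed.

Let bal_l (v : trunc) : linear (fun c : Ce e => subm_val c *> subm_val v).
Proof. by move=> a x y; rewrite /= gm_actDl gm_actZl. Qed.
Let bal_r (c : Ce e) : linear (fun v : trunc => subm_val c *> subm_val v).
Proof. by move=> a x y; rewrite /= gm_actDr gm_actZr. Qed.
Let bal_b (c : Ce e) (a : corner e) (v : trunc) :
  subm_val (c <* a) *> subm_val v = subm_val c *> subm_val (a *> v).
Proof. by rewrite /= gm_actA. Qed.
(** The counit of the adjunction between j_! and truncation. *)
Definition tmul (z : tensor (Ce e) trunc) : V := tens_lift (Balanced bal_l bal_r bal_b) z.

Lemma tmulE (c : Ce e) (v : trunc) :
  tmul (tens (M := Ce e) c v) = subm_val c *> subm_val v.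
Proof. exact: tens_liftE. Qed.

Lemma tmul_hom : is_hom 0 tmul.
Proof.
have lm : linear tmul by exact: tens_lift_linear.
split=> // [a z|n z /subspaceP hz].
  have lz1 : linear (fun z : tensor (Ce e) trunc => tmul (a *> z)).
    by move=> c x y; rewrite gm_actDr gm_actZr lm.
  have lz2 : linear (fun z : tensor (Ce e) trunc => a *> tmul z).
    by move=> c x y; rewrite lm gm_actDr gm_actZr.
  apply: (lin_span_eq lz1 lz2 _ (tens_span z)) => _ [c [v ->]].
  have -> : gm_act (tensor (Ce e) trunc) a (tens (M := Ce e) c v) =
    tens (M := Ce e) (a *> c) v by exact: tens_actE.
  by rewrite !tmulE /= gm_actA.
rewrite addr0; move: z hz; apply: in_span_ind_sub.
  split; first by rewrite (lin0 lm) rpred0.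
  by move=> c x y hx hy; rewrite lm rpredD ?rpredZ.
move=> _ [d [f [c [v [cd vf <- ->]]]]]; rewrite tmulE.
by move: cd vf; rewrite /= !subm_hcompP; apply: gm_act_hom.
Qed.
End Truncation.

(** Computations in A_{>= l} e, e A_{>= l} and A_l are carried out on
    representatives in A, through the maps ceof, ecof and alof. *)
Section Elements.
Variables (k : fieldType) (I : choiceType) (A : galg k I).
Variables (disp : Order.disp_t) (Lam : porderType disp) (T : tri_basis A Lam).
Variable l : Lam.
Local Notation J := (ideal T l).
Local Notation C := (A_geq T l).
Local Notation eb := (ebar T l).
Local Notation Sl := (tb_fib T l).

Definition geq (a : A) : C := qpi J a.

Lemma geq_lin : linear geq. Proof. exact: qpi_linear. Qed.
Lemma geqM a b : geq a ** geq b = geq (a ** b). Proof. exact: qalg_mulE. Qed.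
Lemma geq_eq0 a : geq a = 0 <-> a \in J. Proof. exact: qpi0. Qed.
Lemma geq_surj (c : C) : exists a, c = geq a.
Proof. by exists (qrepr (c : quotm J)); rewrite /geq qreprK. Qed.
Lemma geq_hom d a : a \in ga_gr A d -> geq a \in ga_gr C d.
Proof. exact: quot_hcomp_pi. Qed.
Lemma geq_rep d (c : C) : c \in ga_gr C d -> exists2 a, a \in ga_gr A d & c = geq a.
Proof. by move=> /subspaceP. Qed.
Lemma geq_idem i : geq 1_[A]_i = 1_[C]_i. Proof. by []. Qed.
Lemma geq_e : geq (e_ T l) = eb. Proof. by []. Qed.

Definition ceof (a : A) : Ce eb := Subm (Ce_proj_subproof eb (geq a)).
Definition ecof (a : A) : eC eb := Subm (eC_proj_subproof eb (geq a)).

Lemma alof_subproof (a : A) : (eb : C) ** geq a ** (eb : C) \in eCe_sub eb.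
Proof.
apply/subspaceP; rewrite !ga_mulA id_mul; split=> //.
by rewrite -!ga_mulA id_mul.
Qed.
Definition alof (a : A) : A_at T l := Subm (alof_subproof a).

Lemma ceof_lin : linear ceof.
Proof.
move=> c a b; apply: val_inj.
exact: etrans (congr1 (fun x : C => x ** (eb : C)) (geq_lin c a b)) (ga_mulPl _ _ _ _).
Qed.
Lemma ecof_lin : linear ecof.
Proof.
move=> c a b; apply: val_inj.
exact: etrans (congr1 (fun x : C => (eb : C) ** x) (geq_lin c a b)) (ga_mulPr _ _ _ _).
Qed.
Lemma alof_lin : linear alof.
Proof.
have lf : linear (fun x : C => (eb : C) ** x ** (eb : C)).
  by move=> c x y; rewrite ga_mulDr ga_mulDl ga_mulZr ga_mulZl.
move=> c a b; apply: val_inj.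
exact: etrans (congr1 (fun x : C => (eb : C) ** x ** (eb : C)) (geq_lin c a b)) (lf _ _ _).
Qed.

Lemma ceof_eq0 a : a \in J -> ceof a = 0.
Proof.
move=> /geq_eq0 h; apply: val_inj.
exact: etrans (congr1 (fun x : C => x ** (eb : C)) h) (ga_mul0l _).
Qed.
Lemma ecof_eq0 a : a \in J -> ecof a = 0.
Proof.
move=> /geq_eq0 h; apply: val_inj.
exact: etrans (congr1 (fun x : C => (eb : C) ** x) h) (ga_mul0r _).
Qed.
Lemma alof_eq0 a : a \in J -> alof a = 0.
Proof.
move=> /geq_eq0 h; apply: val_inj.
apply: etrans (congr1 (fun x : C => (eb : C) ** x ** (eb : C)) h) _.
by rewrite ga_mul0r ga_mul0l.
Qed.

Let E : C := eb.
Let EE : E ** E = E. Proof. exact: id_mul. Qed.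

Lemma alofM a b : alof a ** alof b = alof (a ** e_ T l ** b).
Proof.
apply: val_inj; rewrite -[LHS]/(E ** geq a ** E ** (E ** geq b ** E)).
rewrite -[RHS]/(E ** geq (a ** e_ T l ** b) ** E) -!geqM geq_e -/E.
by rewrite !ga_mulA -(ga_mulA _ E E) EE.
Qed.
Lemma ceofM a b : gb_act (Ce eb) (ceof a) (alof b) = ceof (a ** e_ T l ** b).
Proof.
apply: val_inj; rewrite -[LHS]/(geq a ** E ** (E ** geq b ** E)).
rewrite -[RHS]/(geq (a ** e_ T l ** b) ** E) -!geqM geq_e -/E.
by rewrite !ga_mulA -(ga_mulA _ E E) EE.
Qed.
Lemma ecofM a b : gm_act (eC eb) (alof a) (ecof b) = ecof (a ** e_ T l ** b).
Proof.
apply: val_inj; rewrite -[LHS]/(E ** geq a ** E ** (E ** geq b)).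
rewrite -[RHS]/(E ** geq (a ** e_ T l ** b)) -!geqM geq_e -/E.
by rewrite !ga_mulA -(ga_mulA _ E E) EE.
Qed.
Lemma ceof_act a b : gm_act (Ce eb) (geq a) (ceof b) = ceof (a ** b).
Proof.
apply: val_inj; rewrite -[LHS]/(geq a ** (geq b ** E)).
by rewrite -[RHS]/(geq (a ** b) ** E) -geqM ga_mulA.
Qed.
Lemma ecof_act a b : gb_act (eC eb) (ecof a) (geq b) = ecof (a ** b).
Proof.
apply: val_inj; rewrite -[LHS]/(E ** geq a ** geq b).
by rewrite -[RHS]/(E ** geq (a ** b)) -geqM ga_mulA.
Qed.

Lemma alof_e a : alof (e_ T l ** a) = alof a.
Proof.
apply: val_inj; rewrite -[LHS]/(E ** geq (e_ T l ** a) ** E).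
by rewrite -geqM geq_e -/E ga_mulA EE.
Qed.
Lemma alof_r a : alof (a ** e_ T l) = alof a.
Proof.
apply: val_inj; rewrite -[LHS]/(E ** geq (a ** e_ T l) ** E).
by rewrite -geqM geq_e -/E -!ga_mulA EE !ga_mulA.
Qed.
Lemma ceof_r a : ceof (a ** e_ T l) = ceof a.
Proof.
apply: val_inj; rewrite -[LHS]/(geq (a ** e_ T l) ** E).
by rewrite -geqM geq_e -/E -!ga_mulA EE.
Qed.
Lemma ecof_l a : ecof (e_ T l ** a) = ecof a.
Proof.
apply: val_inj; rewrite -[LHS]/(E ** geq (e_ T l ** a)).
by rewrite -geqM geq_e -/E !ga_mulA EE.
Qed.

Lemma Ce_degP d (c : Ce eb) : (c \in gm_gr (Ce eb) d) = (subm_val c \in ga_gr C d).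
Proof. exact: (subm_hcompP (ga_gr C)). Qed.
Lemma eC_degP d (c : eC eb) : (c \in gm_gr (eC eb) d) = (subm_val c \in ga_gr C d).
Proof. exact: (subm_hcompP (ga_gr C)). Qed.
Lemma A_at_degP d (c : A_at T l) :
  (c \in ga_gr (A_at T l) d) = (subm_val c \in ga_gr C d).
Proof. exact: (subm_hcompP (ga_gr C)). Qed.

Lemma val_ceof a : subm_val (ceof a) = geq a ** E. Proof. by []. Qed.
Lemma val_ecof a : subm_val (ecof a) = E ** geq a. Proof. by []. Qed.
Lemma val_alof a : subm_val (alof a) = E ** geq a ** E. Proof. by []. Qed.

Lemma ceof_hom d a : a \in ga_gr A d -> ceof a \in gm_gr (Ce eb) d.
Proof. by move=> ad; rewrite Ce_degP val_ceof id_hom_r// geq_hom. Qed.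
Lemma ecof_hom d a : a \in ga_gr A d -> ecof a \in gm_gr (eC eb) d.
Proof. by move=> ad; rewrite eC_degP val_ecof id_hom_l// geq_hom. Qed.
Lemma alof_hom d a : a \in ga_gr A d -> alof a \in ga_gr (A_at T l) d.
Proof. by move=> ad; rewrite A_at_degP val_alof id_hom_r// id_hom_l// geq_hom. Qed.

Lemma ceof_val (c : Ce eb) a : subm_val c = geq a -> c = ceof a.
Proof.
move=> e; apply: val_inj; rewrite [RHS](val_ceof a) -e.
by have /subspaceP := submP c.
Qed.
Lemma ecof_val (c : eC eb) a : subm_val c = geq a -> c = ecof a.
Proof.
move=> e; apply: val_inj; rewrite [RHS](val_ecof a) -e.
by have /subspaceP := submP c.
Qed.
Lemma alof_val (c : A_at T l) a : subm_val c = geq a -> c = alof a.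
Proof.
move=> e; apply: val_inj; rewrite [RHS](val_alof a) -e.
have /subspaceP[h1 h2] := submP c.
by rewrite -[LHS]/(subm_val c) /E h1 h2.
Qed.

Lemma ceof_rep d (c : Ce eb) : c \in gm_gr (Ce eb) d ->
  exists2 a, a \in ga_gr A d & c = ceof a.
Proof. by rewrite Ce_degP => /geq_rep[a ad /ceof_val]; exists a. Qed.
Lemma ecof_rep d (c : eC eb) : c \in gm_gr (eC eb) d ->
  exists2 a, a \in ga_gr A d & c = ecof a.
Proof. by rewrite eC_degP => /geq_rep[a ad /ecof_val]; exists a. Qed.
Lemma alof_rep d (c : A_at T l) : c \in ga_gr (A_at T l) d ->
  exists2 a, a \in ga_gr A d & c = alof a.
Proof. by rewrite A_at_degP => /geq_rep[a ad /alof_val]; exists a. Qed.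
Lemma ceof_surj (c : Ce eb) : exists a, c = ceof a.
Proof. by have [a /ceof_val] := geq_surj (subm_val c); exists a. Qed.
Lemma ecof_surj (c : eC eb) : exists a, c = ecof a.
Proof. by have [a /ecof_val] := geq_surj (subm_val c); exists a. Qed.
Lemma alof_surj (c : A_at T l) : exists a, c = alof a.
Proof. by have [a /alof_val] := geq_surj (subm_val c); exists a. Qed.

Lemma ceof_sum a : ceof a = \sum_(s <- Sl) ceof (a ** 1_[A]_s).
Proof. by rewrite -(lin_sum ceof_lin) -e_sum_r ceof_r. Qed.
Lemma ecof_sum a : ecof a = \sum_(s <- Sl) ecof (1_[A]_s ** a).
Proof. by rewrite -(lin_sum ecof_lin) -e_sum_l ecof_l. Qed.
Lemma alof_sum a :
  alof a = \sum_(s <- Sl) \sum_(t <- Sl) alof (1_[A]_s ** a ** 1_[A]_t).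
Proof.
rewrite -alof_e e_sum_l (lin_sum alof_lin); apply: eq_bigr => s _.
by rewrite -alof_r e_sum_r (lin_sum alof_lin).
Qed.

Section Finiteness.
Hypotheses (A_lfd : alg_loc_fin_dim A) (A_bb : alg_bounded_below A).

Lemma uniform_bound (J0 : eqType) (s : seq J0) (P : J0 -> int -> Prop) :
  (forall i, exists N, forall d, d < N -> P i d) ->
  exists N, forall i, i \in s -> forall d, d < N -> P i d.
Proof.
move=> h; elim: s => [|i s [N hN]]; first by exists 0.
have [M hM] := h i; exists (Order.min N M) => j; rewrite inE => js d.
by rewrite lt_min => /andP[dN dM]; case/orP: js => [/eqP->|/hN]; [apply: hM|apply].
Qed.

Lemma sandwich_hom i j d a : a \in ga_gr A d ->
  1_[A]_i ** a ** 1_[A]_j \in ga_gr A d /\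
  1_[A]_i ** (1_[A]_i ** a ** 1_[A]_j) ** 1_[A]_j = 1_[A]_i ** a ** 1_[A]_j.
Proof.
move=> ad; split; first exact/hom_le_r/hom_le_l.
by rewrite !ga_mulA ga_idem_idem -ga_mulA ga_idem_idem.
Qed.

Lemma A_at_lfd : alg_loc_fin_dim (A_at T l).
Proof.
move=> [] [] d; apply: fin_dim_gen; first exact: idem_axiom.
apply: (fin_gen_sub (Q := fun c => exists2 st : I * I, st \in [seq (s, t) | s <- Sl, t <- Sl] &
   exists2 a, a \in ga_gr A d /\ 1_[A]_st.1 ** a ** 1_[A]_st.2 = a & c = alof a)).
  move=> c [/alof_rep[a ad ->] _]; rewrite alof_sum.
  apply: in_span_sum => s ss; apply: in_span_sum => t ts; apply: in_span1.
  exists (s, t); first by apply/allpairsP; exists (s, t).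
  by eexists; first exact: sandwich_hom ad.
apply: fin_gen_sum => -[s t] _.
by apply: (fin_gen_image alof_lin (fin_gen_dim (A_lfd s t d))).
Qed.

Lemma A_at_bb : alg_bounded_below (A_at T l).
Proof.
move=> [] [].
have [N hN] : exists N, forall st, st \in [seq (s, t) | s <- Sl, t <- Sl] -> forall d,
    d < N -> forall a, a \in ga_gr A d -> 1_[A]_st.1 ** a ** 1_[A]_st.2 = a -> a = 0.
  apply: (@uniform_bound _ _ (fun st d => forall a, a \in ga_gr A d ->
    1_[A]_st.1 ** a ** 1_[A]_st.2 = a -> a = 0)) => -[s t].
  have [N hN] := A_bb s t; exists N => d dN a ad; exact: (hN d dN a ad).
exists N => d dN c /alof_rep[a ad ->] _; rewrite alof_sum.
rewrite big_seq big1// => s ss; rewrite big_seq big1// => t ts.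
have [ad' a1] := sandwich_hom s t ad.
have -> : 1_[A]_s ** a ** 1_[A]_t = 0; last exact: lin0 alof_lin.
by apply: (hN (s, t) _ d dN) => //; apply/allpairsP; exists (s, t).
Qed.
End Finiteness.
End Elements.

(** * The layers of a projective module *)

Section Layer.
Variables (k : fieldType) (I : choiceType) (A : galg k I).
Variables (disp : Order.disp_t) (Lam : porderType disp) (T : tri_basis A Lam).
Variables (P : gmod A) (i : I) (n : int) (x0 : P) (sg : P -> A).
Hypothesis pr : presentation i n x0 sg.
Variable l : Lam.
Local Notation J := (ideal T l).
Local Notation C := (A_geq T l).
Local Notation eb := (ebar T l).
Local Notation Sl := (tb_fib T l).

Let lsg : linear sg. Proof. exact: pr_lin pr. Qed.

Lemma sg_hproj d p : sg (hproj (gm_gr P) d p) = hproj (ga_gr A) (d - n) (sg p).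
Proof. by apply: (hproj_comm _ _ lsg) => m u /(pr_deg pr). Qed.

(** This submodule is J P: if sg p is in J then p = sg p *> x0 is in J P. *)
Lemma JP_axiom : gsub_axiom (fun p : P => sg p \in J).
Proof.
split=> [|a p h|d p h].
- split; first by rewrite (lin0 lsg) rpred0.
  by move=> a u v hu hv; rewrite lsg rpredD ?rpredZ.
- by rewrite (pr_act pr); apply: ideal_mull.
by rewrite sg_hproj; apply: (graded_sub_proj (@gi_gr _ _ _ J)).
Qed.
Definition JP : gsub P := mkgsub JP_axiom.
Lemma JPP p : p \in JP <-> sg p \in J. Proof. exact: mkgsubP. Qed.

Definition topq : gmod A := gquot JP.
Definition cls (p : P) : topq := qpi JP p.

Lemma cls_hom : is_hom 0 cls. Proof. exact: gquot_hom. Qed.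
Let lcls : linear cls. Proof. exact: hom_lin cls_hom. Qed.
Lemma cls_act a p : a *> cls p = cls (a *> p). Proof. exact: gquot_act. Qed.
Lemma cls_eq0 p : cls p = 0 <-> sg p \in J.
Proof. by rewrite -JPP; apply: qpi0. Qed.
Lemma cls_surj (m : topq) : exists p, cls p = m. Proof. exact: qpi_surj. Qed.

Lemma topq_J a (m : topq) : a \in J -> a *> m = 0.
Proof.
move=> aJ; have [p <-] := cls_surj m; rewrite cls_act; apply/cls_eq0.
by rewrite (pr_act pr); apply: ideal_mulr.
Qed.

Definition topd : gmod C := deflate topq_J.
Definition layer : gmod (A_at T l) := trunc eb topd.

Lemma topd_act a (m : topq) : gm_act topd (geq T l a) m = a *> m.
Proof. exact: (defl_actE topq_J a m). Qed.

Definition lof (m : topq) : layer := to_trunc eb (V := topd) m.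
Lemma lof_lin : linear lof. Proof. exact: (@to_trunc_lin _ _ _ eb topd). Qed.
Lemma val_lof m : subm_val (lof m) = e_ T l *> m :> topq.
Proof. exact: topd_act. Qed.
Lemma lofK (q : layer) : lof (subm_val q) = q. Proof. exact: (@to_truncK _ _ _ eb topd). Qed.
Lemma lof_hom d m : m \in gm_gr topq d -> lof m \in gm_gr layer d.
Proof. exact: (@to_trunc_hom _ _ _ eb topd). Qed.
Lemma layer_degP d (q : layer) : (q \in gm_gr layer d) = ((subm_val q : topq) \in gm_gr topq d).
Proof. exact: (subm_hcompP (gm_gr topd)). Qed.
Lemma lof_inj (q q' : layer) : subm_val q = subm_val q' -> q = q'.
Proof. exact: val_inj. Qed.

Lemma layer_act a (q : layer) :
  subm_val (alof T l a *> q) = (e_ T l ** a ** e_ T l) *> (subm_val q : topq) :> topq.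
Proof.
rewrite -[LHS]/(gm_act topd (subm_val (alof T l a)) (subm_val q)) val_alof.
by rewrite -geq_e !geqM topd_act.
Qed.

Lemma alof_lof a b p : alof T l a *> lof (cls (b *> p)) = lof (cls ((a ** e_ T l ** b) *> p)).
Proof.
apply: lof_inj; rewrite layer_act !val_lof !cls_act.
by rewrite -!gm_actA !ga_mulA -(ga_mulA _ (e_ T l) (e_ T l)) e_mul.
Qed.

Definition qof (a : A) : layer := lof (cls (a *> x0)).

Lemma qof_lin : linear qof.
Proof. by move=> c a b; rewrite /qof gm_actPl lcls lof_lin. Qed.
Lemma qof_sg p : qof (sg p) = lof (cls p).
Proof. by rewrite /qof (pr_K pr). Qed.
Lemma qof_eq0 a : a \in J -> qof a = 0.
Proof.
move=> aJ; rewrite /qof -cls_act topq_J//; exact: (lin0 lof_lin).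
Qed.
Lemma alof_qof a b : alof T l a *> qof b = qof (a ** e_ T l ** b).
Proof. exact: alof_lof. Qed.
Lemma qof_e a : qof (e_ T l ** a) = qof a.
Proof.
apply: lof_inj; rewrite !val_lof !cls_act.
by rewrite -!gm_actA ga_mulA e_mul.
Qed.
Lemma qof_hom d a : a \in ga_gr A d -> qof a \in gm_gr layer (d + n).
Proof.
move=> ad; apply/lof_hom; rewrite -[d + n]addr0; apply: (hom_deg cls_hom).
by apply: gm_act_hom => //; apply: pr_hom pr.
Qed.
Lemma qof_sum a : qof a = \sum_(s <- Sl) qof (1_[A]_s ** a).
Proof. by rewrite -(lin_sum qof_lin) -e_sum_l qof_e. Qed.

Lemma layer_rep (q : layer) : exists p, q = qof (sg p) /\ subm_val q = cls p.
Proof.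
by have [p e] := cls_surj (subm_val q : topq); exists p; rewrite qof_sg e lofK.
Qed.
Lemma layer_rep_hom d (q : layer) : q \in gm_gr layer d ->
  exists2 p, p \in gm_gr P d & q = qof (sg p) /\ subm_val q = cls p.
Proof.
rewrite layer_degP => /subspaceP[p pd e]; exists p => //.
by rewrite qof_sg /cls -e lofK.
Qed.

(** ** Multiplication from the layer is injective *)

Local Notation ten := (tensor (Ce eb) layer).
Local Notation tns := (tens (M := Ce eb) (V := layer)).

Lemma tmul_tens a q : tmul (tns (ceof T l a) q : ten) = a *> (subm_val q : topq).
Proof.
rewrite tmulE val_ceof -geq_e geqM topd_act.
by rewrite -{1}(lofK q) val_lof -gm_actA -ga_mulA e_mul gm_actA -val_lof lofK.
Qed.

(** The products of A e_l with the layer satisfy the universal property of the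
    tensor product: for a basis vector xhy of weight l, the class of xhy x0 has
    to be sent to b(x, hy x0), and this prescribes N. *)
Lemma layer_universal (W : lmodType k) (b : Ce eb -> layer -> W) :
  (forall q, linear (b^~ q)) -> (forall c, linear (b c)) ->
  (forall c a q, b (gb_act (Ce eb) c a) q = b c (a *> q)) ->
  exists N : topq -> W, linear N /\
    forall a q, N (a *> (subm_val q : topq)) = b (ceof T l a) q.
Proof.
move=> bl br bb; pose g x h y := b (ceof T l x) (qof (h ** y)).
have [F [lF F0 FE]] := weight_lift T l g.
have Fx i' t x u : t \in Sl -> tb_X T i' t x -> 1_[A]_t ** u = u ->
    F (x ** u) = b (ceof T l x) (qof u).
  move=> tl hx tu.
  have l1 : linear (fun u => F (x ** u)) by move=> c v w; rewrite ga_mulPr lF.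
  have l2 : linear (fun u => b (ceof T l x) (qof u)).
    by move=> c v w; rewrite qof_lin br.
  apply: (lin_span_eq l1 l2 _ (weight_l tl tu (bspan_l T tu))).
  move=> v [vJ|[h [y [t' [j [hp _ ->]]]]]].
    by rewrite (F0 _ (ideal_mull x vJ)) qof_eq0// (lin0 (br _)).
  rewrite ga_mulA (FE x h y i' t t' j)//.
  by case: hp => /= *; split.
have lFs : linear (fun p => F (sg p)) by move=> c u v; rewrite lsg lF.
have [|N [lN NE]] := factor_lin lcls lFs cls_surj.
  by move=> p /cls_eq0; apply: F0.
exists N; split=> // a q; have [p [qp vq]] := layer_rep q.
have lb : linear (fun a => b (ceof T l a) q) by move=> c u v; rewrite ceof_lin bl.
have lNq : linear (fun a => N (a *> (subm_val q : topq))).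
  by move=> c u v; rewrite gm_actPl lN.
have qe : e_ T l *> (subm_val q : topq) = subm_val q by rewrite -val_lof lofK.
rewrite -qe -gm_actA e_sum_r gm_sum_l (lin_sum lN) ceof_sum (lin_sum (bl q)).
apply: eq_big_seq => s sl; have as_s : a ** 1_[A]_s ** 1_[A]_s = a ** 1_[A]_s.
  by rewrite -ga_mulA ga_idem_idem.
apply: (lin_span_eq lNq lb _ (weight_r sl as_s)) => u.
move=> [uJ|[x [h [i' [t [tl hx hh xt ->]]]]]].
  by rewrite topq_J// ceof_eq0// (lin0 (bl _)) (lin0 lN).
have [th hs] := sandwich hh.
rewrite vq cls_act NE (pr_act pr) -ga_mulA (Fx i' t)//; last first.
  by rewrite ga_mulA th.
have he : h ** e_ T l = h := e_fib_r' sl hs.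
have xe : x ** e_ T l = x := e_fib_r' tl xt.
by rewrite -{2}xe -ceofM bb qp alof_qof he.
Qed.

Lemma tmul_left_inv : exists N : topq -> ten, linear N /\ forall z : ten, N (tmul z) = z.
Proof.
have [N [lN NE]] := layer_universal (tensPl (M := Ce eb) (V := layer))
  (tensPr (M := Ce eb) (V := layer)) (tens_bal (M := Ce eb) (V := layer)).
exists N; split=> // z; have lm : linear (@tmul _ _ _ eb topd) := hom_lin (tmul_hom eb topd).
have lNm : linear (fun z : ten => N (tmul z)) by move=> c u v; rewrite lm lN.
apply: (lin_span_eq lNm (g := idfun) _ _ (tens_span z)) => // _ [c [q ->]].
by have [a ->] := ceof_surj c; rewrite tmul_tens NE.
Qed.

Lemma tmul_inj (z : ten) : tmul z = 0 :> topq -> z = 0.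
Proof.
move=> z0; have [N [lN NK]] := tmul_left_inv.
by rewrite -[z]NK z0 (lin0 lN).
Qed.

(** ** The layer is projective *)

(** The layer of A 1_i is the direct sum of the modules A_l 1_t generated by
    the classes of the y in Y(t, i), with t of weight l, so lifts can be chosen
    freely on these classes.  The section sg transfers this to P. *)
Lemma layer_projective : projective layer.
Proof.
move=> V W g f hg sg_ hf; have lg := hom_lin hg; have lf := hom_lin hf.
have vy y : exists v : V, g v = f (qof y) /\
    forall d, y \in ga_gr A d -> y <> 0 -> v \in gm_gr V (d + n).
  have [[d yd]|nh] := pselect (exists d, y \in ga_gr A d); last first.
    by have [v gv] := sg_ (f (qof y)); exists v; split=> // d yd; case: nh; exists d.
  have [v gv] := sg_ (f (qof y)); exists (hproj (gm_gr V) (d + n) v); split.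
    rewrite (hom_hproj hg) gv addr0 hproj_id// -[d + n]addr0 (hom_deg hf)//.
    exact: qof_hom.
  move=> d' yd' y0; suff -> : d' = d by exact: hproj_mem.
  apply/eqP; apply: contra_notT y0 => /negPf dd.
  by rewrite -(hproj_id yd') (hproj_hom _ yd) dd.
pose v y := projT1 (cid (vy y)).
have gv y : g (v y) = f (qof y) by rewrite /v; case: cid => ? [].
have vd y d : y \in ga_gr A d -> y <> 0 -> v y \in gm_gr V (d + n).
  by rewrite /v; case: cid => ? []; auto.
(* F maps hy, with y in Y(t, i), to the product of h with the chosen lift of
   the class of y x0. *)
have [F [lF F0 FE]] := weight_lift T l
  (fun x h y => alof T l h *> v y).
have FE' h y s t j : s \in Sl -> btrip T (1_[A]_s, h, y) s s t j ->
    F (h ** y) = alof T l h *> v y.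
  move=> sl hp; rewrite -(FE _ _ _ _ _ _ _ hp sl).
  by have [/= sh _] := bt_h hp; rewrite sh.
have tl_ h y s t j : s \in Sl -> btrip T (1_[A]_s, h, y) s s t j -> t \in Sl.
  by move=> sl hp; rewrite fibP -(bt_dot hp) (fib_dot sl) eqxx andbT; case: hp.
have gF s b : s \in Sl -> 1_[A]_s ** b = b -> g (F b) = f (qof b).
  move=> sl sb.
  have l1 : linear (fun b => g (F b)) by move=> c x y; rewrite lF lg.
  have l2 : linear (fun b => f (qof b)) by move=> c x y; rewrite qof_lin lf.
  apply: (lin_span_eq l1 l2 _ (weight_l sl sb (bspan_l T sb))).
  move=> u [uJ|[h [y [t [j [hp _ ->]]]]]].
    by rewrite F0// qof_eq0// (lin0 lg) (lin0 lf).
  rewrite (FE' _ _ _ _ _ sl hp) (hom_act hg) gv -(hom_act hf) alof_qof.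
  have [/= _ ht] := bt_h hp; rewrite (e_fib_r' (tl_ _ _ _ _ _ sl hp) ht).
  by [].
have alF s t b a : s \in Sl -> t \in Sl -> 1_[A]_t ** b = b -> 1_[A]_s ** a = a ->
    a ** 1_[A]_t = a -> F (a ** b) = alof T l a *> F b.
  move=> sl tl tb sa at_.
  have l1 : linear (fun b => F (a ** b)) by move=> c x y; rewrite ga_mulPr lF.
  have l2 : linear (fun b => alof T l a *> F b).
    by move=> c x y; rewrite lF gm_actPr.
  apply: (lin_span_eq l1 l2 _ (weight_l tl tb (bspan_l T tb))).
  move=> u [uJ|[h [y [t' [j [hp _ ->]]]]]].
    by rewrite (F0 _ (ideal_mull a uJ)) F0// gm_act0r.
  have tl' := tl_ _ _ _ _ _ tl hp; have [/= th ht] := bt_h hp.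
  rewrite (FE' _ _ _ _ _ tl hp) -gm_actA alofM (e_fib_r' tl at_) ga_mulA.
  have l3 : linear (fun c => F (c ** y)) by move=> c x z; rewrite ga_mulPl lF.
  have l4 : linear (fun c => alof T l c *> v y).
    by move=> c x z; rewrite alof_lin gm_actPl.
  have sah : 1_[A]_s ** (a ** h) = a ** h by rewrite ga_mulA sa.
  have aht : a ** h ** 1_[A]_t' = a ** h by rewrite -ga_mulA ht.
  apply: (lin_span_eq l3 l4 _ (weight_lr sl tl' sah aht)) => c [cJ|hc].
    by rewrite F0 ?alof_eq0 ?gm_act0l//; apply: ideal_mulr.
  have hp' : btrip T (1_[A]_s, c, y) s s t' j.
    have sS := fib_S sl.
    by case: hp => /= _ t'S _ _ hy; split=> //; apply/X_diag.
  exact: FE' hp'.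
have Fhom s d b : s \in Sl -> 1_[A]_s ** b = b -> b \in ga_gr A d ->
    F b \in gm_gr V (d + n).
  move=> sl sb bd; apply: (in_span_ind_sub (Q := fun b => F b \in gm_gr V (d + n)) _ _
    (weight_l sl sb (bspan_hom T bd))).
    split; first by rewrite (lin0 lF) rpred0.
    by move=> c x y hx hy; rewrite lF rpredD ?rpredZ.
  move=> u [uJ|[h [y [t [j [hp + ->]]]]]] /=; first by rewrite F0// rpred0.
  rewrite (FE' _ _ _ _ _ sl hp) => ud.
  have [/= sS tS _ hh hy] := hp; have [_ [d1 hd1]] := tb_H_hom sS tS hh.
  have [_ [d2 yd2]] := tb_Y_hom tS hy; have := bt_neq0 hp; have [/= sh _] := bt_h hp.
  rewrite /= sh in ud * => hy0.
  have <- : d1 + d2 = d.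
    apply/eqP; apply: contra_notT hy0 => /negPf dd.
    by rewrite -(hproj_id ud) (hproj_hom _ (ga_mul_hom hd1 yd2)) eq_sym dd.
  rewrite -addrA; apply: gm_act_hom; first exact: alof_hom.
  by apply: vd => // y0; apply: hy0; rewrite y0 ga_mul0r.
(* Fe adds up the values of F on the blocks 1_s A with s of weight l. *)
pose Fe b := \sum_(s <- Sl) F (1_[A]_s ** b).
have lFe : linear Fe.
  move=> c x y; rewrite /Fe scaler_sumr -big_split; apply: eq_bigr => s _ /=.
  by rewrite ga_mulPr lF.
have lFs : linear (Fe \o sg) by move=> c x y; rewrite /= lsg lFe.
have [|H [lH HE]] := factor_lin lcls lFs cls_surj.
  by move=> p /cls_eq0 pJ; rewrite /= /Fe big1// => s _; apply/F0/ideal_mull.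
have ss s b : 1_[A]_s ** (1_[A]_s ** b) = 1_[A]_s ** b.
  by rewrite ga_mulA ga_idem_idem.
exists (fun q : layer => H (subm_val q)); split; last first.
  move=> q; have [p [qp vq]] := layer_rep q; rewrite vq HE /= /Fe (lin_sum lg).
  rewrite qp qof_sum (lin_sum lf); apply: eq_big_seq => s sl.
  exact: gF sl (ss _ _).
split=> [c x y|a q|d q].
- exact: (lH c (subm_val x) (subm_val y)).
- have [b ->] := alof_surj a; have [p [qp vq]] := layer_rep q.
  rewrite layer_act vq cls_act !HE /= (pr_act pr) {2}/Fe (lin_sum (gm_actPr _)).
  have tE t : t \in Sl -> alof T l b *> F (1_[A]_t ** sg p) =
      Fe (b ** 1_[A]_t ** sg p).
    move=> tl; have := alF t t (1_[A]_t ** sg p) 1_[A]_t tl tl (ss _ _).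
    rewrite ss ga_idem_idem => -> //.
    rewrite -gm_actA alofM -ga_mulA (e_fib_l tl) -alof_e e_sum_l.
    rewrite (lin_sum (alof_lin T l)) gm_sum_l; apply: eq_big_seq => s sl.
    rewrite -(alF s t)// ?ss//; last by rewrite -!ga_mulA ga_idem_idem.
    by rewrite -!ga_mulA ss.
  rewrite (eq_big_seq _ tE) -(lin_sum lFe) -ga_sum_l -e_sum_r.
  rewrite /Fe; apply: eq_big_seq => s sl.
  by rewrite !ga_mulA -[1_[A]_s ** e_ T l]/(_ ** _) (e_fib_r sl).
move=> /layer_rep_hom[p pd [_ vq]]; rewrite vq HE /= /Fe addr0.
rewrite big_seq; apply: rpred_sum => s sl; rewrite -[d](addrNK n).
by apply: Fhom sl (ss _ _) _; apply/hom_le_l/(pr_deg pr).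
Qed.

Section Finite.
Hypotheses (A_lfd : alg_loc_fin_dim A) (A_bb : alg_bounded_below A).

Let sr s p : 1_[A]_s ** (1_[A]_s ** sg p) ** 1_[A]_i = 1_[A]_s ** sg p.
Proof. by rewrite -!ga_mulA (pr_r pr) ga_mulA ga_idem_idem. Qed.

(** The layer in degree d is the image of the sum of the finitely many spaces
    (1_s A 1_i)_(d - n), with s of weight l. *)
Lemma layer_lfd : loc_fin_dim layer.
Proof.
move=> [] d; apply: fin_dim_gen; first exact: idem_mod_axiom.
apply: (fin_gen_sub (Q := fun q : layer => exists2 s, s \in enum_fset Sl &
   exists2 a, a \in ga_gr A (d - n) /\ 1_[A]_s ** a ** 1_[A]_i = a & q = qof a)).
  move=> q [/layer_rep_hom[p pd [-> _]] _]; rewrite qof_sum.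
  apply: in_span_sum => s sl; apply: in_span1; exists s => //.
  by exists (1_[A]_s ** sg p) => //; split; [apply/hom_le_l/(pr_deg pr)|apply: sr].
apply: fin_gen_sum => s _.
exact: (fin_gen_image qof_lin (fin_gen_dim (A_lfd s i (d - n)))).
Qed.

Lemma layer_bb : bounded_below layer.
Proof.
move=> []; have [N hN] : exists N, forall s, s \in (Sl : seq I) -> forall d,
    d < N -> forall a, a \in ga_gr A d -> 1_[A]_s ** a ** 1_[A]_i = a -> a = 0.
  by apply: (@uniform_bound _ _ (fun s d => forall a, a \in ga_gr A d ->
    1_[A]_s ** a ** 1_[A]_i = a -> a = 0)) => s; apply: A_bb.
exists (N + n) => d dN q /layer_rep_hom[p pd [-> _]] _; rewrite qof_sum.
rewrite big_seq big1// => s sl.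
have -> : 1_[A]_s ** sg p = 0; last exact: lin0 qof_lin.
by apply: (hN s sl (d - n)); [rewrite ltrBlDr|apply/hom_le_l/(pr_deg pr)|apply: sr].
Qed.
End Finite.

(** ** Sections of P that are layers *)

(** Both modules embed in P / J P: the section by the first hypothesis, and
    the standard module by tmul.  The other hypotheses make the images equal. *)
Lemma section_layer (U W : gsub P) :
  (forall w, w \in W -> (w \in U <-> sg w \in J)) ->
  (forall w, w \in W -> exists z : ten, tmul z = cls w :> topq) ->
  (forall a p, (a ** e_ T l) *> p \in W) ->
  gmod_iso (gsection U W) (j_shriek layer).
Proof.
move=> UW Wz zW.
have hWc : is_hom 0 (fun w : gsubmod W => cls (subm_val w)).
  by have := is_hom_comp (gsubmod_hom W) cls_hom; rewrite addr0.
have [|f [hf fE]] := factor_hom (sec_pi_hom U W) hWc (@sec_pi_surj _ _ _ _ U W).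
  by move=> w /sec_pi_eq0 wU; apply/cls_eq0/(UW _ (submP w)).
have hm : @is_hom _ _ A (j_shriek layer) topq 0 (@tmul _ _ _ eb topd).
  have [lm am dm] := tmul_hom eb topd; split=> // a z.
  exact: etrans (am (geq T l a) z) (topd_act a _).
apply: (gmod_iso_im hf hm) => [x|z /tmul_inj //|x|z].
- have [w <-] := sec_pi_surj x; rewrite fE => /cls_eq0 h.
  exact/sec_pi_eq0/(UW _ (submP w)).
- have [w <-] := sec_pi_surj x; rewrite fE.
  by have [z <-] := Wz _ (submP w); exists z.
suff [w [wW wz]] : exists w, w \in W /\ cls w = tmul (z : ten).
  by exists (sec_pi U (Subm wW)); rewrite fE.
have lm := hom_lin (tmul_hom eb topd).
elim: {z}(tens_span z) => [|c _ z [m [q ->]] _ [w [wW wz]]].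
  by exists 0; rewrite rpred0 (lin0 lm) (lin0 lcls).
have [a ->] := ceof_surj m; have [p [_ qp]] := layer_rep q.
exists (c *: ((a ** e_ T l) *> p) + w); split; first by rewrite rpredD ?rpredZ.
rewrite lm lcls wz; congr (_ *: _ + _); rewrite tmul_tens -cls_act -qp.
by rewrite gm_actA -val_lof lofK.
Qed.

End Layer.

(** * Flags *)

(** Sort by the number of elements of r lying below, which is strictly
    monotone. *)
Lemma linear_extension (disp : Order.disp_t) (Lam : porderType disp) (r : seq Lam) :
  exists2 s : seq Lam, uniq s /\ s =i r &
    forall x0 a b, (a < size s)%N -> (b < size s)%N ->
      (nth x0 s b < nth x0 s a)%O -> (b < a)%N.
Proof.
pose u := undup r; pose key x := count (fun m => m <= x)%O u.
pose le x y := (key x <= key y)%N.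
have le_tr : transitive le by move=> y x z; apply: leq_trans.
have le_refl : reflexive le by move=> x; apply: leqnn.
have le_tot : total le by move=> x y; apply: leq_total.
exists (sort le u).
  by split=> [|x]; rewrite ?sort_uniq ?undup_uniq// mem_sort mem_undup.
move=> x0 a b sa sb lt; rewrite ltnNge; apply/negP => ab.
have /(sorted_leq_nth le_tr le_refl x0)/(_ a b sa sb ab) := sort_sorted le_tot u.
rewrite /le leqNgt => /negP; apply.
set x := nth x0 _ b in lt *; set y := nth x0 _ a in lt *.
have yu : y \in u by rewrite -(mem_sort le) mem_nth.
rewrite /key -!sum1_count [X in (X < _)%N]big_mkcond [X in (_ < X)%N]big_mkcond /=.
rewrite (bigD1_seq y)//= ?undup_uniq// [X in (_ < X)%N](bigD1_seq y)//= ?undup_uniq//.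
rewrite lexx (lt_geF lt) add0n add1n ltnS; apply: leq_sum => m _.
by case: ifP => // mx; rewrite (le_trans mx (ltW lt)).
Qed.

Section Flag.
Variables (k : fieldType) (I : choiceType) (A : galg k I).
Variables (disp : Order.disp_t) (Lam : porderType disp) (T : tri_basis A Lam).
Local Notation dot := (tb_dot T).

(** For i in S the axioms bound the weight of t by that of i, and principal
    lower sets are finite; for the other i finiteness is an axiom. *)
Lemma finite_weights i : exists r : seq Lam,
  forall p i' s t, btrip T p i' s t i -> dot s \in r.
Proof.
have [iS|/(tb_finite (t0 := T))[F hF]] := boolP (i \in tb_S T).
  have [F hF] := tb_lower_finite T (dot i); exists F => p i' s t hp.
  rewrite (bt_dot hp); apply: hF; case: hp => _ tS _ _ hy.
  by have [->|/ltW] := dot_Y tS iS hy.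
exists [seq dot s | s <- F] => p i' s t hp; rewrite (bt_dot hp).
by case: hp => _ tS _ _ hy; apply: map_f; apply: (hF _ tS).2; exists p.2.
Qed.

Variables (P : gmod A) (i : I) (n : int) (x0 : P) (sg : P -> A).
Hypothesis pr : presentation i n x0 sg.

Lemma weight_sub_axiom (G : pred Lam) : (forall x y, (x <= y)%O -> G y -> G x) ->
  gsub_axiom (fun p : P => bspan T (fun _ _ s _ _ => G (dot s)) (sg p)).
Proof.
move=> Glow; have lsg := pr_lin pr; split=> [|a p|d p h].
- split; first by rewrite (lin0 lsg); left.
  by move=> a u v hu hv; rewrite lsg; apply: in_span_closed.
- rewrite (pr_act pr); apply: (lin_span (ga_mulPr a)).
  move=> _ [q [i' [s [t [j [hq Gq ->]]]]]]; have [_ qs] := bt_x hq.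
  rewrite -qs -!ga_mulA [_ ** (1_[A]_s ** _)]ga_mulA [_ ** (_ ** 1_[A]_s ** _)]ga_mulA.
  rewrite [a ** (_ ** _)]ga_mulA.
  apply: bspan_mono (bspan_idem _ _ (bt_s hq)) => q' _ s' _ _ _ /Glow; exact.
by rewrite (sg_hproj pr); apply: bspan_hproj.
Qed.

(** The r-th step is the preimage under sg of the ideal spanned by the basis
    vectors whose weights lie below one of the first r weights.  If l is the
    next weight, the elements of the next step that lie in J P belong to the
    r-th step: a weight occurring in A 1_i that is smaller than l comes earlier
    in the list. *)
Lemma presentation_flag : alg_loc_fin_dim A -> alg_bounded_below A -> delta_flag T P.
Proof.
move=> A_lfd A_bb; have [r0 hr0] := finite_weights i.
have [ls [uls ls_r0] ls_lt] := linear_extension r0.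
pose G r (x : Lam) := has (fun m => x <= m)%O (take r ls).
have Glow r x y : (x <= y)%O -> G r y -> G r x.
  by move=> xy /hasP[m ml ym]; apply/hasP; exists m => //; apply: le_trans ym.
pose F r := mkgsub (weight_sub_axiom (Glow r)).
have FP r p : p \in F r <-> bspan T (fun _ _ s _ _ => G r (dot s)) (sg p).
  exact: mkgsubP.
have sgi p : bspan T (fun _ _ _ _ j => j = i) (sg p) by apply: bspan_r (pr_r pr p).
have dls q i' s t : btrip T q i' s t i -> dot s \in ls by move/hr0; rewrite ls_r0.
exists (size ls), F, (tnth (in_tuple ls)); split.
- split=> [p /FP h|p|r rn p /FP h].
  + suff s0 : sg p = 0 by rewrite -[p](pr_K pr) s0 gm_act0l.
    apply: (lin_span_eq0 (f := idfun) _ _ h) => // u [q [i' [s [t [j [_ + _]]]]]].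
    by rewrite /G take0.
  + apply/FP; apply: bspan_mono (sgi p) => q i' s t j hq e; rewrite e in hq.
    by rewrite /G take_size; apply/hasP; exists (dot s); [apply: dls hq|].
  + apply/FP; apply: bspan_mono h => q i' s t j _ /hasP[m ml sm]; apply/hasP.
    exists m => //; move: ml; rewrite (take_nth m)// mem_rcons inE => ->.
    by rewrite orbT.
- move=> a b; have y0 : Lam := tnth (in_tuple ls) a.
  by rewrite !(tnth_nth y0) => /eqP; rewrite nth_uniq// => /eqP/val_inj.
move=> r; set l := tnth _ r; exists (layer T pr l); split.
- exact: layer_projective.
- exact: layer_lfd.
- exact: layer_bb.
have rn : (r < size ls)%N := ltn_ord r.
have lE : l = nth l ls r by exact: tnth_nth.
have take_r x : G r.+1 x -> G r x \/ (x <= l)%O.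
  rewrite /G (take_nth l)// -lE => /hasP[m]; rewrite mem_rcons inE.
  by case/orP=> [/eqP->|mr] xm; [right|left; apply/hasP; exists m].
have before m : m \in take r ls -> exists2 a, (a < r)%N & m = nth l ls a.
  move=> /(nthP l)[a]; rewrite size_takel ?(ltnW rn)// => ar <-.
  by exists a => //; rewrite nth_take.
have not_above x : G r x -> ~~ (l <= x)%O.
  move=> /hasP[m /before[a ar ->] xm]; apply/negP => /le_trans/(_ xm).
  rewrite {1}lE le_eqVlt => /orP[|/ls_lt].
    by rewrite nth_uniq ?(ltn_trans ar)// => /eqP e; rewrite e ltnn in ar.
  by move=> /(_ (ltn_trans ar rn) rn); rewrite ltnNge ltnW.
have Gl : G r.+1 l.
  by apply/hasP; exists l => //; rewrite (take_nth l)// -lE mem_rcons mem_head.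
apply: section_layer.
- move=> w /FP wW; rewrite FP; split=> [h|/idealP wJ].
    by apply/idealP; apply: bspan_mono h => q i' s t j _ /not_above.
  have := bspan_cap (bspan_cap wW wJ) (sgi w).
  apply: bspan_mono => q i' s t j hq [[/take_r[//|sl] ls_] e]; rewrite e in hq.
  have /(nthP l)[c cn cE] := dls _ _ _ _ hq.
  have sl' : (nth l ls c < nth l ls r)%O.
    by rewrite cE -lE lt_neqAle sl andbT; apply: contraNneq ls_ => ->.
  have cr := ls_lt l r c rn cn sl'.
  by apply/hasP; exists (dot s) => //; rewrite -cE -(nth_take l cr) mem_nth// size_takel// ltnW.
- move=> w /FP wW.
  have lm := hom_lin (tmul_hom (ebar T l) (topd T pr l)).
  have lc := hom_lin (cls_hom T pr l).
  pose Q (a : A) := exists z : tensor (Ce (ebar T l)) (layer T pr l),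
    tmul z = cls T pr l (a *> x0) :> topq T pr l.
  suff [z hz] : Q (sg w) by exists z; rewrite hz (pr_K pr).
  apply: (in_span_ind_sub (Q := Q) _ _ wW).
    split; first by exists 0; rewrite (lin0 lm) gm_act0l (lin0 lc).
    move=> c a b [z hz] [z' hz']; exists (c *: z + z').
    by rewrite lm hz hz' gm_actDl gm_actZl lc.
  move=> _ [q [i' [s [t [j [hq Gs ->]]]]]].
  have [ls_|nls] := boolP (l <= dot s)%O; last first.
    exists 0; rewrite (lin0 lm); apply/esym/cls_eq0; rewrite (pr_act pr).
    by apply: ideal_mulr; apply: bt_lower hq nls.
  have sl : s \in tb_fib T l.
    rewrite fibP (bt_s hq) eq_le ls_ andbT.
    by case/take_r: Gs => // /not_above; rewrite ls_.
  exists (tens (M := Ce (ebar T l)) (ceof T l q.1.1) (qof T pr l (q.1.2 ** q.2))).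
  have [_ xs] := bt_x hq.
  rewrite tmul_tens val_lof -gm_actA (e_fib_r' sl xs) cls_act -gm_actA.
  by rewrite ga_mulA.
move=> a p; apply/FP; rewrite (pr_act pr) e_sum_r ga_sum_l.
apply: in_span_sum => s; rewrite fibP => /andP[sS /eqP sl].
apply: bspan_mono (bspan_idem a (sg p) sS) => q _ s' _ _ _; rewrite sl.
by move=> /Glow; apply.
Qed.

End Flag.

(** * Standard and costandard modules are locally finite-dimensional *)

Section FinGen.
Variable k : fieldType.

Lemma fin_gen_bilin (U V W : lmodType k) (P : U -> Prop) (Q : V -> Prop)
    (b : U -> V -> W) : (forall v, linear (b ^~ v)) -> (forall u, linear (b u)) ->
  fin_gen P -> fin_gen Q -> fin_gen (fun w => exists u v, [/\ P u, Q v & w = b u v]).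
Proof.
move=> bl br [s hs] [t ht]; exists [seq b u v | u <- s, v <- t].
move=> _ [u [v [/hs Pu /ht Qv ->]]].
apply: (lin_span (bl v) _ Pu) => u' us; apply: (lin_span (br u') _ Qv) => v' vt.
by apply/in_span1/allpairsP; exists (u', v').
Qed.

Lemma fin_gen_fun (V : lmodType k) n : fin_gen (fun _ : V => True) ->
  fin_gen (fun _ : 'I_n -> V => True).
Proof.
pose del (j : 'I_n) (v : V) : 'I_n -> V := fun j' => if j' == j then v else 0.
have dl j : linear (del j).
  move=> a u v; apply/funext => j'.
  rewrite -[RHS]/(a *: del j u j' + del j v j') /del.
  by case: eqP => // _; rewrite scaler0 addr0.
move=> Vf; have h j : j \in enum 'I_n -> fin_gen (fun f => exists2 v, True & f = del j v).
  by move=> _; apply: fin_gen_image (dl j) Vf _ => f [v]; exists v.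
apply: fin_gen_sub (fin_gen_sum h) => f _.
have -> : f = \sum_(j <- enum 'I_n) del j (f j).
  apply/funext => j; rewrite fct_sumE (bigD1_seq j) ?mem_enum ?enum_uniq//=.
  rewrite /del eqxx big1 ?addr0// => j' /negPf; by rewrite eq_sym => ->.
by apply: in_span_sum => j je; apply: in_span1; exists j => //; exists (f j).
Qed.
End FinGen.

Section Standard.
Variables (k : fieldType) (I : choiceType) (A : galg k I).
Variables (disp : Order.disp_t) (Lam : porderType disp) (T : tri_basis A Lam).
Variables (l : Lam) (V : gmod (A_at T l)).
Local Notation eb := (ebar T l).
Local Notation Sl := (tb_fib T l).

Local Notation shr := (j_shriek V).
Local Notation str := (j_star V).
Local Notation tns := (tens (M := Ce eb) (V := V)).

Lemma shriek_act a b v : gm_act shr a (tns (ceof T l b) v) = tns (ceof T l (a ** b)) v.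
Proof.
apply: etrans (tens_actE (M := Ce eb) (V := V) (geq T l a) (ceof T l b) v) _.
by congr tens; apply: ceof_act.
Qed.

Lemma shriek_span (z : shr) :
  in_span (fun w => exists a v, w = tns (ceof T l a) v) z.
Proof.
apply: in_span_mono (tens_span z) => _ [c [v ->]].
by have [a ->] := ceof_surj c; exists a, v.
Qed.

Lemma shriek_degP d (z : shr) : z \in gm_gr shr d ->
  in_span (fun w => exists e f a v, [/\ a \in ga_gr A e, v \in gm_gr V f, e + f = d &
    w = tns (ceof T l a) v]) z.
Proof.
move=> /subspaceP; apply: in_span_mono => _ [e [f [c [v [/ceof_rep[a ae ->] vf ef ->]]]]].
by exists e, f, a, v.
Qed.

Lemma shriek_hom e f a v : a \in ga_gr A e -> v \in gm_gr V f ->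
  tns (ceof T l a) v \in gm_gr shr (e + f).
Proof. by move=> /(ceof_hom T l) ae vf; apply: tens_hcomp_tens. Qed.

Definition ev (f : str) (a : A) : V := subm_val (f : coind_space (eC eb) V) (ecof T l a).

Lemma ev_lin_r f : linear (ev f).
Proof. by move=> c a b; rewrite /ev ecof_lin; apply: coind_linear. Qed.
Lemma ev_lin_l a : linear (ev^~ a).
Proof. by []. Qed.
Lemma ev_act a f b : ev (a *> f) b = ev f (b ** a).
Proof.
rewrite -[LHS]/(subm_val (f : coind_space (eC eb) V) (gb_act (eC eb) (ecof T l b) (geq T l a))).
by rewrite ecof_act.
Qed.
Lemma ev_inj f g : (forall a, ev f a = ev g a) -> f = g.
Proof.
move=> h; apply: val_inj; apply/funext => x; have [a ->] := ecof_surj x; exact: h.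
Qed.
Lemma ev_hom d f : f \in gm_gr str d ->
  is_hom (V := eC eb) (W := V) d (subm_val (f : coind_space (eC eb) V)).
Proof. by move=> /subspaceP. Qed.
Lemma ev_deg d e f a : f \in gm_gr str d -> a \in ga_gr A e -> ev f a \in gm_gr V (e + d).
Proof. by move=> /ev_hom/hom_deg h ae; apply/h/ecof_hom. Qed.
Lemma ev_al f a b : ev f (a ** e_ T l ** b) = alof T l a *> ev f b.
Proof.
have l2 : linear (fun f => alof T l a *> ev f b) by move=> c x y; apply: gm_actPr.
apply: (lin_span_eq (ev_lin_l _) l2 _ (hcomp_span (gm_gr str) f)) => g [d /ev_hom gd].
by rewrite /ev -ecofM (hom_act gd).
Qed.
Lemma ev_sum f a : ev f a = \sum_(s <- Sl) ev f (1_[A]_s ** a).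
Proof. by rewrite /ev ecof_sum (lin_sum (coind_linear f)). Qed.

Lemma ev_lift d i (v : A -> V) : linear v -> (forall a, ecof T l a = 0 -> v a = 0) ->
  (forall a b, v (a ** e_ T l ** b) = alof T l a *> v b) ->
  (forall e a, a \in ga_gr A e -> v a \in gm_gr V (e + d)) ->
  (forall a, v (a ** 1_[A]_i) = v a) ->
  exists2 f : str, f \in gm_gr str d & forall a, ev f a = v a.
Proof.
move=> lv v0 vM vd vi.
have ecs (x : eC eb) : exists a, ecof T l a = x by have [a ->] := ecof_surj x; exists a.
have [h [lh hE]] := factor_lin (ecof_lin T l) lv ecs v0.
have hh : is_hom (V := eC eb) (W := V) d h.
  split=> // [a x|e x /ecof_rep[b be ->]]; last by rewrite hE; apply: vd.
  by have [b ->] := alof_surj a; have [y <-] := ecs x; rewrite ecofM !hE vM.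
have fin : h \in coind_sub (eC eb) V.
  apply/subspaceP/in_span1; exists d, i; split=> // x; have [y <-] := ecs x.
  by rewrite -geq_idem ecof_act !hE vi.
by exists (Subm fin); [apply/subspaceP|apply: hE].
Qed.

Variable r : seq int.
Hypothesis V_supp : forall d, d \notin r -> forall v, v \in gm_gr V d -> v = 0.
Hypothesis V_fg : fin_gen (fun _ : V => True).
Hypothesis A_lfd : alg_loc_fin_dim A.

(** The degree d part of 1_i j_! V is spanned by the tensors of vectors of
    (1_i A 1_s)_(d - f) and V_f, with f in the support of V. *)
Lemma shriek_lfd : loc_fin_dim shr.
Proof.
move=> i d; apply: fin_dim_gen; first exact: idem_mod_axiom.
apply: (fin_gen_sub (Q := fun w : shr => exists2 sf : I * int,
    sf \in [seq (s, f) | s <- Sl, f <- r] & exists a v,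
    [/\ a \in ga_gr A (d - sf.2) /\ 1_[A]_i ** a ** 1_[A]_sf.1 = a, True &
        w = tns (ceof T l a) v])).
  move=> z [/shriek_degP zd iz]; rewrite -iz.
  apply: (lin_span (gm_actPr (g := shr) _) _ zd) => _ [e [f [a [v [ae vf ef ->]]]]].
  rewrite shriek_act; have [fr|/V_supp h] := boolP (f \in r); last first.
    by rewrite (h v vf) tens0r; left.
  rewrite ceof_sum (lin_sum (tensPl (M := Ce eb) v)).
  apply: in_span_sum => s sl; apply: in_span1; exists (s, f).
    by apply/allpairsP; exists (s, f).
  exists (1_[A]_i ** a ** 1_[A]_s), v; split=> //=.
  by rewrite -ef addrK; apply: sandwich_hom.
apply: fin_gen_sum => -[s f] _ /=; apply: fin_gen_bilin V_fg.
- by move=> v c a b; rewrite ceof_lin tensPl.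
- by move=> a; apply: tensPr.
exact: fin_gen_dim (A_lfd i s (d - f)).
Qed.

(** An element of degree d of 1_i j_* V is determined by its values on the
    finitely many degrees e of 1_s A 1_i with e + d in the support of V. *)
Lemma star_lfd : loc_fin_dim str.
Proof.
move=> i d.
have [|bs hbs] := @fin_gen_sum k A _ [seq (s, f) | s <- Sl, f <- r]
    (fun sf a => a \in ga_gr A (sf.2 - d) /\ 1_[A]_sf.1 ** a ** 1_[A]_i = a).
  by move=> [s f] _; apply: fin_gen_dim (A_lfd s i (f - d)).
pose Phi (f : str) : 'I_(size bs) -> V := fun j => ev f (nth 0 bs j).
apply: (fin_dim_inj (f := Phi) _ _ (fin_gen_fun (size bs) V_fg)) => //.
  exact: idem_mod_axiom.
move=> f [fd jf] Phi0; apply: ev_inj => a.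
suff: ev f a = 0 by move->.
rewrite -jf ev_act.
have l1 : linear (fun a => ev f (a ** 1_[A]_i)) by move=> c x y; rewrite ga_mulPl ev_lin_r.
apply: (lin_span_eq0 l1 _ (hcomp_span (ga_gr A) a)) => {}a [e ae].
rewrite ev_sum big_seq big1// => s sl; rewrite ga_mulA.
have [ae' ase] := sandwich_hom s i ae.
have [fr|/V_supp] := boolP (e + d \in r); last by apply; apply: ev_deg fd ae'.
apply: (lin_span_eq0 (ev_lin_r f) _ (hbs _ _)); last first.
  exists (s, e + d); first by apply/allpairsP; exists (s, e + d).
  by rewrite /= addrK.
move=> b bb; have bn : (index b bs < size bs)%N by rewrite index_mem.
by have := congr1 (fun g => g (Ordinal bn)) Phi0; rewrite /Phi /= nth_index.
Qed.

End Standard.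

Lemma irr_standard_lfd (k : fieldType) (I : choiceType) (A : galg k I)
    (disp : Order.disp_t) (Lam : porderType disp) (T : tri_basis A Lam) (l : Lam)
    (V : gmod (A_at T l)) : alg_loc_fin_dim A -> alg_bounded_below A -> irreducible V ->
  loc_fin_dim (j_shriek V) /\ loc_fin_dim (j_star V).
Proof.
move=> A_lfd A_bb irrV; have bb := @A_at_bb _ _ _ _ _ T l A_bb.
have [r hr] := irr_unital_supp bb irrV.
have fg := irr_unital_fin_gen (@A_at_lfd _ _ _ _ _ T l A_lfd) bb irrV.
by split; [apply: shriek_lfd hr fg A_lfd|apply: star_lfd hr fg A_lfd].
Qed.

(** * Duality *)

Section Dual.
Variables (k : fieldType) (I : choiceType) (A : galg k I).

Lemma duality_inv (t : duality A) : exists t' : duality A, cancel t' t /\ cancel t t'.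
Proof.
have [g gK Kg] := tau_bij t; have inj := can_inj gK.
have gl : linear g by move=> a u v; apply: inj; rewrite (tau_linear t) !Kg.
have gb : bijective g by exists t.
have gm a b : g (a ** b) = g b ** g a by apply: inj; rewrite (tau_mul t) !Kg.
have gh d a : a \in ga_gr A d -> g a \in ga_gr A d.
  move=> ad; suff -> : g a = hproj (ga_gr A) d (g a) by exact: hproj_mem.
  have th m u : u \in ga_gr A m -> t u \in ga_gr A (m + 0).
    by rewrite addr0; apply: tau_hom.
  by apply: inj; rewrite (hproj_comm _ _ (tau_linear t) th) addr0 !Kg hproj_id.
have gi i : g 1_[A]_i = 1_[A]_i by apply: inj; rewrite Kg (tau_idem t).
by exists (Duality gl gb gm gh gi).
Qed.

Variables (t : duality A) (V : gmod A).

Definition ap (f : gdual t V) (v : V) : k^o :=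
  subm_val (f : coind_space (twist t V) (kmod (kgr k))) v.

Lemma ap_lin_r f : linear (ap f).
Proof. exact: (coind_linear (f : coind_space (twist t V) (kmod (kgr k)))). Qed.
Lemma ap_act a f v : ap (a *> f) v = ap f (t a *> v). Proof. by []. Qed.
Lemma ap_inj f : (forall v, ap f v = 0) -> f = 0.
Proof. by move=> h; apply: val_inj; apply/funext. Qed.
Lemma ap_deg d m f v : f \in gm_gr (gdual t V) d -> v \in gm_gr V m ->
  m + d <> 0 -> ap f v = 0.
Proof. by move=> /subspaceP[_ _ h] /h /subspaceP[]. Qed.
Lemma ap_hproj d f v : f \in gm_gr (gdual t V) d ->
  ap f v = ap f (hproj (gm_gr V) (- d) v).
Proof.
move=> fd; have l2 : linear (fun v => ap f (hproj (gm_gr V) (- d) v)).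
  by move=> a x y; rewrite linearP ap_lin_r.
apply: (lin_span_eq (ap_lin_r f) l2 _ (hcomp_span (gm_gr V) v)) => u [m um].
rewrite (hproj_hom _ um); case: eqP => // md.
rewrite (lin0 (ap_lin_r f)); apply: ap_deg fd um _ => /eqP; rewrite addr_eq0.
by move=> /eqP mE; apply: md.
Qed.

(** Functionals on the finite-dimensional space 1_i V_d extend by 0. *)
Lemma gdual_separate i d v : loc_fin_dim V -> 1_[A]_i *> hproj (gm_gr V) d v <> 0 ->
  exists2 f : gdual t V, f \in gm_gr (gdual t V) (- d) & ap f v <> 0.
Proof.
move=> Vf pv; pose p v := 1_[A]_i *> hproj (gm_gr V) d v.
have lp : linear p by move=> a x y; rewrite /p linearP gm_actPr.
have pP u : p u \in gm_gr V d /\ 1_[A]_i *> p u = p u.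
  by split; [apply/act_idem_hom/hproj_mem|rewrite -gm_actA ga_idem_idem].
have [f [lf fv f0]] := dim_separate lp pP (Vf i d) pv.
have fp u : f (1_[A]_i *> u) = f u.
  apply/eqP; rewrite -subr_eq0 -(linB lf); apply/eqP/f0.
  by rewrite (linB lp) /p -act_idem_hproj -gm_actA ga_idem_idem subrr.
have hf : is_hom (V := twist t V) (W := kmod (kgr k)) (- d) f.
  split=> // [a u|m u um]; first by rewrite [LHS](linZ lf).
  apply/subspaceP; have [->|/eqP md] := eqVneq m d; [by left; rewrite subrr|right].
  by apply: f0; rewrite /p (hproj_hom _ um) eq_sym (negPf (introN eqP md)) gm_act0r.
have fin : f \in coind_sub (twist t V) (kmod (kgr k)).
  apply/subspaceP/in_span1; exists (- d), i; split=> // u.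
  by rewrite /= (tau_idem t) fp.
by exists (Subm fin) => //; apply/subspaceP.
Qed.

Lemma comp_neq0 (v : V) : v <> 0 -> exists i d, 1_[A]_i *> hproj (gm_gr V) d v <> 0.
Proof.
move=> /(@hproj_neq0 _ _ (gm_gr V))[d vd]; have [s [_ e]] := gm_unital_seq (hproj (gm_gr V) d v).
apply: contrapT => h; apply: vd; rewrite e big1// => i _.
by apply: contrapT => hi; apply: h; exists i, d.
Qed.

Lemma gdual_separates v : loc_fin_dim V -> v <> 0 -> exists f : gdual t V, ap f v <> 0.
Proof.
move=> Vf /comp_neq0[i [d h]]; have [f _ fv] := gdual_separate Vf h.
by exists f.
Qed.
End Dual.

(** ** The top weight space of the simple head *)

Section WeightSpace.
Variables (k : closedFieldType) (I : choiceType) (A : galg k I).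
Variables (disp : Order.disp_t) (Lam : porderType disp) (T : tri_basis A Lam).
Variables (l : Lam) (M Pm : gmod (A_at T l)) (L : gmod A).
Local Notation e := (e_ T l).
Local Notation eb := (ebar T l).

(** Such an iota is an isomorphism of A_l-modules between M and e_l L. *)
Record weight_space (iota : M -> L) : Prop := {
  ws_lin : linear iota;
  ws_act : forall a m, iota (alof T l a *> m) = (e ** a ** e) *> iota m;
  ws_deg : forall d m, m \in gm_gr M d -> iota m \in gm_gr L d;
  ws_inj : forall m, iota m = 0 -> m = 0;
  ws_e : forall m, e *> iota m = iota m;
  ws_surj : forall w, exists m, iota m = e *> w }.

Hypotheses (irrM : irreducible M) (irrL : irreducible L).
Variables (pm : Pm -> M) (hpm : is_hom 0 pm) (spm : surj pm).
Hypothesis pm_cover :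
  forall U : gsub Pm, (forall x, exists2 u, u \in U & pm (x - u) = 0) ->
    forall x, x \in U.
Variables (q : j_shriek Pm -> L) (hq : is_hom 0 q) (sq : surj q).

Local Notation tns := (tens (M := Ce eb) (V := Pm)).

(** The kernels of Pm -> M and of Pm -> e_l L, u |-> q(e_l (x) u), are both
    the largest proper graded submodule of Pm. *)
Lemma weight_space_exists : exists iota, weight_space iota.
Proof.
pose pi u := q (tns (ceof T l e) u).
have lpi : linear pi by move=> c u v; rewrite /pi tensPr (hom_lin hq).
have piE a u : q (tns (ceof T l a) u) = a *> pi u.
  by rewrite /pi -(hom_act hq) shriek_act ceof_r.
have pi_act a u : pi (alof T l a *> u) = (e ** a ** e) *> pi u.
  by rewrite {1}/pi -tens_bal ceofM e_mul -piE ceof_r.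
have pi_e u : e *> pi u = pi u by rewrite -piE.
have pi_deg d u : u \in gm_gr Pm d -> pi u \in gm_gr L (d + 0).
  move=> ud; apply: (hom_deg hq).
  by have := shriek_hom (e_hom T l) ud; rewrite add0r.
have piN0 : ~ forall u, pi u = 0.
  move=> pi0; have [[w w0] _] := irrL; apply: w0; have [z <-] := sq w.
  apply: (lin_span_eq0 (hom_lin hq) _ (shriek_span z)) => _ [a [u ->]].
  by rewrite piE pi0 gm_act0r.
have kpi : gsub_axiom (fun u => pi u = 0).
  split=> [|a u h|d u h].
  - split=> [|c u v hu hv]; first exact: lin0.
    by rewrite lpi hu hv scaler0 addr0.
  - by have [b ->] := alof_surj a; rewrite pi_act h gm_act0r.
  by rewrite (hproj_comm _ _ lpi pi_deg) h linear0.
have pi_pm u : pi u = 0 -> pm u = 0.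
  move=> pu; apply: contrapT => pmu; apply: piN0.
  exact: (cover_max irrM hpm pm_cover kpi pu pmu).
have pm_pi_hom d u : u \in gm_gr Pm d -> pm u = 0 -> pi u = 0.
  move=> ud pmu; apply: contrapT => piu.
  have [u' pmu'] := cover_neq0 irrM spm; apply: pmu'.
  have [a ha] := irr_gen (pi u') irrL (pi_deg _ _ ud) piu.
  have : pi (u' - alof T l a *> u) = 0.
    by rewrite (linB lpi) pi_act -ga_mulA !gm_actA pi_e -ha pi_e subrr.
  move=> /pi_pm; rewrite (linB (hom_lin hpm)) (hom_act hpm) pmu gm_act0r.
  by rewrite subr0.
have pm_pi u : pm u = 0 -> pi u = 0.
  move=> pmu; rewrite [u](hproj_sum (gm_gr Pm)) (lin_sum lpi) big1// => d _.
  by apply: pm_pi_hom (hproj_mem _ _ _) _; rewrite (hom_hproj hpm) pmu linear0.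
have [iota [li iE]] := factor_lin (hom_lin hpm) lpi spm pm_pi.
exists iota; split=> // [a m|d m md|m|m|w].
- by have [u <-] := spm m; rewrite -(hom_act hpm) !iE pi_act.
- have [u um] := spm m; rewrite -um in md *.
  have -> : pm u = pm (hproj (gm_gr Pm) d u) by rewrite (hom_hproj hpm) addr0 hproj_id.
  by rewrite iE; have := pi_deg _ _ (hproj_mem (gm_gr Pm) d u); rewrite addr0.
- by have [u <-] := spm m; rewrite iE => /pi_pm.
- by have [u <-] := spm m; rewrite iE pi_e.
have [z <-] := sq w; elim: {z}(shriek_span z) => [|c _ z [a [u ->]] _ [m hm]].
  by exists 0; rewrite (lin0 li) (lin0 (hom_lin hq)) gm_act0r.
exists (c *: pm (alof T l a *> u) + m).
rewrite li hm iE pi_act (hom_lin hq) gm_actDr gm_actZr piE.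
by rewrite -(ga_mulA e a e) !gm_actA pi_e.
Qed.
End WeightSpace.

(** ** The pairing of standard and costandard modules *)

Section Represent.
Variables (k : fieldType) (V : lmodType k) (B : V -> V -> k).
Hypotheses (Bl : forall v, linear (B^~ v : V -> k^o)) (Br : forall u, linear (B u : V -> k^o)).
Hypothesis Bnd : forall v, (forall u, B u v = 0) -> v = 0.

(** The Gram matrix of B in a basis of V is invertible. *)
Lemma form_represent n (f : V -> k^o) : has_dim (fun _ : V => True) n -> linear f ->
  exists v, forall u, B u v = f u.
Proof.
move=> [b [_ bI bS]] lf.
pose G := \matrix_(j < n, i < n) B (b i) (b j).
pose cmb (r : 'rV[k]_n) := \sum_j r 0 j *: b j.
have Bc r i : B (b i) (cmb r) = (r *m G) 0 i.
  rewrite (lin_sum (Br (b i))) mxE; apply: eq_bigr => j _.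
  by rewrite (linZ (Br (b i))) mxE.
have Beq v (g : V -> k^o) : linear g -> (forall i, B (b i) v = g (b i)) ->
    forall u, B u v = g u.
  move=> lg h u; have [c ->] := bS u Logic.I.
  rewrite (lin_sum (Bl v)) (lin_sum lg); apply: eq_bigr => i _.
  by rewrite (linZ (Bl v)) (linZ lg) h.
have Gu : G \in unitmx.
  rewrite -row_free_unit -kermx_eq0; apply/negPn/negP => /rowV0Pn[r /sub_kermxP rG /eqP r0].
  apply: r0; apply/rowP => j; rewrite [RHS]mxE; apply: (bI (fun j => r 0 j)).
  apply: Bnd; apply: (Beq _ (fun=> 0)).
    by move=> a x y; rewrite scaler0 addr0.
  by move=> i; rewrite Bc rG mxE.
exists (cmb (\row_i f (b i) *m invmx G)); apply: (Beq _ _ lf) => i.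
by rewrite Bc -mulmxA mulVmx// mulmx1 mxE.
Qed.
End Represent.

Section Pairing.
Variables (k : closedFieldType) (I : choiceType) (A : galg k I).
Variables (disp : Order.disp_t) (Lam : porderType disp) (T : tri_basis A Lam).
Variables (t t' : duality A) (t'K : cancel t' t) (tK : cancel t t').
Variables (l : Lam) (M : gmod (A_at T l)) (L : gmod A).
Variables (iota : M -> L) (ws : weight_space iota).
Variables (c : int) (psi : gshift c L -> gdual t L).
Hypotheses (hpsi : is_hom 0 psi) (psi_inj : forall w, psi w = 0 -> w = 0).
Hypothesis psi_surj : surj psi.
Hypothesis L_lfd : loc_fin_dim L.

Local Notation e := (e_ T l).
Local Notation eb := (ebar T l).
Local Notation shr := (j_shriek M).
Local Notation str := (j_star M).
Local Notation tns := (tens (M := Ce eb) (V := M)).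

Lemma tau_e (s : duality A) : s e = e.
Proof. by rewrite /e_ (lin_sum (tau_linear s)); apply: eq_bigr => i _; rewrite tau_idem. Qed.

Lemma tau_ideal (s : duality A) a : a \in ideal T l -> s a \in ideal T l.
Proof.
move=> /subspaceP aJ; apply/subspaceP; move: aJ.
apply: (lin_span (tau_linear s)) => _ [m [x [y [lm ->]]]].
apply: in_span1; exists m, (s y), (s x); split=> //.
rewrite !tau_mul; have -> : s (e_ T m) = e_ T m.
  by rewrite /e_ (lin_sum (tau_linear s)); apply: eq_bigr => i _; rewrite tau_idem.
by rewrite ga_mulA.
Qed.

Lemma ceof_ecof (s : duality A) a : ceof T l a = 0 -> ecof T l (s a) = 0.
Proof.
move=> /(congr1 (@subm_val _ _ _)); rewrite val_ceof -geq_e geqM => /geq_eq0 aJ.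
by rewrite -ecof_l -{1}(tau_e s) -tau_mul ecof_eq0// tau_ideal.
Qed.
Lemma ecof_ceof (s : duality A) a : ecof T l a = 0 -> ceof T l (s a) = 0.
Proof.
move=> /(congr1 (@subm_val _ _ _)); rewrite val_ecof -geq_e geqM => /geq_eq0 aJ.
by rewrite -ceof_r -{1}(tau_e s) -tau_mul ceof_eq0// tau_ideal.
Qed.

(** An isomorphism of L with its graded dual is a contravariant form on L; its
    restriction to e_l L = M is again nondegenerate, as t fixes e_l. *)
Definition form (u v : M) : k := ap (psi (iota u)) (iota v).

Let li : linear iota := ws_lin ws.
Let lpsi : linear psi := hom_lin hpsi.

Lemma form_l v : linear (form^~ v : M -> k^o).
Proof. by move=> a x y; rewrite /form li lpsi. Qed.
Lemma form_r u : linear (form u : M -> k^o).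
Proof. by move=> a x y; rewrite /form li ap_lin_r. Qed.
Lemma form_act a u v : form (alof T l a *> u) v = form u (alof T l (t a) *> v).
Proof.
rewrite /form !(ws_act ws); have -> := hom_act hpsi (e ** a ** e) (iota u).
by rewrite ap_act !tau_mul tau_e ga_mulA.
Qed.

Lemma psi_deg d w : w \in gm_gr L d -> psi w \in gm_gr (gdual t L) (d + c).
Proof.
move=> wd; rewrite -[d + c]addr0; apply: (hom_deg hpsi).
by rewrite /= addrK.
Qed.

Lemma form_deg f g u v : u \in gm_gr M f -> v \in gm_gr M g -> f + c + g <> 0 ->
  form u v = 0.
Proof.
move=> /(ws_deg ws)/psi_deg uf /(ws_deg ws) vg fg.
by apply: ap_deg uf vg _; rewrite addrC.
Qed.

Lemma form_hproj f u v : u \in gm_gr M f ->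
  form u v = form u (hproj (gm_gr M) (- f - c) v).
Proof.
move=> uf; have l2 : linear (fun v => form u (hproj (gm_gr M) (- f - c) v) : k^o).
  by move=> a x y; rewrite linearP form_r.
apply: (lin_span_eq (form_r u) l2 _ (hcomp_span (gm_gr M) v)) => {}v [g vg].
rewrite (hproj_hom _ vg); case: eqP => // ne.
rewrite (lin0 (form_r u)); apply: form_deg uf vg _ => h; apply: ne.
by apply/eqP; rewrite -subr_eq0 -oppr_eq0 -h; apply/eqP; lia.
Qed.

Lemma form_nd_r v : (forall u, form u v = 0) -> v = 0.
Proof.
move=> h; apply: (ws_inj ws); apply: contrapT => iv0.
have [f] := gdual_separates t L_lfd iv0; apply.
have [w <-] := psi_surj f; rewrite -(ws_e ws) -{1}(tau_e t) -ap_act.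
have <- := hom_act hpsi e w; have -> : gm_act (gshift c L) e w = gm_act L e w by [].
by have [m <-] := ws_surj ws w; apply: h.
Qed.

Let rep (x : Ce eb) : A := projT1 (cid (ceof_surj x)).
Let repK x : ceof T l (rep x) = x. Proof. by rewrite /rep; case: cid. Qed.

(** The pairing is < a e (x) u, phi > = form u (phi (t a)), computed on
    representatives a in A; the choice does not matter as t preserves J. *)
Let prd (phi : str) (x : Ce eb) (u : M) : k^o := form u (ev phi (t (rep x))).
Let prdE phi a u : prd phi (ceof T l a) u = form u (ev phi (t a)).
Proof.
rewrite /prd; congr form; apply/eqP; rewrite -subr_eq0 -(linB (ev_lin_r phi)).
rewrite -(linB (tau_linear t)); apply/eqP.
by rewrite /ev ceof_ecof ?(lin0 (coind_linear phi))// (linB (ceof_lin T l)) repK subrr.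
Qed.
Let prd_l phi u : linear (prd phi ^~ u).
Proof.
move=> a x y; rewrite -[x]repK -[y]repK -ceof_lin !prdE (tau_linear t) ev_lin_r.
exact: form_r.
Qed.
Let prd_r phi x : linear (prd phi x).
Proof. by move=> a u v; apply: form_l. Qed.
Let prd_b phi x b u : prd phi (x <* b) u = prd phi x (b *> u).
Proof.
have [a ->] := alof_surj b; rewrite -[x]repK ceofM !prdE form_act; congr form.
by rewrite !tau_mul tau_e ga_mulA ev_al.
Qed.

Definition pair (z : shr) (phi : str) : k^o :=
  tens_lift (Balanced (prd_l phi) (prd_r phi) (prd_b phi)) z.

Lemma pairE a u phi : pair (tns (ceof T l a) u) phi = form u (ev phi (t a)).
Proof. by rewrite /pair tens_liftE; apply: prdE. Qed.
Lemma pair_l phi : linear (pair^~ phi). Proof. exact: tens_lift_linear. Qed.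
Lemma pair_r z : linear (pair z).
Proof.
move=> a f g; have l2 : linear (fun z => a *: pair z f + pair z g).
  move=> b x y; rewrite !pair_l !scalerDr !scalerA [b * a]mulrC.
  by rewrite addrACA.
apply: (lin_span_eq (pair_l _) l2 _ (shriek_span z)) => _ [b [u ->]].
by rewrite !pairE ev_lin_l; apply: form_r.
Qed.
Lemma pair_act a z phi : pair (a *> z) phi = pair z (t a *> phi).
Proof.
have l1 : linear (fun z => pair (a *> z) phi).
  by move=> b x y; rewrite gm_actPr pair_l.
apply: (lin_span_eq l1 (pair_l _) _ (shriek_span z)) => _ [b [u ->]].
by rewrite shriek_act !pairE tau_mul ev_act.
Qed.

Lemma pair_deg d d' z phi : z \in gm_gr shr d -> phi \in gm_gr str d' ->
  d + d' + c <> 0 -> pair z phi = 0.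
Proof.
move=> /shriek_degP zd pd ne; apply: (lin_span_eq0 (pair_l phi) _ zd).
move=> _ [f [g [a [u [af ug fg ->]]]]]; rewrite pairE.
apply: (form_deg ug (ev_deg pd (tau_hom t af))) => h; apply: ne.
by rewrite -h -fg; lia.
Qed.

Lemma pair_nd_r phi : (forall z, pair z phi = 0) -> phi = 0.
Proof.
move=> h; apply: ev_inj => a; rewrite -[a]t'K; apply: form_nd_r => u.
by rewrite -pairE.
Qed.

Hypotheses (shr_lfd : loc_fin_dim shr) (M_fd : fin_dim (fun _ : M => True)).

(** A functional on 1_i of the degree d part of the standard module is of the
    form < -, phi >: the value of phi at t a is found by representing the
    functional u |-> zeta (a e (x) u) of M through the form. *)
Lemma pair_nd_l d z : z \in gm_gr shr d ->
  (forall phi, phi \in gm_gr str (- d - c) -> pair z phi = 0) -> z = 0.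
Proof.
move=> zd h; apply: contrapT => z0; have [n Mn] := M_fd.
have [i iz] : exists i, 1_[A]_i *> z <> 0.
  have [s [_ e0]] := gm_unital_seq z; apply: contrapT => hi; apply: z0.
  by rewrite e0 big1// => i _; apply: contrapT => ?; apply: hi; exists i.
pose p (w : shr) : shr := 1_[A]_i *> hproj (gm_gr shr) d w.
have lp : linear p by move=> a x y; rewrite /p linearP gm_actPr.
have pP w : p w \in gm_gr shr d /\ 1_[A]_i *> p w = p w.
  by split; [apply/act_idem_hom/hproj_mem|rewrite -gm_actA ga_idem_idem].
have pz : p z <> 0 by rewrite /p hproj_id.
have [zeta [lz zz z_p]] := dim_separate lp pP (shr_lfd i d) pz.
have rp a : exists v : M, forall u, form u v = zeta (tns (ceof T l (t' a)) u).
  apply: (form_represent form_l form_r form_nd_r Mn).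
  by move=> b x y; rewrite tensPr lz.
pose v a := projT1 (cid (rp a)).
have vE a u : form u (v a) = zeta (tns (ceof T l (t' a)) u).
  by rewrite /v; case: cid.
have fm_inj x y : (forall u, form u x = form u y) -> x = y.
  move=> hxy; apply/eqP; rewrite -subr_eq0; apply/eqP/form_nd_r => u.
  by rewrite (linB (form_r u)) hxy subrr.
have zi w : zeta (1_[A]_i *> w) = zeta w.
  apply/eqP; rewrite -subr_eq0 -(linB lz); apply/eqP/z_p.
  by rewrite (linB lp) /p -act_idem_hproj -gm_actA ga_idem_idem subrr.
have lv : linear v.
  move=> a x y; apply: fm_inj => u.
  rewrite (form_r u) !vE (tau_linear t') ceof_lin tensPl.
  exact: lz.
have v0 a : ecof T l a = 0 -> v a = 0.
  move=> /(ecof_ceof t') h0; apply: form_nd_r => u.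
  by rewrite vE h0 tens0l (lin0 lz).
have vM a b : v (a ** e ** b) = alof T l a *> v b.
  apply: fm_inj => u; rewrite vE !tau_mul tau_e ga_mulA -ceofM tens_bal -vE.
  by rewrite form_act t'K.
have vi a : v (a ** 1_[A]_i) = v a.
  by apply: fm_inj => u; rewrite !vE tau_mul tau_idem -shriek_act zi.
have vd m a : a \in ga_gr A m -> v a \in gm_gr M (m + (- d - c)).
  move=> am; set g := m + _.
  suff -> : v a = hproj (gm_gr M) g (v a) by exact: hproj_mem.
  apply: fm_inj => u.
  apply: (lin_span_eq (form_l _) (form_l _) _ (hcomp_span (gm_gr M) u)) => {}u [f uf].
  have [fg|fg] := eqVneq (f + c + g) 0.
    rewrite (form_hproj _ uf); congr (form _ (hproj _ _ _)).
    by apply/eqP; rewrite -subr_eq0 -oppr_eq0 -fg; apply/eqP; lia.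
  rewrite (form_deg uf (hproj_mem _ _ _) (elimN eqP fg)) vE; apply: z_p.
  have := shriek_hom (tau_hom t' am) uf; rewrite /p => /(hproj_hom d)->.
  case: eqP => [e0|_]; last exact: gm_act0r.
  by case/eqP: fg; rewrite /g e0; lia.
have [phi phid phiE] := ev_lift lv v0 vM vd vi.
apply: zz; rewrite -(h phi phid); apply/esym.
apply: (lin_span_eq (pair_l _) lz _ (shriek_span z)) => _ [b [u ->]].
by rewrite pairE phiE vE tK.
Qed.
End Pairing.

(** * Twisted generators and the comparison of multiplicities *)

Section Compare.
Variables (k : closedFieldType) (I : choiceType) (A : galg k I).
Variables (P L : gmod A) (i : I) (n : int) (x0 : P) (sg : P -> A).
Hypothesis pr : presentation i n x0 sg.
Hypotheses (irrL : irreducible L) (L_lfd : loc_fin_dim L).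
Variables (p : P -> L) (hp : is_hom 0 p) (sp : surj p).
Hypothesis p_cover :
  forall U : gsub P, (forall x, exists2 u, u \in U & p (x - u) = 0) ->
    forall x, x \in U.
Local Notation eps := (sg x0).

Lemma eps_hom : eps \in ga_gr A 0.
Proof. by have := pr_deg pr (pr_hom pr); rewrite subrr. Qed.
Lemma eps_idem : eps ** eps = eps.
Proof. by rewrite -(pr_act pr) (pr_K pr). Qed.

Lemma px0_neq0 : p x0 <> 0.
Proof.
move=> h; have [y py] := cover_neq0 irrL sp; apply: py.
by rewrite -(pr_K pr y) (hom_act hp) h gm_act0r.
Qed.

(** Apply f to a lift of w to P: the result is not in ker p, the largest
    proper graded submodule, so it generates P. *)
Lemma twisted_generator (f : A) m w : f \in ga_gr A 0 -> f ** f = f ->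
  w \in gm_gr L m -> f *> w <> 0 ->
  exists w0 : P, [/\ w0 \in gm_gr P m, f *> w0 = w0 & forall y, exists a, y = a *> w0].
Proof.
move=> f0 ff wm fw; have [x px] := sp w; pose w0 := f *> hproj (gm_gr P) m x.
have w0m : w0 \in gm_gr P m by rewrite -[m]add0r gm_act_hom ?add0r ?hproj_mem.
exists w0; split=> //; first by rewrite /w0 -gm_actA ff.
apply: (cover_gen irrL hp p_cover w0m).
by rewrite /w0 (hom_act hp) (hom_hproj hp) px addr0 hproj_id.
Qed.

Lemma act_hproj0 (V : gmod A) f d (v : V) : f \in ga_gr A 0 ->
  f *> hproj (gm_gr V) d v = hproj (gm_gr V) d (f *> v).
Proof.
move=> f0; have hf m u : u \in gm_gr V m -> f *> u \in gm_gr V (m + 0).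
  by move=> um; rewrite addrC; apply: gm_act_hom.
by rewrite (hproj_comm d v (gm_actPr f) hf) addr0.
Qed.

Section Twist.
Variables (t t' : duality A) (t'K : cancel t' t) (tK : cancel t t').
Variables (c : int) (psi : gshift c L -> gdual t L).
Hypotheses (hpsi : is_hom 0 psi) (psi_inj : forall w, psi w = 0 -> w = 0).
Hypothesis psi_surj : surj psi.

Let eps_v : eps *> p x0 = p x0.
Proof. by rewrite -(hom_act hp) (pr_K pr). Qed.
Let v_n : p x0 \in gm_gr L n.
Proof. by rewrite -[n]addr0 (hom_deg hp)// (pr_hom pr). Qed.

(** The functional psi (p x0) is fixed by eps, so it takes a nonzero value on
    the image of t eps. *)
Lemma tau_generator : exists w0 : P, [/\ w0 \in gm_gr P (- n - c), t eps *> w0 = w0 &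
  forall y, exists a, y = a *> w0].
Proof.
have [w fw] : exists w, ap (psi (p x0)) w <> 0.
  apply: contrapT => h; apply/px0_neq0/psi_inj/ap_inj => w.
  by apply: contrapT => hw; apply: h; exists w.
have fd := psi_deg hpsi v_n.
have ft : ap (psi (p x0)) (t eps *> w) = ap (psi (p x0)) w.
  by rewrite -ap_act; have <- := hom_act hpsi eps (p x0); rewrite /= eps_v.
apply: (twisted_generator (w := hproj (gm_gr L) (- n - c) w)).
- exact/tau_hom/eps_hom.
- by rewrite -tau_mul eps_idem.
- exact: hproj_mem.
rewrite act_hproj0; last exact/tau_hom/eps_hom.
move=> h; apply: fw; rewrite -ft (ap_hproj _ fd) opprD h.
exact: lin0 (ap_lin_r _).
Qed.

(** A functional f on L that does not vanish at p x0 = t (t' eps) (p x0) is not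
    killed by t' eps, and f = psi w for some w. *)
Lemma tau_inv_generator : exists w0 : P, [/\ w0 \in gm_gr P (- n - c),
  t' eps *> w0 = w0 & forall y, exists a, y = a *> w0].
Proof.
have pv : 1_[A]_i *> hproj (gm_gr L) n (p x0) <> 0.
  rewrite (hproj_id v_n) -(hom_act hp) (pr_idem pr); exact: px0_neq0.
have [f fd fv] := gdual_separate t L_lfd pv.
have [w wf] := psi_surj f.
apply: (twisted_generator (w := hproj (gm_gr L) (- n - c) w)).
- exact/tau_hom/eps_hom.
- by rewrite -tau_mul eps_idem.
- exact: hproj_mem.
have pf : psi (hproj (gm_gr L) (- n - c) w) = f.
  have -> : hproj (gm_gr L) (- n - c) w = hproj (gm_gr (gshift c L)) (- n) w.
    have l1 : linear (hproj (gm_gr L) (- n - c)) by exact: linearP.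
    have l2 : linear (hproj (gm_gr (gshift c L)) (- n)) by exact: linearP.
    apply: (lin_span_eq l1 l2 _ (hcomp_span (gm_gr L) w)) => u [m um].
    rewrite (hproj_hom _ um); have um' : u \in gm_gr (gshift c L) (m + c).
      by rewrite /= addrK.
    by rewrite (hproj_hom _ um') subr_eq.
  by rewrite (hom_hproj hpsi) wf addr0 hproj_id.
move=> h; apply: fv; rewrite -pf -eps_v -[eps]t'K -ap_act.
have <- := hom_act hpsi (t' eps) (hproj (gm_gr L) (- n - c) w).
by rewrite -[X in psi X]/(gm_act L _ _) h (lin0 (hom_lin hpsi)).
Qed.
End Twist.

Section Swap.
Variables (disp : Order.disp_t) (Lam : porderType disp) (T : tri_basis A Lam).
Variables (t t' : duality A) (t'K : cancel t' t) (tK : cancel t t').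
Variables (c : int) (psiL : gshift c L -> gdual t L).
Hypotheses (hpsiL : is_hom 0 psiL) (psiL_inj : forall w, psiL w = 0 -> w = 0).
Hypothesis psiL_surj : surj psiL.
Variables (l : Lam) (M : gmod (A_at T l)) (N : gmod A).
Variables (iota : M -> N) (ws : weight_space iota) (psi : gshift c N -> gdual t N).
Hypotheses (hpsi : is_hom 0 psi) (psi_inj : forall w, psi w = 0 -> w = 0).
Hypothesis psi_surj : surj psi.
Hypothesis N_lfd : loc_fin_dim N.
Hypotheses (shr_lfd : loc_fin_dim (j_shriek M)) (M_fd : fin_dim (fun _ : M => True)).

Lemma sg_hom (V : gmod A) m d (z : V) : z \in gm_gr V m -> d + n = m ->
  is_hom d (fun y : P => sg y *> z).
Proof.
move=> zm dm; split=> [a u v|a y|e y ye].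
- by rewrite (pr_lin pr) gm_actDl gm_actZl.
- by rewrite (pr_act pr) gm_actA.
have -> : e + d = (e - n) + m by rewrite -dm [d + n]addrC addrA addrNK.
exact: gm_act_hom (pr_deg pr ye) zm.
Qed.

Lemma hom_eq_gen (V : gmod A) (w0 : P) d (g : P -> V) : is_hom d g ->
  (forall y, exists a, y = a *> w0) -> g w0 = 0 -> g = 0.
Proof.
move=> hg gen g0; apply/funext => y; have [a ->] := gen y.
by rewrite (hom_act hg) g0 gm_act0r.
Qed.

Local Notation pr_ := (pair ws hpsi).

(** Evaluation at the generators x0 and w0 embeds both spaces of
    homomorphisms in the standard and costandard modules; contravariance makes
    the pairing of the images nondegenerate. *)
Lemma hom_dim_swap d a b : has_dim (fun g : P -> j_star M => is_hom (- d) g) a ->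
  has_dim (fun g : P -> j_shriek M => is_hom d g) b -> a = b.
Proof.
move=> da db; apply/eqP; rewrite eqn_leq; apply/andP; split.
  have [w0 [w0m ew0 gen]] := tau_generator hpsiL psiL_inj.
  apply: (dim_le_pairing (B := fun g1 g2 => pr_ (g2 x0) (g1 w0)) _ da db).
  - exact: is_hom_axiom.
  - by move=> g2 c0 g g'; apply: pair_r.
  - by move=> g1 c0 g g'; apply: pair_l.
  move=> g1 hg1 h; apply: (hom_eq_gen hg1 gen).
  apply: (pair_nd_r (ws := ws) (hpsi := hpsi) t'K psi_surj N_lfd) => z.
  have gw := hom_deg hg1 w0m.
  apply: (lin_span_eq0 (pair_l ws hpsi _) _ (hcomp_span (gm_gr (j_shriek M)) z)).
  move=> {}z [m zm]; have [mE|mE] := eqVneq m (d + n); last first.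
    by apply: (pair_deg ws hpsi zm gw) => e0; case/eqP: mE; lia.
  have hg2 := sg_hom zm (esym mE); have := h _ hg2.
  by rewrite pair_act -(hom_act hg1) ew0.
have [w0 [w0m ew0 gen]] := tau_inv_generator t'K hpsiL psiL_surj.
apply: (dim_le_pairing (B := fun g2 g1 => pr_ (g2 w0) (g1 x0)) _ db da).
- exact: is_hom_axiom.
- by move=> g1 c0 g g'; apply: pair_l.
- by move=> g2 c0 g g'; apply: pair_r.
move=> g2 hg2 h; apply: (hom_eq_gen hg2 gen).
apply: (pair_nd_l (ws := ws) (hpsi := hpsi) t'K tK psi_surj N_lfd shr_lfd M_fd (hom_deg hg2 w0m)).
move=> phi phid; have e0 : - d + n = - (- n - c + d) - c by lia.
have hg1 := sg_hom phid e0; have := h _ hg1.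
by rewrite -[X in pr_ _ (X *> _)]t'K -pair_act -(hom_act hg2) ew0.
Qed.
End Swap.
End Compare.

(** * Multiplicities of projective covers *)

Section Covers.
Variables (k : closedFieldType) (I : choiceType) (A : galg k I).
Hypothesis A_lfd : alg_loc_fin_dim A.

Lemma irr_lfd (L : gmod A) : irreducible L -> loc_fin_dim L.
Proof.
move=> irrL; have [i [d [v [vd iv v0]]]] := irr_vec irrL.
exact: cyclic_lfd vd iv (fun y => irr_gen y irrL vd v0) A_lfd.
Qed.

Lemma cover_presentation (P L : gmod A) : irreducible L -> proj_cover P L ->
  exists i n (x0 : P) sg, presentation i n x0 sg.
Proof.
move=> irrL [projP [p [hp sp cov]]]; have [i [n [v [vn iv v0]]]] := irr_vec irrL.
have [x px] := sp v; pose x0 := 1_[A]_i *> hproj (gm_gr P) n x.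
have px0 : p x0 = v.
  by rewrite /x0 (hom_act hp) (hom_hproj hp) addr0 px hproj_id.
have x0n : x0 \in gm_gr P n by apply/act_idem_hom/hproj_mem.
have ix0 : 1_[A]_i *> x0 = x0 by rewrite /x0 -gm_actA ga_idem_idem.
have gen : forall y, exists a, y = a *> x0.
  by apply: (cover_gen irrL hp cov x0n); rewrite px0.
by have [sg pr] := projective_presentation projP x0n ix0 gen; exists i, n, x0, sg.
Qed.

Lemma hom_qdim_exists (P L N : gmod A) : irreducible L -> proj_cover P L ->
  loc_fin_dim N -> exists f, hom_qdim P N f.
Proof.
move=> irrL cov Nf; have [i [n [x0 [sg pr]]]] := cover_presentation irrL cov.
have fd d : fin_dim (fun g : P -> N => is_hom d g).
  apply: (hom_fin_dim (pr_hom pr) (pr_idem pr)) => // y.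
  by exists (sg y); rewrite (pr_K pr).
by exists (fun d => projT1 (cid (fd d))) => d; case: cid.
Qed.
End Covers.

Theorem corollary8p4 (k : closedFieldType) (I : choiceType) (A : galg k I)
    (A_lfd : alg_loc_fin_dim A) (A_bb : alg_bounded_below A)
    (disp : Order.disp_t) (Lam : porderType disp) (T : tri_basis A Lam)
    (B : Lam -> Type)
    (Llam : forall l, B l -> gmod (A_at T l))
    (Llam_full : forall l, full_irreducibles (Llam l))
    (Plam : forall l, B l -> gmod (A_at T l))
    (Plam_cover : forall l (b : B l), proj_cover (Plam l b) (Llam l b))
    (L : forall l, B l -> gmod A)
    (L_head : forall l (b : B l), irr_quotient (L l b) (j_shriek (Plam l b)))
    (P : forall l, B l -> gmod A)
    (P_cover : forall l (b : B l), proj_cover (P l b) (L l b)) :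
  (forall l (b : B l),
     delta_flag T (P l b) /\
     forall m (a : B m), exists f : series,
       irr_mult (j_star (Llam m a)) (L l b) f /\
       delta_mult (P l b) (j_star (Llam m a)) (qbar f)) /\
  (forall t : duality A,
     forall l (b : B l) m (a : B m) (c : int),
     gmod_iso (gdual t (L l b)) (gshift c (L l b)) ->
     gmod_iso (gdual t (L m a)) (gshift c (L m a)) ->
     exists f : series,
       irr_mult (j_shriek (Llam m a)) (L l b) f /\
       delta_mult (P l b) (j_star (Llam m a)) f).
Proof.
have irrL l (b : B l) : irreducible (L l b) by case: (L_head l b).
have irrLl m (a : B m) : irreducible (Llam m a) by case: (Llam_full m).
have lfdL l (b : B l) : loc_fin_dim (L l b) by apply: irr_lfd.
have std m (a : B m) := irr_standard_lfd A_lfd A_bb (irrLl m a).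
have mult l (b : B l) N f : hom_qdim (P l b) N f -> irr_mult N (L l b) f.
  have [projP [p [hp sp cov]]] := P_cover l b.
  exact: (irr_mult_hom projP (irrL l b) hp sp cov (lfdL l b)).
split=> [l b|t l b m a c isoL isoN].
  split=> [|m a].
    have [i [n [x0 [sg pr]]]] := cover_presentation (irrL l b) (P_cover l b).
    exact: presentation_flag pr A_lfd A_bb.
  have [f hf] := hom_qdim_exists (irrL l b) (P_cover l b) (std m a).2.
  by exists f; split; [apply: mult|exists f].
have [f hf] := hom_qdim_exists (irrL l b) (P_cover l b) (std m a).1.
have [h hh] := hom_qdim_exists (irrL l b) (P_cover l b) (std m a).2.
exists f; split; first exact: mult.
exists h => //; apply/funext => d.
have [i [n [x0 [sg pr]]]] := cover_presentation (irrL l b) (P_cover l b).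
have [_ [p [hp sp cov]]] := P_cover l b.
have [t' [t'K tK]] := duality_inv t.
have [psiL [hpsiL injL surjL]] := gmod_iso_hom (gmod_iso_sym isoL).
have [psiN [hpsiN _ surjN]] := gmod_iso_hom (gmod_iso_sym isoN).
have [_ [q [hq sq]]] := L_head m a.
have [_ [pm [hpm spm covm]]] := Plam_cover m a.
have [iota ws] := weight_space_exists (irrLl m a) (irrL m a) hpm spm covm hq sq.
have M_fd : fin_dim (fun _ : Llam m a => True).
  apply: fin_dim_gen => //; apply: irr_unital_fin_gen (irrLl m a).
    exact: A_at_lfd.
  exact: A_at_bb.
apply/esym; exact: (hom_dim_swap pr (irrL l b) (lfdL l b) hp sp cov t'K tK hpsiL injL
  surjL ws hpsiN surjN (lfdL m a) (std m a).1 M_fd (hh (- d)) (hf d)).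
Qed.
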